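(* Let $k$ be an infinite field of characteristic $p\ge0$ and let $\mathcal P$ be the category of strict polynomial functors over $k$. For $r\ge 0$ define functors $\mathbf A_r,\mathbf B_r:\mathcal P\to\mathcal P$ by $\mathbf A_r(M)(V)=M(V\oplus k)_r$ and $\mathbf B_r(M)(V)=M(V)\otimes\Lambda^r(V)$. Then the family $\{\mathbf A_n,\mathbf B_n\}$ defines a weak $H_{\mathbb Z}$-categorification on $\mathcal P$ which categorifies the Fock space representation of $H_{\mathbb Z}$ on $B_{\mathbb Z}$.
   Context: $\mathcal V_k$ is the category of finite-dimensional $k$-vector spaces. Objects of $\mathcal P$ are functors $M:\mathcal V_k\to\mathcal V_k$ such that all maps $\mathrm{Hom}(V,W)\to\mathrm{Hom}(M(V),M(W))$ are polynomial and the degrees of $\mathrm{End}(V)\to\mathrm{End}(M(V))$ are bounded uniformly in $V$; morphisms are natural transformations. $GL(k)$ acts on $M(V\oplus k)$ through $M(1_V\oplus g)$, and $M(V\oplus k)_r$ is the weight $r$ subspace. $B_{\mathbb Z}$ is the ring of symmetric functions in infinitely many variables over $\mathbb Z$, with inner product for which Schur functions are orthonormal; for $b\in B_{\mathbb Z}$, $b$ also denotes multiplication by $b$ and $b^*$ its adjoint operator. $e_r,h_r$ are the elementary and complete symmetric functions. $H_{\mathbb Z}$ is the unital ring generated by symbols $e_r,h_r^*$ ($r\ge1$) with relations $e_re_s=e_se_r$, $h_r^*h_s^*=h_s^*h_r^*$, $h_r^*e_s=e_sh_r^*+e_{s-1}h_{r-1}^*$ (with $e_0=h_0^*=1$); its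 Fock space representation is the action on $B_{\mathbb Z}$ by the corresponding operators. A weak $H_{\mathbb Z}$-categorification of an $H_{\mathbb Z}$-module $N$ is an abelian category $\mathcal V$, functors $A_n,B_n:\mathcal V\to\mathcal V$ ($n\ge0$) and functorial isomorphisms $A_n\circ B_m\cong B_m\circ A_n\oplus B_{m-1}\circ A_{n-1}$, $A_n\circ A_m\cong A_m\circ A_n$, $B_n\circ B_m\cong B_m\circ B_n$, such that $h_n^*\mapsto[A_n]$, $e_n\mapsto[B_n]$ defines a representation of $H_{\mathbb Z}$ on the Grothendieck group $K_0(\mathcal V)$ that is isomorphic to $N$. *)

(* Defs.v *)
From HB Require Import structures.
From mathcomp Require Import all_boot all_order all_algebra.
From mathcomp Require Import boolp classical_sets cardinality.
From mathcomp Require Import generic_quotient mpoly.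

Set Implicit Arguments.
Unset Strict Implicit.
Unset Printing Implicit Defensive.

Import GRing.Theory.
Local Open Scope ring_scope.
Local Open Scope quotient_scope.

Section LinearAlgebra.
Variable k : fieldType.

Lemma homE (U V : vectType k) a (f g : ('Hom(U, V) : vectType k)) x :
  (a *: f + g) x = a *: f x + g x.
Proof. by rewrite add_lfunE scale_lfunE. Qed.

Lemma linfunE (U V : vectType k) (f : U -> V) : linear f -> linfun f =1 f.
Proof.
move=> lf; pose m := GRing.isLinear.Build k U V _ f lf.
pose L : {linear U -> V} := HB.pack f m.
exact: (lfunE L).
Qed.

Lemma subspace_ex (V : vectType k) (S : V -> Prop) :
  S 0 -> (forall a u v, S u -> S v -> S (a *: u + v)) ->
  exists U : {vspace V}, forall v, v \in U <-> S v.
Proof.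
move=> S0 Slin.
have grow n (U : {vspace V}) : (forall v, v \in U -> S v) ->
    (\dim {:V} - \dim U <= n)%N -> exists U : {vspace V}, forall v, v \in U <-> S v.
  elim: n U => [|n IH] U US dU.
    have eU : U = fullv by apply/eqP; rewrite eqEdim subvf -subn_eq0 -leqn0.
    by exists U => v; split=> [/US//|_]; rewrite eU memvf.
  have [all_in|/existsNP[v /not_implyP[Sv /negP vU]]] :=
    pselect (forall v, S v -> v \in U).
    by exists U => v; split; [apply: US|apply: all_in].
  apply: (IH (<[v]> + U)%VS).
    move=> w /memv_addP[_ /vlineP[a ->] [u uU ->]].
    by apply: Slin => //; apply: US.
  have lt : (\dim U < \dim (<[v]> + U))%N.
    rewrite (ltn_leqif (dimv_leqif_sup (addvSr _ _))) subv_add subvv andbT.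
    by apply: contra vU => /subvP; apply; apply: memv_line.
  have le : (\dim (<[v]> + U) <= \dim {:V})%N by apply: dimvS; apply: subvf.
  by rewrite -ltnS; apply: leq_trans dU; rewrite ltn_sub2l // (leq_trans lt).
apply: (grow _ 0%VS _ (leqnn _)) => v; rewrite memv0 => /eqP -> //.
Qed.

Definition subspace (V : vectType k) (S : V -> Prop) (S0 : S 0)
    (Slin : forall a u v, S u -> S v -> S (a *: u + v)) : {vspace V} :=
  projT1 (cid (subspace_ex S0 Slin)).

Lemma subspaceP (V : vectType k) (S : V -> Prop) S0 Slin v :
  v \in subspace (S := S) S0 Slin <-> S v.
Proof. by rewrite /subspace; case: cid. Qed.

Lemma vspan0 (V : vectType k) (S : V -> Prop) :
  forall W : {vspace V}, (forall s, S s -> s \in W) -> 0 \in W.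
Proof. by move=> W _; apply: mem0v. Qed.

Lemma vspan_lin (V : vectType k) (S : V -> Prop) (a : k) (u v : V) :
  (forall W : {vspace V}, (forall s, S s -> s \in W) -> u \in W) ->
  (forall W : {vspace V}, (forall s, S s -> s \in W) -> v \in W) ->
  forall W : {vspace V}, (forall s, S s -> s \in W) -> a *: u + v \in W.
Proof. by move=> hu hv W hW; rewrite memvD ?memvZ ?hu ?hv. Qed.

Definition vspan (V : vectType k) (S : V -> Prop) : {vspace V} :=
  subspace (@vspan0 V S) (@vspan_lin V S).

Lemma vspan_mem (V : vectType k) (S : V -> Prop) s : S s -> s \in vspan S.
Proof. by move=> Ss; apply/subspaceP => W; apply. Qed.

Lemma vspan_sub (V : vectType k) (S : V -> Prop) (W : {vspace V}) :
  (forall s, S s -> s \in W) -> (vspan S <= W)%VS.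
Proof. by move=> SW; apply/subvP => v /subspaceP; apply. Qed.

(* Quotient space V / W, carried by a complement of W. *)
Definition vquot (V : vectType k) (W : {vspace V}) : vectType k :=
  subvs_of (W^C)%VS.

Definition vquot_pi (V : vectType k) (W : {vspace V}) : 'Hom(V, vquot W) :=
  (linfun (vsproj (W^C)%VS) \o daddv_pi (W^C)%VS W)%VF.

Definition vquot_sec (V : vectType k) (W : {vspace V}) : 'Hom(vquot W, V) :=
  linfun (@vsval k V (W^C)%VS).

Lemma vquot_secK (V : vectType k) (W : {vspace V}) v :
  exists2 w, w \in W & vquot_sec W (vquot_pi W v) = v - w.
Proof.
have WC : (W^C :&: W = 0)%VS by rewrite capvC capv_compl.
have WD : v \in (W^C + W)%VS by rewrite addvC addv_complf memvf.
exists (daddv_pi W (W^C)%VS v); first exact: memv_pi.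
rewrite comp_lfunE !lfunE /= vsprojK ?memv_pi //.
by rewrite -{2}(daddv_pi_add WC WD) addrK.
Qed.

Lemma vquot_piK (V : vectType k) (W : {vspace V}) q :
  vquot_pi W (vquot_sec W q) = q.
Proof.
have WC : (W^C :&: W = 0)%VS by rewrite capvC capv_compl.
by rewrite comp_lfunE !lfunE /= daddv_pi_id ?subvsP // vsvalK.
Qed.

Lemma vquot_pi_eq0 (V : vectType k) (W : {vspace V}) v :
  (vquot_pi W v == 0) = (v \in W).
Proof.
have [w wW e] := vquot_secK W v.
apply/eqP/idP => [pi0|vW].
  by move: e; rewrite pi0 linear0 => /esym/eqP; rewrite subr_eq0 => /eqP->.
rewrite -[RHS](vquot_piK (W := W)) -[LHS](vquot_piK (W := W)) linear0.
congr (vquot_pi W _); rewrite e; apply/eqP; rewrite -memv0 -(capv_compl W).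
rewrite memv_cap memvB //= -e lfunE; exact: subvsP.
Qed.

(* U ⊗ V for finite-dimensional U and V, modelled as Hom(U^*, V), with
   u ⊗ v the map phi |-> phi(u) v. *)
Definition dual (V : vectType k) : vectType k := 'Hom(V, k^o).

Definition tens (U V : vectType k) : vectType k := 'Hom(dual U, V).

Definition pure (U V : vectType k) (u : U) (v : V) : tens U V :=
  linfun (fun phi : dual U => (phi u : k) *: v).

Definition tens_map (U U' V V' : vectType k) (f : 'Hom(U, U'))
    (g : 'Hom(V, V')) : 'Hom(tens U V, tens U' V') :=
  linfun (fun t : tens U V =>
    linfun (fun phi : dual U' => g (t (phi \o f)%VF)) : tens U' V').

Lemma pureE (U V : vectType k) (u : U) (v : V) phi :
  pure u v phi = (phi u : k) *: v.
Proof.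
by rewrite linfunE // => a p q; rewrite homE scalerDl scalerA.
Qed.

Lemma tens_mapE (U U' V V' : vectType k) (f : 'Hom(U, U')) (g : 'Hom(V, V'))
  (t : tens U V) (phi : dual U') :
  tens_map f g t phi = g (t (phi \o f)%VF).
Proof.
have lin2 (s : tens U V) : linear (fun phi : dual U' => g (s (phi \o f)%VF)).
  by move=> a p q; rewrite comp_lfunDl -comp_lfunZl !linearP.
rewrite linfunE; first by rewrite linfunE.
move=> a s s'; apply/lfunP => p.
rewrite (linfunE (lin2 _)) homE linearP; symmetry; etransitivity; first exact: homE.
by rewrite !(linfunE (lin2 _)).
Qed.

Lemma tens_map_pure (U U' V V' : vectType k) (f : 'Hom(U, U'))
    (g : 'Hom(V, V')) u v :
  tens_map f g (pure u v) = pure (f u) (g v).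
Proof. by apply/lfunP => p; rewrite tens_mapE !pureE linearZ comp_lfunE. Qed.

Lemma tens_map_id (U V : vectType k) : tens_map (\1 : 'End(U)) (\1 : 'End(V)) = \1%VF.
Proof.
by apply/lfunP => t; apply/lfunP => p; rewrite tens_mapE !id_lfunE comp_lfun1r.
Qed.

Lemma tens_map_comp (U U' U'' V V' V'' : vectType k)
  (f' : 'Hom(U', U'')) (f : 'Hom(U, U')) (g' : 'Hom(V', V'')) (g : 'Hom(V, V')) :
  tens_map (f' \o f)%VF (g' \o g)%VF = (tens_map f' g' \o tens_map f g)%VF.
Proof.
apply/lfunP => t; apply/lfunP => p.
by rewrite comp_lfunE !tens_mapE comp_lfunE comp_lfunA.
Qed.

Lemma tens_mapPl (U U' V V' : vectType k) (g : 'Hom(V, V')) :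
  linear (fun f : 'Hom(U, U') => tens_map f g).
Proof.
move=> a f f'; apply/lfunP => t; apply/lfunP => p.
rewrite !homE !tens_mapE comp_lfunDr -comp_lfunZr.
by rewrite !linearP.
Qed.

Lemma tens_mapPr (U U' V V' : vectType k) (f : 'Hom(U, U')) :
  linear (fun g : 'Hom(V, V') => tens_map f g).
Proof.
move=> a g g'; apply/lfunP => t; apply/lfunP => p.
by rewrite !homE !tens_mapE homE.
Qed.

Fixpoint tpow (r : nat) (V : vectType k) : vectType k :=
  if r is r'.+1 then tens V (tpow r' V) else k^o.

Fixpoint tpure (V : vectType k) (r : nat) (v : nat -> V) : tpow r V :=
  if r is r'.+1 then pure (v 0%N) (tpure r' (fun i => v i.+1)) else (1 : k^o).

Fixpoint tpow_map (r : nat) (U V : vectType k) (f : 'Hom(U, V)) :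
    'Hom(tpow r U, tpow r V) :=
  if r is r'.+1 then tens_map f (tpow_map r' f) else \1%VF.

Lemma tpow_map_id r (U : vectType k) : tpow_map r (\1 : 'End(U)) = \1%VF.
Proof. by elim: r => //= r ->; rewrite tens_map_id. Qed.

Lemma tpow_map_comp r (U V W : vectType k) (f : 'Hom(V, W)) (g : 'Hom(U, V)) :
  tpow_map r (f \o g)%VF = (tpow_map r f \o tpow_map r g)%VF.
Proof.
elim: r => [|r IH] /=; first by rewrite comp_lfun1l.
by rewrite IH tens_map_comp.
Qed.

Lemma tpow_map_pure r (U V : vectType k) (f : 'Hom(U, V)) (v : nat -> U) :
  tpow_map r f (tpure r v) = tpure r (fun i => f (v i)).
Proof.
by elim: r v => [|r IH] v /=; rewrite ?id_lfunE // tens_map_pure IH.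
Qed.

(* The exterior power is the quotient of the r-th tensor power by the span of
   the v_0 ⊗ ... ⊗ v_(r-1) with a repeated factor. *)
Definition alt_rel (r : nat) (V : vectType k) : {vspace tpow r V} :=
  vspan (fun t => exists v : nat -> V,
    (exists i j, [/\ (i < j)%N, (j < r)%N & v i = v j]) /\ t = tpure r v).

Definition ext (r : nat) (V : vectType k) : vectType k := vquot (alt_rel r V).

Definition ext_map (r : nat) (U V : vectType k) (f : 'Hom(U, V)) :
    'Hom(ext r U, ext r V) :=
  (vquot_pi (alt_rel r V) \o (tpow_map r f \o vquot_sec (alt_rel r U)))%VF.

Lemma alt_rel_map r (U V : vectType k) (f : 'Hom(U, V)) t :
  t \in alt_rel r U -> tpow_map r f t \in alt_rel r V.
Proof.
rewrite memv_preim; move: t; apply/subvP/vspan_sub => _ [v [[i [j [ij jr vij]]] ->]].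
rewrite -memv_preim tpow_map_pure; apply: vspan_mem; exists (fun i => f (v i)).
by split=> //; exists i, j; rewrite vij.
Qed.

Lemma ext_map_pi r (U V : vectType k) (f : 'Hom(U, V)) t :
  ext_map r f (vquot_pi (alt_rel r U) t) = vquot_pi (alt_rel r V) (tpow_map r f t).
Proof.
transitivity (vquot_pi (alt_rel r V)
    (tpow_map r f (vquot_sec (alt_rel r U) (vquot_pi (alt_rel r U) t)))).
  by etransitivity; [exact: comp_lfunE|congr (vquot_pi _ _); exact: comp_lfunE].
have [w wW ->] := vquot_secK (alt_rel r U) t.
rewrite !linearB /=; have /eqP-> : vquot_pi (alt_rel r V) (tpow_map r f w) == 0.
  by rewrite vquot_pi_eq0 alt_rel_map.
by rewrite subr0.
Qed.

Lemma ext_map_id r (U : vectType k) : ext_map r (\1 : 'End(U)) = \1%VF.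
Proof.
by apply/lfunP => q; rewrite -(vquot_piK q) ext_map_pi tpow_map_id !id_lfunE.
Qed.

Lemma ext_map_comp r (U V W : vectType k) (f : 'Hom(V, W)) (g : 'Hom(U, V)) :
  ext_map r (f \o g)%VF = (ext_map r f \o ext_map r g)%VF.
Proof.
apply/lfunP => q; rewrite -(vquot_piK q) ext_map_pi comp_lfunE !ext_map_pi.
by rewrite tpow_map_comp comp_lfunE.
Qed.

Definition dsum_map (U U' V V' : vectType k) (f : 'Hom(U, U'))
    (g : 'Hom(V, V')) : 'Hom((U * V)%type, (U' * V')%type) :=
  linfun (fun x => (f x.1, g x.2)).

Lemma dsum_mapE (U U' V V' : vectType k) (f : 'Hom(U, U')) (g : 'Hom(V, V')) x :
  dsum_map f g x = (f x.1, g x.2).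
Proof. by rewrite linfunE // => a [u v] [u' v'] /=; rewrite !linearP. Qed.

Lemma dsum_map_id (U V : vectType k) : dsum_map (\1 : 'End(U)) (\1 : 'End(V)) = \1%VF.
Proof. by apply/lfunP => -[u v]; rewrite dsum_mapE !id_lfunE. Qed.

Lemma dsum_map_comp (U U' U'' V V' V'' : vectType k)
  (f' : 'Hom(U', U'')) (f : 'Hom(U, U')) (g' : 'Hom(V', V'')) (g : 'Hom(V, V')) :
  dsum_map (f' \o f)%VF (g' \o g)%VF = (dsum_map f' g' \o dsum_map f g)%VF.
Proof. by apply/lfunP => x; rewrite comp_lfunE !dsum_mapE !comp_lfunE. Qed.

End LinearAlgebra.

Section PolynomialMaps.
Variable k : fieldType.

(* Polynomial function of degree at most d, in coordinates; as k is infinite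
   in the application, the polynomial is determined by the function. *)
Definition polyfun_le (d : nat) (U : vectType k) (g : U -> k) : Prop :=
  exists2 p : {mpoly k[\dim {:U}]}, (msize p <= d.+1)%N &
    forall u, g u = p.@[fun i => coord (vbasis {:U}) i u].

Definition polymap_le (d : nat) (U W : vectType k) (f : U -> W) : Prop :=
  forall j, polyfun_le d (fun u => coord (vbasis {:W}) j (f u)).

Definition polymap (U W : vectType k) (f : U -> W) : Prop :=
  exists d, polymap_le d f.

Lemma polyfun_ext d (U : vectType k) (g g' : U -> k) :
  g =1 g' -> polyfun_le d g -> polyfun_le d g'.
Proof. by move=> e [p sp hp]; exists p => // u; rewrite -e. Qed.

Lemma polyfun_leW d d' (U : vectType k) (g : U -> k) : (d <= d')%N ->
  polyfun_le d g -> polyfun_le d' g.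
Proof. by move=> dd [p sp hp]; exists p => //; apply: leq_trans sp _. Qed.

Lemma polyfunC d (U : vectType k) c : polyfun_le d (fun _ : U => c).
Proof. by exists c%:MP; rewrite ?msizeC 1?(leq_trans (leq_b1 _)) // => u; rewrite mevalC. Qed.

Lemma polyfunD d (U : vectType k) (g h : U -> k) :
  polyfun_le d g -> polyfun_le d h -> polyfun_le d (fun u => g u + h u).
Proof.
move=> [p sp hp] [q sq hq]; exists (p + q).
  by rewrite (leq_trans (msizeD_le _ _)) // geq_max sp.
by move=> u; rewrite mevalD hp hq.
Qed.

Lemma polyfunM d e (U : vectType k) (g h : U -> k) :
  polyfun_le d g -> polyfun_le e h -> polyfun_le (d + e) (fun u => g u * h u).
Proof.
move=> [p sp hp] [q sq hq]; exists (p * q); last first.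
  by move=> u; rewrite mevalM hp hq.
have [->|p0] := eqVneq p 0; first by rewrite mul0r msize0.
have [->|q0] := eqVneq q 0; first by rewrite mulr0 msize0.
rewrite msizeM // -ltnS prednK; last by rewrite addn_gt0 !lt0n !msize_poly_eq0 p0.
by rewrite -addSn -addnS leq_add.
Qed.

Lemma polyfun_sum d (U : vectType k) (I : Type) (r : seq I) (P : pred I) (g : I -> U -> k) :
  (forall i, P i -> polyfun_le d (g i)) -> polyfun_le d (fun u => \sum_(i <- r | P i) g i u).
Proof.
move=> hg; elim: r => [|i r IH].
  by apply: polyfun_ext (polyfunC _ _ 0) => u; rewrite big_nil.
case Pi: (P i).
  by apply: polyfun_ext (polyfunD (hg i Pi) IH) => u; rewrite big_cons Pi.
by apply: polyfun_ext IH => u; rewrite big_cons Pi.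
Qed.

Lemma polyfun_prod (U : vectType k) (I : Type) (r : seq I) (g : I -> U -> k) (d : I -> nat) :
  (forall i, polyfun_le (d i) (g i)) ->
  polyfun_le (\sum_(i <- r) d i)%N (fun u => \prod_(i <- r) g i u).
Proof.
move=> hg; elim: r => [|i r IH].
  by rewrite big_nil; apply: polyfun_ext (polyfunC _ _ 1) => u; rewrite big_nil.
rewrite big_cons.
by apply: polyfun_ext (polyfunM (hg i) IH) => u; rewrite big_cons.
Qed.

Lemma polyfun_exp (U : vectType k) (g : U -> k) n :
  polyfun_le 1 g -> polyfun_le n (fun u => g u ^+ n).
Proof.
move=> hg; elim: n => [|n IH]; first exact: polyfunC.
by apply: polyfun_ext (polyfunM hg IH) => u; rewrite exprS.
Qed.

Lemma polyfun_coord (U : vectType k) i :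
  polyfun_le 1 (fun u => coord (vbasis {:U}) i u).
Proof. by exists 'X_i; rewrite ?msizeX ?mdeg1 // => u; rewrite mevalXU. Qed.

Lemma polyfun_comp d (U W : vectType k) (g : W -> k) (f : U -> W) :
  polyfun_le d g -> polymap_le 1 f -> polyfun_le d (fun u => g (f u)).
Proof.
move=> [p sp hp] hf.
apply: (@polyfun_ext _ _ (fun u => \sum_(m <- msupp p) p@_m *
    \prod_i coord (vbasis {:W}) i (f u) ^+ m i)).
  by move=> u; rewrite hp mevalE.
suff : polyfun_le d (fun u => \sum_(m <- msupp p | (mdeg m <= d)%N) p@_m *
    \prod_i coord (vbasis {:W}) i (f u) ^+ m i).
  apply: polyfun_ext => u; rewrite big_seq_cond [RHS]big_seq.
  apply: eq_bigl => m; case mp: (m \in msupp p) => //=.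
  by rewrite -ltnS (leq_trans _ sp) // msize_mdeg_lt.
apply: polyfun_sum => m md; rewrite -(add0n d); apply: polyfunM (polyfunC _ _ _) _.
apply: polyfun_leW md _; rewrite mdegE.
by apply: polyfun_prod => i; apply: polyfun_exp; apply: hf.
Qed.

Lemma vbasisE (U : vectType k) (u : U) :
  u = \sum_i coord (vbasis {:U}) i u *: (vbasis {:U})`_i.
Proof. by rewrite -coord_vbasis // memvf. Qed.

Lemma polyfun_lfun d (U W : vectType k) (f : U -> W) (l : W -> k) :
  polymap_le d f -> linear (l : W -> k^o) -> polyfun_le d (fun u => l (f u)).
Proof.
move=> hf hl.
pose L : 'Hom(W, k^o) := linfun (l : W -> k^o).
have LE w : l w = L w by rewrite (linfunE hl).
apply: (@polyfun_ext _ _ (fun u => \sum_i coord (vbasis {:W}) i (f u) * l (vbasis {:W})`_i)).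
  move=> u; rewrite LE {2}(vbasisE (f u)) linear_sum; apply: eq_bigr => i _.
  by rewrite linearZ LE.
apply: polyfun_sum => i _; rewrite -(addn0 d).
exact: polyfunM (hf i) (polyfunC _ _ _).
Qed.

Lemma polymap_ext d (U W : vectType k) (f f' : U -> W) :
  f =1 f' -> polymap_le d f -> polymap_le d f'.
Proof. by move=> e hf j; apply: polyfun_ext (hf j) => u; rewrite e. Qed.

Lemma polymap_leW d d' (U W : vectType k) (f : U -> W) : (d <= d')%N ->
  polymap_le d f -> polymap_le d' f.
Proof. by move=> dd hf j; apply: polyfun_leW (hf j). Qed.

Lemma polymap_lin (U W : vectType k) (f : U -> W) :
  linear f -> polymap_le 1 f.
Proof.
move=> lf j; apply: (@polyfun_lfun 1 U U id (fun u => coord (vbasis {:W}) j (f u))).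
  exact: polyfun_coord.
by move=> a u v; rewrite lf linearP.
Qed.

Lemma polymapC d (U W : vectType k) (w : W) : polymap_le d (fun _ : U => w).
Proof. by move=> j; apply: polyfunC. Qed.

Lemma polymapD d (U W : vectType k) (f g : U -> W) :
  polymap_le d f -> polymap_le d g -> polymap_le d (fun u => f u + g u).
Proof.
by move=> hf hg j; apply: polyfun_ext (polyfunD (hf j) (hg j)) => u; rewrite linearD.
Qed.

Lemma polymap_postlin d (U W X : vectType k) (f : U -> W) (l : W -> X) :
  polymap_le d f -> linear l -> polymap_le d (fun u => l (f u)).
Proof.
move=> hf hl j; apply: (polyfun_lfun (l := fun w => coord (vbasis {:X}) j (l w)) hf).
by move=> a u v; rewrite hl linearP.
Qed.

Lemma polymap_comp d (U W X : vectType k) (g : W -> X) (f : U -> W) :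
  polymap_le d g -> polymap_le 1 f -> polymap_le d (fun u => g (f u)).
Proof. by move=> hg hf j; apply: polyfun_comp (hg j) hf. Qed.

Lemma polymap_bilin d e (U W1 W2 X : vectType k) (b : W1 -> W2 -> X)
    (f : U -> W1) (g : U -> W2) :
  (forall w, linear (b w)) -> (forall w, linear (b^~ w)) ->
  polymap_le d f -> polymap_le e g -> polymap_le (d + e) (fun u => b (f u) (g u)).
Proof.
move=> lb1 lb2 hf hg j.
pose c i i' := coord (vbasis {:X}) j (b (vbasis {:W1})`_i (vbasis {:W2})`_i').
apply: (@polyfun_ext _ _ (fun u => \sum_i \sum_i'
   (coord (vbasis {:W1}) i (f u) * coord (vbasis {:W2}) i' (g u)) * c i i')).
  move=> u.
  pose B1 : 'Hom(W1, X) := linfun (b^~ (g u)).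
  have B1E w : b w (g u) = B1 w by rewrite (linfunE (lb2 _)).
  rewrite B1E {2}(vbasisE (f u)) !linear_sum; apply: eq_bigr => i _.
  rewrite !linearZ /= -B1E.
  pose B2 : 'Hom(W2, X) := linfun (b (vbasis {:W1})`_i).
  have B2E w : b (vbasis {:W1})`_i w = B2 w by rewrite (linfunE (lb1 _)).
  rewrite B2E {2}(vbasisE (g u)) !linear_sum mulr_sumr; apply: eq_bigr => i' _.
  by rewrite !linearZ /= -B2E mulrA.
apply: polyfun_sum => i _; apply: polyfun_sum => i' _.
by rewrite -(addn0 (d + e)%N); apply: polyfunM (polyfunM (hf i) (hg i')) (polyfunC _ _ _).
Qed.

End PolynomialMaps.

(* The objects of P form a type too large to be the carrier of a MathComp
   structure, so the abelian groups attached to categories (groups of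
   morphisms, Grothendieck groups) have their own record. *)
Record abgroup := AbGroup {
  gsort :> Type;
  gzero : gsort;
  gopp : gsort -> gsort;
  gadd : gsort -> gsort -> gsort;
  gaddA : associative gadd;
  gaddC : commutative gadd;
  gadd0 : left_id gzero gadd;
  gaddN : left_inverse gzero gopp gadd
}.
Arguments gzero {a}.
Arguments gopp {a}.
Arguments gadd {a}.

Definition zmod_abgroup (V : zmodType) : abgroup :=
  AbGroup (@addrA V) (@addrC V) (@add0r V) (@addNr V).

Record preadditive := Preadditive {
  ob :> Type;
  hom : ob -> ob -> abgroup;
  idm : forall X, hom X X;
  comp : forall X Y Z, hom Y Z -> hom X Y -> hom X Z;
  compA : forall X Y Z T (h : hom Z T) (g : hom Y Z) (f : hom X Y),
    comp h (comp g f) = comp (comp h g) f;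
  comp1m : forall X Y (f : hom X Y), comp (idm Y) f = f;
  compm1 : forall X Y (f : hom X Y), comp f (idm X) = f;
  compDl : forall X Y Z (g g' : hom Y Z) (f : hom X Y),
    comp (gadd g g') f = gadd (comp g f) (comp g' f);
  compDr : forall X Y Z (g : hom Y Z) (f f' : hom X Y),
    comp g (gadd f f') = gadd (comp g f) (comp g f')
}.
Arguments hom {p}.
Arguments idm {p}.
Arguments comp {p X Y Z}.

Declare Scope cat_scope.
Delimit Scope cat_scope with cat.
Local Notation "g ∘ f" := (comp g f) (at level 40, left associativity) : cat_scope.
Local Notation "0" := gzero : cat_scope.
Local Notation "f + g" := (gadd f g) : cat_scope.

Section Categories.
Local Open Scope cat_scope.

Definition mono (C : preadditive) (X Y : C) (f : hom X Y) : Prop :=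
  forall (W : C) (g h : hom W X), f ∘ g = f ∘ h -> g = h.

Definition epi (C : preadditive) (X Y : C) (f : hom X Y) : Prop :=
  forall (W : C) (g h : hom Y W), g ∘ f = h ∘ f -> g = h.

Definition is_kernel (C : preadditive) (K X Y : C) (i : hom K X) (f : hom X Y) :=
  f ∘ i = 0 /\
  forall (W : C) (g : hom W X), f ∘ g = 0 -> exists! h : hom W K, i ∘ h = g.

Definition is_cokernel (C : preadditive) (X Y Q : C) (p : hom Y Q) (f : hom X Y) :=
  p ∘ f = 0 /\
  forall (W : C) (g : hom Y W), g ∘ f = 0 -> exists! h : hom Q W, h ∘ p = g.

Definition is_biproduct (C : preadditive) (X1 X2 Y : C)
    (i1 : hom X1 Y) (i2 : hom X2 Y) (p1 : hom Y X1) (p2 : hom Y X2) : Prop :=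
  [/\ p1 ∘ i1 = idm X1, p2 ∘ i2 = idm X2, p1 ∘ i2 = 0, p2 ∘ i1 = 0 &
      i1 ∘ p1 + i2 ∘ p2 = idm Y].

Record abelian (C : preadditive) : Prop := Abelian {
  has_zero : exists Z : C, idm Z = 0;
  has_biproducts : forall X1 X2 : C, exists Y : C,
    exists (i1 : hom X1 Y) (i2 : hom X2 Y) (p1 : hom Y X1) (p2 : hom Y X2),
      is_biproduct i1 i2 p1 p2;
  has_kernels : forall (X Y : C) (f : hom X Y),
    exists (K : C) (i : hom K X), is_kernel i f;
  has_cokernels : forall (X Y : C) (f : hom X Y),
    exists (Q : C) (p : hom Y Q), is_cokernel p f;
  mono_normal : forall (X Y : C) (f : hom X Y), mono f ->
    exists (Z : C) (g : hom Y Z), is_kernel f g;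
  epi_normal : forall (X Y : C) (f : hom X Y), epi f ->
    exists (Z : C) (g : hom Z X), is_cokernel f g
}.

Definition short_exact (C : preadditive) (X Y Z : C) (i : hom X Y) (p : hom Y Z) :=
  is_kernel i p /\ is_cokernel p i.

Record functor (C D : preadditive) := Functor {
  fob :> C -> D;
  fmap : forall X Y : C, hom X Y -> hom (fob X) (fob Y);
  fmap1 : forall X, fmap (idm X) = idm (fob X);
  fmapM : forall (X Y Z : C) (g : hom Y Z) (f : hom X Y),
    fmap (g ∘ f) = fmap g ∘ fmap f
}.

Lemma fcomp1 (C D E : preadditive) (G : functor D E) (F : functor C D) (X : C) :
  fmap G (fmap F (idm X)) = idm (G (F X)).
Proof. by rewrite !fmap1. Qed.

Lemma fcompM (C D E : preadditive) (G : functor D E) (F : functor C D)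
    (X Y Z : C) (g : hom Y Z) (f : hom X Y) :
  fmap G (fmap F (g ∘ f)) = fmap G (fmap F g) ∘ fmap G (fmap F f).
Proof. by rewrite !fmapM. Qed.

Definition fcomp (C D E : preadditive) (G : functor D E) (F : functor C D) :
    functor C E :=
  Functor (fob := fun X => G (F X)) (fcomp1 G F) (fcompM G F).

Definition natural (C D : preadditive) (F G : functor C D)
    (t : forall X, hom (F X) (G X)) : Prop :=
  forall (X Y : C) (f : hom X Y), t Y ∘ fmap F f = fmap G f ∘ t X.

Definition nat_iso (C D : preadditive) (F G : functor C D) : Prop :=
  exists (t : forall X, hom (F X) (G X)) (s : forall X, hom (G X) (F X)),
  natural t /\ forall X, s X ∘ t X = idm (F X) /\ t X ∘ s X = idm (G X).

(* F is isomorphic to the direct sum of G and H. *)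
Definition nat_iso_sum (C D : preadditive) (F G H : functor C D) : Prop :=
  exists (i1 : forall X, hom (G X) (F X)) (i2 : forall X, hom (H X) (F X))
         (p1 : forall X, hom (F X) (G X)) (p2 : forall X, hom (F X) (H X)),
  [/\ natural i1, natural i2, natural p1, natural p2 &
      forall X, is_biproduct (i1 X) (i2 X) (p1 X) (p2 X)].

End Categories.

Section GrothendieckGroup.
Variable C : preadditive.

Inductive gterm :=
  GVar of C | GZero | GOpp of gterm | GAdd of gterm & gterm.

Inductive K0_eq : gterm -> gterm -> Prop :=
| K0_refl s : K0_eq s s
| K0_sym s t : K0_eq s t -> K0_eq t s
| K0_trans s t u : K0_eq s t -> K0_eq t u -> K0_eq s u
| K0_opp s s' : K0_eq s s' -> K0_eq (GOpp s) (GOpp s')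
| K0_add s s' t t' : K0_eq s s' -> K0_eq t t' -> K0_eq (GAdd s t) (GAdd s' t')
| K0_addA s t u : K0_eq (GAdd s (GAdd t u)) (GAdd (GAdd s t) u)
| K0_addC s t : K0_eq (GAdd s t) (GAdd t s)
| K0_add0 s : K0_eq (GAdd GZero s) s
| K0_addN s : K0_eq (GAdd (GOpp s) s) GZero
| K0_ses (X Y Z : C) (i : hom X Y) (p : hom Y Z) : short_exact i p ->
    K0_eq (GVar Y) (GAdd (GVar X) (GVar Z)).

Definition K0_sort := {S : gterm -> Prop | exists s, S = K0_eq s}.

Definition K0_class (s : gterm) : K0_sort :=
  exist _ (K0_eq s) (ex_intro _ s erefl).

Definition K0_repr (a : K0_sort) : gterm := projT1 (cid (proj2_sig a)).

Lemma K0_sort_eq (a b : K0_sort) : proj1_sig a = proj1_sig b -> a = b.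
Proof.
case: a b => [S hS] [T hT] /= eST; move: hS hT; rewrite eST => hS hT.
by congr exist; apply: Prop_irrelevance.
Qed.

Lemma K0_class_eq s t : K0_eq s t -> K0_class s = K0_class t.
Proof.
move=> st; apply: K0_sort_eq; apply: functional_extensionality_dep => u.
apply: propositional_extensionality.
by split=> h; [apply: K0_trans (K0_sym st) h|apply: K0_trans st h].
Qed.

Lemma K0_reprK a : K0_class (K0_repr a) = a.
Proof.
by apply: K0_sort_eq; rewrite /K0_repr; case: cid => s /= ->.
Qed.

Lemma K0_classK s : K0_eq (K0_repr (K0_class s)) s.
Proof.
have : K0_class (K0_repr (K0_class s)) = K0_class s by exact: K0_reprK.
by move=> /(congr1 (@proj1_sig _ _)) /= ->; apply: K0_refl.
Qed.

Definition K0_gadd (a b : K0_sort) := K0_class (GAdd (K0_repr a) (K0_repr b)).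
Definition K0_gopp (a : K0_sort) := K0_class (GOpp (K0_repr a)).

Lemma K0_gaddA : associative K0_gadd.
Proof.
move=> a b c; apply: K0_class_eq.
apply: K0_trans (K0_add (K0_refl _) (K0_classK _)) _.
apply: K0_trans (K0_addA _ _ _) _.
exact: K0_add (K0_sym (K0_classK _)) (K0_refl _).
Qed.

Lemma K0_gaddC : commutative K0_gadd.
Proof. by move=> a b; apply: K0_class_eq; apply: K0_addC. Qed.

Lemma K0_gadd0 : left_id (K0_class GZero) K0_gadd.
Proof.
move=> a; rewrite -[RHS]K0_reprK; apply: K0_class_eq.
exact: K0_trans (K0_add (K0_classK _) (K0_refl _)) (K0_add0 _).
Qed.

Lemma K0_gaddN : left_inverse (K0_class GZero) K0_gopp K0_gadd.
Proof.
move=> a; apply: K0_class_eq.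
exact: K0_trans (K0_add (K0_classK _) (K0_refl _)) (K0_addN _).
Qed.

Definition K0 : abgroup := AbGroup K0_gaddA K0_gaddC K0_gadd0 K0_gaddN.

Definition K0_ob (X : C) : K0 := K0_class (GVar X).

End GrothendieckGroup.

Section PolynomialFunctors.
Variable k : fieldType.

Record polyfunctor := PolyFunctor {
  pob :> vectType k -> vectType k;
  pmap : forall V W : vectType k, 'Hom(V, W) -> 'Hom(pob V, pob W);
  pmap1 : forall V : vectType k, pmap (\1 : 'End(V)) = \1%VF;
  pmapM : forall (U V W : vectType k) (g : 'Hom(V, W)) (f : 'Hom(U, V)),
    pmap (g \o f)%VF = (pmap g \o pmap f)%VF;
  pmap_poly : forall V W : vectType k, polymap (@pmap V W);
  pmap_deg : exists d, forall V : vectType k, polymap_le d (@pmap V V)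
}.

Record nattrans (M N : polyfunctor) := NatTrans {
  ncomp :> forall V : vectType k, 'Hom(M V, N V);
  ncompP : forall (V W : vectType k) (f : 'Hom(V, W)),
    (ncomp W \o pmap M f = pmap N f \o ncomp V)%VF
}.

Lemma nattransP (M N : polyfunctor) (s t : nattrans M N) :
  (forall V, s V = t V) -> s = t.
Proof.
case: s t => [s sP] [t tP] /= st.
have est : s = t by apply: functional_extensionality_dep.
by move: sP tP; rewrite est => sP tP; congr NatTrans; apply: Prop_irrelevance.
Qed.

Section NatTransGroup.
Variables M N : polyfunctor.

Lemma nt_zeroP (V W : vectType k) (f : 'Hom(V, W)) :
  ((0 : 'Hom(M W, N W)) \o pmap M f = pmap N f \o (0 : 'Hom(M V, N V)))%VF.
Proof. by rewrite comp_lfun0l comp_lfun0r. Qed.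

Definition nt_zero : nattrans M N := NatTrans nt_zeroP.

Lemma nt_oppP (t : nattrans M N) (V W : vectType k) (f : 'Hom(V, W)) :
  ((- t W) \o pmap M f = pmap N f \o (- t V))%VF.
Proof. by rewrite comp_lfunNl comp_lfunNr ncompP. Qed.

Definition nt_opp (t : nattrans M N) : nattrans M N := NatTrans (nt_oppP t).

Lemma nt_addP (s t : nattrans M N) (V W : vectType k) (f : 'Hom(V, W)) :
  ((s W + t W) \o pmap M f = pmap N f \o (s V + t V))%VF.
Proof. by rewrite comp_lfunDl comp_lfunDr !ncompP. Qed.

Definition nt_add (s t : nattrans M N) : nattrans M N := NatTrans (nt_addP s t).

Lemma nt_addA : associative nt_add.
Proof. by move=> s t u; apply: nattransP => V /=; rewrite addrA. Qed.

Lemma nt_addC : commutative nt_add.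
Proof. by move=> s t; apply: nattransP => V /=; rewrite addrC. Qed.

Lemma nt_add0 : left_id nt_zero nt_add.
Proof. by move=> s; apply: nattransP => V /=; rewrite add0r. Qed.

Lemma nt_addN : left_inverse nt_zero nt_opp nt_add.
Proof. by move=> s; apply: nattransP => V /=; rewrite addNr. Qed.

Definition nt_group : abgroup := AbGroup nt_addA nt_addC nt_add0 nt_addN.

End NatTransGroup.

Lemma nt_idP (M : polyfunctor) (V W : vectType k) (f : 'Hom(V, W)) :
  (\1 \o pmap M f = pmap M f \o \1)%VF.
Proof. by rewrite comp_lfun1l comp_lfun1r. Qed.

Definition nt_id (M : polyfunctor) : nattrans M M := NatTrans (@nt_idP M).

Lemma nt_compP (L M N : polyfunctor) (t : nattrans M N) (s : nattrans L M)
    (V W : vectType k) (f : 'Hom(V, W)) :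
  ((t W \o s W) \o pmap L f = pmap N f \o (t V \o s V))%VF.
Proof. by rewrite -comp_lfunA ncompP comp_lfunA ncompP comp_lfunA. Qed.

Definition nt_comp (L M N : polyfunctor) (t : nattrans M N) (s : nattrans L M) :
  nattrans L N := NatTrans (nt_compP t s).

Lemma nt_compA (K L M N : polyfunctor) (u : nattrans M N) (t : nattrans L M)
  (s : nattrans K L) : nt_comp u (nt_comp t s) = nt_comp (nt_comp u t) s.
Proof. by apply: nattransP => V /=; rewrite comp_lfunA. Qed.

Lemma nt_comp1m (M N : polyfunctor) (t : nattrans M N) : nt_comp (nt_id N) t = t.
Proof. by apply: nattransP => V /=; rewrite comp_lfun1l. Qed.

Lemma nt_compm1 (M N : polyfunctor) (t : nattrans M N) : nt_comp t (nt_id M) = t.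
Proof. by apply: nattransP => V /=; rewrite comp_lfun1r. Qed.

Lemma nt_compDl (L M N : polyfunctor) (t t' : nattrans M N) (s : nattrans L M) :
  nt_comp (nt_add t t') s = nt_add (nt_comp t s) (nt_comp t' s).
Proof. by apply: nattransP => V /=; rewrite comp_lfunDl. Qed.

Lemma nt_compDr (L M N : polyfunctor) (t : nattrans M N) (s s' : nattrans L M) :
  nt_comp t (nt_add s s') = nt_add (nt_comp t s) (nt_comp t s').
Proof. by apply: nattransP => V /=; rewrite comp_lfunDr. Qed.

Definition polyfunctor_cat : preadditive :=
  @Preadditive polyfunctor nt_group nt_id nt_comp nt_compA nt_comp1m nt_compm1
    nt_compDl nt_compDr.

End PolynomialFunctors.

Inductive hterm :=
| HE of nat       (* HE r is the generator e_(r+1) *)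
| HH of nat       (* HH r is the generator h_(r+1)^* *)
| HZero | HOne | HOpp of hterm | HAdd of hterm & hterm | HMul of hterm & hterm.

Definition he (r : nat) : hterm := if r is r'.+1 then HE r' else HOne.
Definition hh (r : nat) : hterm := if r is r'.+1 then HH r' else HOne.

Inductive hrel : hterm -> hterm -> Prop :=
| hrel_refl s : hrel s s
| hrel_sym s t : hrel s t -> hrel t s
| hrel_trans s t u : hrel s t -> hrel t u -> hrel s u
| hrel_opp s s' : hrel s s' -> hrel (HOpp s) (HOpp s')
| hrel_add s s' t t' : hrel s s' -> hrel t t' -> hrel (HAdd s t) (HAdd s' t')
| hrel_mul s s' t t' : hrel s s' -> hrel t t' -> hrel (HMul s t) (HMul s' t')
| hrel_addA s t u : hrel (HAdd s (HAdd t u)) (HAdd (HAdd s t) u)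
| hrel_addC s t : hrel (HAdd s t) (HAdd t s)
| hrel_add0 s : hrel (HAdd HZero s) s
| hrel_addN s : hrel (HAdd (HOpp s) s) HZero
| hrel_mulA s t u : hrel (HMul s (HMul t u)) (HMul (HMul s t) u)
| hrel_1mul s : hrel (HMul HOne s) s
| hrel_mul1 s : hrel (HMul s HOne) s
| hrel_mulDl s t u : hrel (HMul (HAdd s t) u) (HAdd (HMul s u) (HMul t u))
| hrel_mulDr s t u : hrel (HMul s (HAdd t u)) (HAdd (HMul s t) (HMul s u))
| hrel_ee r s : hrel (HMul (he r.+1) (he s.+1)) (HMul (he s.+1) (he r.+1))
| hrel_hh r s : hrel (HMul (hh r.+1) (hh s.+1)) (HMul (hh s.+1) (hh r.+1))
| hrel_he r s : hrel (HMul (hh r.+1) (he s.+1))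
                     (HAdd (HMul (he s.+1) (hh r.+1)) (HMul (he s) (hh r))).

HB.instance Definition _ := gen_eqMixin hterm.
HB.instance Definition _ := gen_choiceMixin hterm.

Definition hrelb (s t : hterm) : bool := `[< hrel s t >].

Lemma hrelb_equiv : equiv_class_of hrelb.
Proof.
split=> [s|s t|t s u].
- by apply/asboolP; apply: hrel_refl.
- by apply/asboolP/asboolP => h; apply: hrel_sym.
- by move=> /asboolP h /asboolP h'; apply/asboolP; apply: hrel_trans h h'.
Qed.

Canonical hrelb_equivRel := EquivRelPack hrelb_equiv.

Definition HZ := {eq_quot hrelb}.

HB.instance Definition _ : EqQuotient hterm hrelb HZ := EqQuotient.on HZ.
HB.instance Definition _ := Choice.on HZ.

Definition hcl (s : hterm) : HZ := \pi_HZ s.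

Lemma hclP s t : hcl s = hcl t <-> hrel s t.
Proof. by split=> [/eqmodP/asboolP|/asboolP st]; last exact/eqmodP. Qed.

Lemma hclK (x : HZ) : hcl (repr x) = x.
Proof. exact: reprK. Qed.

Lemma hrepr s : hrel (repr (hcl s)) s.
Proof. by apply/hclP; rewrite hclK. Qed.

Definition HZ_zero : HZ := hcl HZero.
Definition HZ_one : HZ := hcl HOne.
Definition HZ_opp (x : HZ) : HZ := hcl (HOpp (repr x)).
Definition HZ_add (x y : HZ) : HZ := hcl (HAdd (repr x) (repr y)).
Definition HZ_mul (x y : HZ) : HZ := hcl (HMul (repr x) (repr y)).

Lemma HZ_oppE s : HZ_opp (hcl s) = hcl (HOpp s).
Proof. by apply/hclP; apply: hrel_opp; apply: hrepr. Qed.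

Lemma HZ_addE s t : HZ_add (hcl s) (hcl t) = hcl (HAdd s t).
Proof. by apply/hclP; apply: hrel_add; apply: hrepr. Qed.

Lemma HZ_mulE s t : HZ_mul (hcl s) (hcl t) = hcl (HMul s t).
Proof. by apply/hclP; apply: hrel_mul; apply: hrepr. Qed.

Local Ltac hz := repeat (let x := fresh "x" in move=> x; rewrite -(hclK x));
  rewrite ?HZ_oppE /HZ_zero /HZ_one ?(HZ_addE, HZ_mulE); apply/hclP.

Lemma HZ_addA : associative HZ_add.
Proof. by hz; apply: hrel_addA. Qed.
Lemma HZ_addC : commutative HZ_add.
Proof. by hz; apply: hrel_addC. Qed.
Lemma HZ_add0 : left_id HZ_zero HZ_add.
Proof. by hz; apply: hrel_add0. Qed.
Lemma HZ_addN : left_inverse HZ_zero HZ_opp HZ_add.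
Proof. by hz; apply: hrel_addN. Qed.
Lemma HZ_mulA : associative HZ_mul.
Proof. by hz; apply: hrel_mulA. Qed.
Lemma HZ_1mul : left_id HZ_one HZ_mul.
Proof. by hz; apply: hrel_1mul. Qed.
Lemma HZ_mul1 : right_id HZ_one HZ_mul.
Proof. by hz; apply: hrel_mul1. Qed.
Lemma HZ_mulDl : left_distributive HZ_mul HZ_add.
Proof. by hz; apply: hrel_mulDl. Qed.
Lemma HZ_mulDr : right_distributive HZ_mul HZ_add.
Proof. by hz; apply: hrel_mulDr. Qed.

HB.instance Definition _ :=
  GRing.isZmodule.Build HZ HZ_addA HZ_addC HZ_add0 HZ_addN.
HB.instance Definition _ :=
  GRing.Zmodule_isPzRing.Build HZ HZ_mulA HZ_1mul HZ_mul1 HZ_mulDl HZ_mulDr.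

(* e_r and h_r^* in H_Z, with e_0 = h_0^* = 1. *)
Definition He (r : nat) : HZ := hcl (he r).
Definition Hh (r : nat) : HZ := hcl (hh r).

Record representation (R : pzRingType) (N : abgroup) := Representation {
  ract :> R -> N -> N;
  ractDr : forall a x y, ract a (gadd x y) = gadd (ract a x) (ract a y);
  ractDl : forall a b x, ract (a + b) x = gadd (ract a x) (ract b x);
  ractM : forall a b x, ract (a * b) x = ract a (ract b x);
  ract1 : forall x, ract 1 x = x
}.

Definition rep_iso (R : pzRingType) (N N' : abgroup)
    (rho : representation R N) (rho' : representation R N') : Prop :=
  exists phi : N -> N', [/\ bijective phi,
    forall x y, phi (gadd x y) = gadd (phi x) (phi y) &
    forall a x, phi (rho a x) = rho' a (phi x)].

(* With A_(-1) = B_(-1) = 0, the isomorphism for A_n o B_m has a single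
   summand when n or m is 0. In wc_K0, rho (Hh n) is the operator [A_n]: it is
   additive, hence determined by its values on the classes of objects. *)
Record weak_HZ_categorification (C : preadditive) (A B : nat -> functor C C)
    (N : abgroup) (Nrep : representation HZ N) : Prop := WeakHZCategorification {
  wc_abelian : abelian C;
  wc_AB : forall n m, nat_iso_sum (fcomp (A n.+1) (B m.+1))
    (fcomp (B m.+1) (A n.+1)) (fcomp (B m) (A n));
  wc_AB0 : forall n m, (n == 0)%N || (m == 0)%N ->
    nat_iso (fcomp (A n) (B m)) (fcomp (B m) (A n));
  wc_AA : forall n m, nat_iso (fcomp (A n) (A m)) (fcomp (A m) (A n));
  wc_BB : forall n m, nat_iso (fcomp (B n) (B m)) (fcomp (B m) (B n));
  wc_K0 : exists rho : representation HZ (K0 C),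
    [/\ forall n (X : C), rho (Hh n) (K0_ob X) = K0_ob (A n X),
        forall n (X : C), rho (He n) (K0_ob X) = K0_ob (B n X) &
        rep_iso rho Nrep]
}.

Definition mrestr (n : nat) (p : {mpoly int[n.+1]}) : {mpoly int[n]} :=
  p \mPo [tuple oapp (fun j : 'I_n => 'X_j) 0 (unlift ord_max i) | i < n.+1].

Lemma mrestrN n (p : {mpoly int[n.+1]}) : mrestr (- p) = - mrestr p.
Proof. exact: raddfN. Qed.

Lemma mrestrD n (p q : {mpoly int[n.+1]}) : mrestr (p + q) = mrestr p + mrestr q.
Proof. exact: raddfD. Qed.

Lemma mrestrM n (p q : {mpoly int[n.+1]}) : mrestr (p * q) = mrestr p * mrestr q.
Proof. exact: rmorphM. Qed.

(* A symmetric function in infinitely many variables is a family of symmetric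
   polynomials in x_0, ..., x_(n-1), n : nat, compatible with setting the last
   variable to 0, and of bounded degree. *)
Definition is_symfun (f : forall n, {mpoly int[n]}) : Prop :=
  [/\ forall n, f n \is symmetric, forall n, mrestr (f n.+1) = f n &
      exists d, forall n, (msize (f n) <= d)%N].

Record symfun := SymFun {
  sfun :> forall n, {mpoly int[n]};
  sfunP : is_symfun sfun
}.

Lemma symfunP (f g : symfun) : (forall n, f n = g n) -> f = g.
Proof.
case: f g => [f fP] [g gP] /= fg.
have efg : f = g by apply: functional_extensionality_dep.
by move: fP gP; rewrite efg => fP gP; congr SymFun; apply: Prop_irrelevance.
Qed.

Section SymFunRing.

Lemma sf_constP (c : int) : is_symfun (fun n => c%:MP).
Proof.
split=> [n|n|]; first by apply/issymP => s; rewrite /msym mmapC.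
  exact: comp_mpolyC.
by exists 1%N => n; rewrite msizeC leq_b1.
Qed.

Definition sf_const (c : int) : symfun := SymFun (sf_constP c).

Lemma sf_oppP (f : symfun) : is_symfun (fun n => - f n).
Proof.
case: (sfunP f) => fs fr [d hd].
split=> [n|n|]; first by rewrite rpredN fs.
  by rewrite mrestrN fr.
by exists d => n; rewrite msizeN.
Qed.

Definition sf_opp (f : symfun) : symfun := SymFun (sf_oppP f).

Lemma sf_addP (f g : symfun) : is_symfun (fun n => f n + g n).
Proof.
case: (sfunP f) (sfunP g) => fs fr [d hd] [gs gr [e he]].
split=> [n|n|]; first by rewrite rpredD ?fs ?gs.
  by rewrite mrestrD fr gr.
exists (maxn d e) => n.
by rewrite (leq_trans (msizeD_le _ _)) // geq_max !leq_max hd he orbT.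
Qed.

Definition sf_add (f g : symfun) : symfun := SymFun (sf_addP f g).

Lemma sf_mulP (f g : symfun) : is_symfun (fun n => f n * g n).
Proof.
case: (sfunP f) (sfunP g) => fs fr [d hd] [gs gr [e he]].
split=> [n|n|]; first by rewrite rpredM ?fs ?gs.
  by rewrite mrestrM fr gr.
exists (d + e).+1 => n.
by rewrite (leq_trans (msizeM_le _ _)) // ltnS leq_add.
Qed.

Definition sf_mul (f g : symfun) : symfun := SymFun (sf_mulP f g).

End SymFunRing.

HB.instance Definition _ := gen_eqMixin symfun.
HB.instance Definition _ := gen_choiceMixin symfun.

Local Ltac sf := move=> *; apply: symfunP => n;
  rewrite /=.

Lemma sf_addA : associative sf_add. Proof. by sf; rewrite addrA. Qed.
Lemma sf_addC : commutative sf_add. Proof. by sf; rewrite addrC. Qed.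
Lemma sf_add0 : left_id (sf_const 0) sf_add.
Proof. by sf; rewrite mpolyC0 add0r. Qed.
Lemma sf_addN : left_inverse (sf_const 0) sf_opp sf_add.
Proof. by sf; rewrite mpolyC0 addNr. Qed.
Lemma sf_mulA : associative sf_mul. Proof. by sf; rewrite mulrA. Qed.
Lemma sf_mulC : commutative sf_mul. Proof. by sf; rewrite mulrC. Qed.
Lemma sf_1mul : left_id (sf_const 1) sf_mul.
Proof. by sf; rewrite mpolyC1 mul1r. Qed.
Lemma sf_mulDl : left_distributive sf_mul sf_add.
Proof. by sf; rewrite mulrDl. Qed.
Lemma sf_1neq0 : sf_const 1 != sf_const 0.
Proof.
apply/eqP => /(congr1 (fun f : symfun => f 0%N)); rewrite /=.
by rewrite mpolyC0 mpolyC1 => /eqP; rewrite oner_eq0.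
Qed.

HB.instance Definition _ :=
  GRing.isZmodule.Build symfun sf_addA sf_addC sf_add0 sf_addN.
HB.instance Definition _ := GRing.Zmodule_isComNzRing.Build symfun
  sf_mulA sf_mulC sf_1mul sf_mulDl sf_1neq0.

Definition BZ : comNzRingType := symfun.

Section ElementarySymmetric.

Definition mext (n : nat) (m : 'X_{1..n}) : 'X_{1..n.+1} :=
  [multinom oapp m 0%N (unlift ord_max i) | i < n.+1].

Lemma mext_lift n (m : 'X_{1..n}) j : mext m (lift ord_max j) = m j.
Proof. by rewrite mnmE liftK. Qed.

Lemma mext_max n (m : 'X_{1..n}) : mext m ord_max = 0%N.
Proof. by rewrite mnmE unlift_none. Qed.

Lemma mdeg_mext n (m : 'X_{1..n}) : mdeg (mext m) = mdeg m.
Proof.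
rewrite !mdegE (bigD1_ord ord_max) //= mext_max add0n.
by apply: eq_bigr => j _; rewrite mext_lift.
Qed.

Lemma mcoeff_restr n (p : {mpoly int[n.+1]}) m : (mrestr p)@_m = p@_(mext m).
Proof.
rewrite [in RHS](mpolyE p) /mrestr comp_mpolyEX !raddf_sum /=.
apply: eq_bigr => m' _; rewrite !mcoeffZ; congr (_ * _).
rewrite comp_mpolyX (bigD1_ord ord_max) //= tnth_mktuple unlift_none /= mcoeffX.
have [m0|m0] := eqVneq (m' ord_max) 0%N; last first.
  rewrite expr0n (negbTE m0) mul0r mcoeff0.
  by case: eqP => // em; rewrite em mext_max in m0.
rewrite m0 expr0 mul1r.
under eq_bigr => j _ do rewrite tnth_mktuple liftK /=.
pose m1 := [multinom m' (lift ord_max j) | j < n].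
have -> : \prod_(j < n) 'X_j ^+ m' (lift ord_max j) = 'X_[m1] :> {mpoly int[n]}.
  by rewrite mpolyXE_id; apply: eq_bigr => j _; rewrite mnmE.
rewrite mcoeffX; congr (_%:R); congr nat_of_bool; apply/eqP/eqP => [<-|em].
  apply/mnmP => i; case: (unliftP ord_max i) => [j|] ->; last by rewrite mext_max.
  by rewrite mext_lift mnmE.
by apply/mnmP => j; rewrite mnmE em mext_lift.
Qed.

Lemma e_P r : is_symfun (fun n => mesym n int r).
Proof.
split=> [n|n|]; first exact: mesym_sym.
  apply/mpolyP => m; rewrite mcoeff_restr !mcoeff_mesym; congr (_%:R).
  congr nat_of_bool; rewrite /mechar mdeg_mext; congr andb.
  apply/forallP/forallP => h i; first by rewrite -(mext_lift m i).
  by case: (unliftP ord_max i) => [j|] ->; rewrite ?mext_lift ?mext_max.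
exists r.+1 => n; rewrite msizeE; apply/bigmax_leqP_seq => m + _; rewrite mem_msupp_mesym.
by case/andP => /eqP ->.
Qed.

Definition e_ (r : nat) : BZ := SymFun (e_P r).

Definition mcomplete (n r : nat) : {mpoly int[n]} :=
  \sum_(m : 'X_{1..n < r.+1} | mdeg m == r) 'X_[m].

Lemma mcoeff_complete n r m : (mcomplete n r)@_m = (mdeg m == r)%:R.
Proof.
rewrite raddf_sum /=; have [dm|dm] := eqVneq (mdeg m) r; last first.
  rewrite big1 // => m' /eqP dm'; rewrite mcoeffX.
  by case: eqP => // em; rewrite -em dm' eqxx in dm.
have hm : (mdeg m < r.+1)%N by rewrite dm.
rewrite (bigD1 (BMultinom hm)) /= ?dm // mcoeffX eqxx big1 ?addr0 //.
move=> m' /andP[_ ne]; rewrite mcoeffX; case: eqP => // em.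
by case/eqP: ne; apply: val_inj.
Qed.

Lemma h_P r : is_symfun (fun n => mcomplete n r).
Proof.
split=> [n|n|].
- apply/issymP => s; apply/mpolyP => m; rewrite mcoeff_sym !mcoeff_complete.
  by rewrite mdeg_mperm.
- by apply/mpolyP => m; rewrite mcoeff_restr !mcoeff_complete mdeg_mext.
exists r.+1 => n; rewrite msizeE; apply/bigmax_leqP_seq => m + _; rewrite mcoeff_msupp mcoeff_complete.
by have [->|] := eqVneq (mdeg m) r; rewrite ?eqxx.
Qed.

Definition h_ (r : nat) : BZ := SymFun (h_P r).

End ElementarySymmetric.

Definition is_part (la : seq nat) : bool := sorted geq la && (0%N \notin la).

(* det (x_i ^ (la_j + n - 1 - j)), i, j < n. *)
Definition alternant (n : nat) (la : seq nat) : {mpoly int[n]} :=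
  \det (\matrix_(i < n, j < n) ('X_i ^+ (nth 0%N la j + (n.-1 - j))%N : {mpoly int[n]})).

(* Schur functions, as quotients of alternants. *)
Definition is_schur (la : seq nat) (f : BZ) : Prop :=
  forall n, (size la <= n)%N ->
    (f : symfun) n * alternant n [::] = alternant n la.

Definition schur (la : seq nat) : BZ := xget 0 [set f | is_schur la f].

(* The inner product on B_Z; it is unique, as the Schur functions are a
   Z-basis of B_Z. *)
Definition is_schur_form (ip : BZ -> BZ -> int) : Prop :=
  [/\ forall f g f', ip (f + f') g = ip f g + ip f' g,
      forall f g g', ip f (g + g') = ip f g + ip f g' &
      forall la mu, is_part la -> is_part mu ->
        ip (schur la) (schur mu) = (la == mu)%:R].

Definition is_Fock (F : representation HZ (zmod_abgroup BZ)) : Prop :=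
  exists2 ip, is_schur_form ip & forall r,
    (forall f : BZ, F (He r) f = e_ r * f) /\
    (forall f g : BZ, ip (h_ r * f) g = ip f (F (Hh r) g)).

Section TheFunctors.
Variable k : fieldType.

Definition sub_map (X Y : vectType k) (U : {vspace X}) (U' : {vspace Y})
    (f : 'Hom(X, Y)) : 'Hom(subvs_of U, subvs_of U') :=
  linfun (fun u => vsproj U' (f (vsval u))).

Lemma sub_mapE (X Y : vectType k) (U : {vspace X}) (U' : {vspace Y})
    (f : 'Hom(X, Y)) u :
  (forall x, x \in U -> f x \in U') -> vsval (sub_map U U' f u) = f (vsval u).
Proof.
move=> fU; rewrite linfunE; last by move=> a v w; rewrite !linearP.
by rewrite vsprojK ?fU ?subvsP.
Qed.

Lemma sub_map_lin (X Y : vectType k) (U : {vspace X}) (U' : {vspace Y}) :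
  linear (fun f : 'Hom(X, Y) => sub_map U U' f).
Proof.
have lin (f : 'Hom(X, Y)) : linear (fun u : subvs_of U => vsproj U' (f (vsval u))).
  by move=> a v w; rewrite !linearP.
move=> a f g; apply/lfunP => u; rewrite (linfunE (lin _)) homE linearP.
symmetry; etransitivity; first exact: homE.
by rewrite !(linfunE (lin _)).
Qed.

(* The action of g in GL(k) on V ⊕ k. *)
Definition gl1_act (V : vectType k) (g : k) : 'End((V * k^o)%type) :=
  dsum_map (\1 : 'End(V))%VF (g *: \1 : 'End(k^o))%VF.

Lemma weight0 (M : polyfunctor k) (r : nat) (V : vectType k) :
  forall g, g != 0 -> pmap M (gl1_act V g) 0 = g ^+ r *: 0.
Proof. by move=> g _; rewrite linear0 scaler0. Qed.

Lemma weight_lin (M : polyfunctor k) (r : nat) (V : vectType k) (a : k)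
    (u v : M (V * k^o)%type) :
  (forall g, g != 0 -> pmap M (gl1_act V g) u = g ^+ r *: u) ->
  (forall g, g != 0 -> pmap M (gl1_act V g) v = g ^+ r *: v) ->
  forall g, g != 0 -> pmap M (gl1_act V g) (a *: u + v) = g ^+ r *: (a *: u + v).
Proof.
move=> hu hv g g0; set f := pmap _ _; have -> : f (a *: u + v) = a *: f u + f v by exact: linearP.
by rewrite /f hu // hv // scalerDr !scalerA mulrC.
Qed.

(* M(V ⊕ k)_r *)
Definition weight (M : polyfunctor k) (r : nat) (V : vectType k) :
    {vspace M (V * k^o)%type} :=
  subspace (@weight0 M r V) (@weight_lin M r V).

Lemma weightP (M : polyfunctor k) r (V : vectType k) v :
  v \in weight M r V <->
  forall g, g != 0 -> pmap M (gl1_act V g) v = g ^+ r *: v.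
Proof. exact: subspaceP. Qed.

Section A.
Variables (r : nat) (M : polyfunctor k).

Definition A_ob (V : vectType k) : vectType k := subvs_of (weight M r V).

Definition stab (V W : vectType k) (f : 'Hom(V, W)) :
  'Hom((V * k^o)%type, (W * k^o)%type) := dsum_map f (\1 : 'End(k^o))%VF.

Definition A_map (V W : vectType k) (f : 'Hom(V, W)) : 'Hom(A_ob V, A_ob W) :=
  sub_map (weight M r V) (weight M r W) (pmap M (stab f)).

Lemma stab_act (V W : vectType k) (f : 'Hom(V, W)) g :
  (gl1_act W g \o stab f = stab f \o gl1_act V g)%VF.
Proof. by rewrite -!dsum_map_comp !comp_lfun1l !comp_lfun1r. Qed.

Lemma stab_weight (V W : vectType k) (f : 'Hom(V, W)) v :
  v \in weight M r V -> pmap M (stab f) v \in weight M r W.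
Proof.
move=> /weightP hv; apply/weightP => g g0.
by rewrite -comp_lfunE -pmapM stab_act pmapM comp_lfunE hv // linearZ.
Qed.

Lemma A_mapE (V W : vectType k) (f : 'Hom(V, W)) (u : subvs_of (weight M r V)) :
  vsval (A_map f u : subvs_of (weight M r W)) = pmap M (stab f) (vsval u).
Proof. by apply: sub_mapE; apply: stab_weight. Qed.

Lemma A_map1 (V : vectType k) : A_map (\1 : 'End(V))%VF = \1%VF.
Proof.
apply/lfunP => u; apply: (@subvs_inj _ _ (weight M r V)).
by rewrite A_mapE /stab dsum_map_id pmap1 !id_lfunE.
Qed.

Lemma A_mapM (U V W : vectType k) (g : 'Hom(V, W)) (f : 'Hom(U, V)) :
  A_map (g \o f)%VF = (A_map g \o A_map f)%VF.
Proof.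
apply/lfunP => u; apply: (@subvs_inj _ _ (weight M r W)).
rewrite comp_lfunE !A_mapE -comp_lfunE -pmapM; congr (pmap M _ _).
by rewrite /stab -dsum_map_comp comp_lfun1l.
Qed.

Lemma stab_poly (V W : vectType k) : polymap_le 1 (@stab V W).
Proof.
have e : (fun f => dsum_map f (0 : 'End(k^o)) + dsum_map (0 : 'Hom(V, W)) \1%VF)
    =1 @stab V W.
  move=> f; apply/lfunP => x; rewrite add_lfunE !dsum_mapE.
  by congr pair; rewrite /= !lfunE /= ?addr0 ?add0r.
apply: polymap_ext e _; apply: polymapD (polymapC _ _ _).
apply: polymap_lin => a f f'; apply/lfunP => x; rewrite homE !dsum_mapE homE.
by congr pair; rewrite /= !lfunE /= scaler0 addr0.
Qed.

Lemma A_map_deg d (V W : vectType k) :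
  polymap_le d (@pmap k M (V * k^o)%type (W * k^o)%type) ->
  polymap_le d (@A_map V W).
Proof.
move=> hM; apply: polymap_postlin (@sub_map_lin _ _ _ _).
exact: polymap_comp hM (@stab_poly V W).
Qed.

Lemma A_map_poly (V W : vectType k) : polymap (@A_map V W).
Proof.
have [d hd] := @pmap_poly k M (V * k^o)%type (W * k^o)%type.
by exists d; apply: A_map_deg.
Qed.

Lemma A_map_bound : exists d, forall V : vectType k, polymap_le d (@A_map V V).
Proof. by have [d hd] := pmap_deg M; exists d => V; apply: A_map_deg. Qed.

Definition A_polyfunctor : polyfunctor k :=
  PolyFunctor A_map1 A_mapM A_map_poly A_map_bound.

End A.

Section AMorphism.
Variables (r : nat) (M N : polyfunctor k) (t : nattrans M N).

Definition A_nt (V : vectType k) : 'Hom(A_polyfunctor r M V, A_polyfunctor r N V) :=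
  sub_map (weight M r V) (weight N r V) (t (V * k^o)%type).

Lemma nt_weight (V : vectType k) v :
  v \in weight M r V -> t (V * k^o)%type v \in weight N r V.
Proof.
move=> /weightP hv; apply/weightP => g g0.
by rewrite -comp_lfunE -ncompP comp_lfunE hv // linearZ.
Qed.

Lemma A_ntE (V : vectType k) (u : subvs_of (weight M r V)) :
  vsval (A_nt V u : subvs_of (weight N r V)) = t (V * k^o)%type (vsval u).
Proof. by apply: sub_mapE; apply: nt_weight. Qed.

Lemma A_ntP (V W : vectType k) (f : 'Hom(V, W)) :
  (A_nt W \o pmap (A_polyfunctor r M) f = pmap (A_polyfunctor r N) f \o A_nt V)%VF.
Proof.
apply/lfunP => u; apply: (@subvs_inj _ _ (weight N r W)).
rewrite !comp_lfunE /= A_ntE !A_mapE A_ntE.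
by rewrite -!comp_lfunE ncompP.
Qed.

Definition A_nattrans : nattrans (A_polyfunctor r M) (A_polyfunctor r N) :=
  NatTrans A_ntP.

End AMorphism.

Lemma A_nattrans1 r (M : polyfunctor k) :
  A_nattrans r (nt_id M) = nt_id (A_polyfunctor r M).
Proof.
apply: nattransP => V; apply/lfunP => u; apply: (@subvs_inj _ _ (weight M r V)).
by rewrite A_ntE !id_lfunE.
Qed.

Lemma A_nattransM r (L M N : polyfunctor k) (t : nattrans M N) (s : nattrans L M) :
  A_nattrans r (nt_comp t s) = nt_comp (A_nattrans r t) (A_nattrans r s).
Proof.
apply: nattransP => V; apply/lfunP => u; apply: (@subvs_inj _ _ (weight N r V)).
by rewrite comp_lfunE !A_ntE comp_lfunE.
Qed.

(* A_r(M)(V) = M(V ⊕ k)_r *)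
Definition functorA (r : nat) : functor (polyfunctor_cat k) (polyfunctor_cat k) :=
  @Functor (polyfunctor_cat k) (polyfunctor_cat k) (A_polyfunctor r) (@A_nattrans r)
    (@A_nattrans1 r) (@A_nattransM r).

Section B.
Variables (r : nat) (M : polyfunctor k).

Definition B_ob (V : vectType k) : vectType k := tens (M V) (ext r V).

Definition B_map (V W : vectType k) (f : 'Hom(V, W)) : 'Hom(B_ob V, B_ob W) :=
  tens_map (pmap M f) (ext_map r f).

Lemma B_map1 (V : vectType k) : B_map (\1 : 'End(V))%VF = \1%VF.
Proof. by rewrite /B_map pmap1 ext_map_id tens_map_id. Qed.

Lemma B_mapM (U V W : vectType k) (g : 'Hom(V, W)) (f : 'Hom(U, V)) :
  B_map (g \o f)%VF = (B_map g \o B_map f)%VF.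
Proof. by rewrite /B_map pmapM ext_map_comp tens_map_comp. Qed.

Lemma tpow_map_deg n (V W : vectType k) : polymap_le n (@tpow_map k n V W).
Proof.
elim: n => [|n IH] /=; first exact: polymapC.
apply: (polymap_bilin (d := 1) (e := n) (b := @tens_map k V W _ _) _ _ _ IH).
- exact: tens_mapPr.
- by move=> g; apply: tens_mapPl.
- by apply: (@polymap_lin _ _ _ id).
Qed.

Lemma ext_map_deg n (V W : vectType k) : polymap_le n (@ext_map k n V W).
Proof.
pose l (t : 'Hom(tpow n V, tpow n W)) : 'Hom(ext n V, ext n W) :=
  (vquot_pi (alt_rel n W) \o (t \o vquot_sec (alt_rel n V)))%VF.
have ll : linear l.
  move=> a s t; rewrite /l comp_lfunDl comp_lfunDr; congr (_ + _).
  by rewrite -comp_lfunZl -comp_lfunZr.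
exact: polymap_postlin (@tpow_map_deg n V W) ll.
Qed.

Lemma B_map_deg d (V W : vectType k) :
  polymap_le d (@pmap k M V W) -> polymap_le (d + r) (@B_map V W).
Proof.
move=> hM; apply: polymap_bilin hM (@ext_map_deg r V W).
- exact: tens_mapPr.
- by move=> g; apply: tens_mapPl.
Qed.

Lemma B_map_poly (V W : vectType k) : polymap (@B_map V W).
Proof.
have [d hd] := @pmap_poly k M V W.
by exists (d + r)%N; apply: B_map_deg.
Qed.

Lemma B_map_bound : exists d, forall V : vectType k, polymap_le d (@B_map V V).
Proof.
by have [d hd] := pmap_deg M; exists (d + r)%N => V; apply: B_map_deg.
Qed.

Definition B_polyfunctor : polyfunctor k :=
  PolyFunctor B_map1 B_mapM B_map_poly B_map_bound.

End B.

Section BMorphism.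
Variables (r : nat) (M N : polyfunctor k) (t : nattrans M N).

Definition B_nt (V : vectType k) : 'Hom(B_polyfunctor r M V, B_polyfunctor r N V) :=
  tens_map (t V) (\1 : 'End(ext r V))%VF.

Lemma B_ntP (V W : vectType k) (f : 'Hom(V, W)) :
  (B_nt W \o pmap (B_polyfunctor r M) f = pmap (B_polyfunctor r N) f \o B_nt V)%VF.
Proof.
by rewrite /B_nt /= /B_map -!tens_map_comp comp_lfun1l comp_lfun1r ncompP.
Qed.

Definition B_nattrans : nattrans (B_polyfunctor r M) (B_polyfunctor r N) :=
  NatTrans B_ntP.

End BMorphism.

Lemma B_nattrans1 r (M : polyfunctor k) :
  B_nattrans r (nt_id M) = nt_id (B_polyfunctor r M).
Proof. by apply: nattransP => V; rewrite /= /B_nt tens_map_id. Qed.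

Lemma B_nattransM r (L M N : polyfunctor k) (t : nattrans M N) (s : nattrans L M) :
  B_nattrans r (nt_comp t s) = nt_comp (B_nattrans r t) (B_nattrans r s).
Proof.
by apply: nattransP => V; rewrite /= /B_nt -tens_map_comp comp_lfun1l.
Qed.

(* B_r(M)(V) = M(V) ⊗ Λ^r(V) *)
Definition functorB (r : nat) : functor (polyfunctor_cat k) (polyfunctor_cat k) :=
  @Functor (polyfunctor_cat k) (polyfunctor_cat k) (B_polyfunctor r) (@B_nattrans r)
    (@B_nattrans1 r) (@B_nattransM r).

End TheFunctors.

(* Main.v *)
(* The multiplicity of the weight (r_1, ..., r_l) in M(k^l) is the dimension of
   A_(r_l) ... A_(r_1) M at 0. As the A_r commute, these multiplicities are the
   coefficients of a symmetric function ch M, which is additive on short exact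
   sequences because k is infinite, so that weight spaces of polynomial
   representations split off. By construction A_r acts on characters as the
   adjoint h_r^* of h_r, extraction of the coefficient of t^r in f(t, x). The
   isomorphism A_n B_m = B_m A_n + B_(m-1) A_(n-1) combines the weight
   decomposition of M(V ⊕ k) with Λ^m(V ⊕ k) = Λ^m V ⊕ Λ^(m-1) V, and it yields
   ch (B_r M) = e_r ch M by recursion on the weight. It remains to see that ch is
   an isomorphism from K_0 onto B_Z. It is onto as the e_r generate B_Z.

   For injectivity, two functors M, N with the same nonzero character share a
   nonzero subquotient, that is, there is a subfunctor R of M x N that is not the
   direct sum of its intersections with M and N. By induction on the degree, let r
   be the largest weight with A_r M <> 0, take such an R' in A_r M x A_r N, and let
   R be the subfunctor of M x N that R' generates: factoring a map V ⊕ k -> W ⊕ k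
   as (upper unipotent)(diagonal)(lower unipotent) shows that the part of weight r
   of R is R' again. Splitting off the common subquotient lowers the sum of the
   multiplicities and does not affect the difference of the classes in K_0.

   The form on B_Z is given by <h_a, g> = coefficient of x^a in g; it is well
   defined since the coefficient of x^a in h_b is symmetric in a and b. The
   Jacobi-Trudi formula turns <s_la, s_mu> into the coefficient of x^(la + delta)
   in the alternant of mu. *)

Require Import Defs.
From HB Require Import structures.
From mathcomp Require Import all_boot all_order all_algebra.
From mathcomp Require Import boolp classical_sets cardinality.
From mathcomp Require Import perm generic_quotient mpoly zify.
Set Implicit Arguments.
Unset Strict Implicit.
Unset Printing Implicit Defensive.
Import GRing.Theory Defs.
Local Open Scope ring_scope.

(** * Polynomial functors form an abelian category *)

Section AbelianCategory.
Variable k : fieldType.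
Implicit Types (L M N X Y Z : polyfunctor k) (U V W : vectType k).

(** One device carries every weight argument. Along an affine curve g |-> u + g v in Hom(V, W) a
    polynomial functor is a polynomial in g with vector coefficients; as k is infinite, two such
    curves that agree for all g != 0 have the same coefficients, hence the same value at g = 0. This
    yields the weight projections as coefficients of the action of g, and it extends identities from
    GL(k) to the noninvertible scalar 0. It also removes the one gap in the triangular factorization
    of V ⊕ k -> W ⊕ k, which requires a nonzero entry k -> k: a map whose entry is 0 is the value at
    g = 0 of a curve of maps with entry g. Simple objects and composition series never occur. Two
    functors with the same character are compared by removing a common subquotient, so it is enough
    that a finite sum of multiplicities decreases, and the subquotient may be any nonzero one. *)

Lemma dim_subvs V (U : {vspace V}) : \dim {: subvs_of U} = \dim U.
Proof. by rewrite dimvf. Qed.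

Lemma dim0_eq V (u v : V) : \dim {:V} = 0%N -> u = v.
Proof.
move=> d0; have V0 : {:V}%VS = 0%VS by apply/eqP; rewrite -dimv_eq0 d0.
have z (w : V) : w = 0 by apply/eqP; rewrite -memv0 -V0 memvf.
by rewrite (z u) (z v).
Qed.

Lemma lfun_inj_compl U V W (f : 'Hom(V, W)) (g h : 'Hom(U, V)) :
  injective f -> (f \o g = f \o h)%VF -> g = h.
Proof.
move=> fi e; apply/lfunP => u; apply: fi.
by rewrite -!comp_lfunE e.
Qed.

Lemma lfun_surj_compr U V W (f : 'Hom(U, V)) (g h : 'Hom(V, W)) :
  limg f = fullv -> (g \o f = h \o f)%VF -> g = h.
Proof.
move=> fs e; apply/lfunP => v.
have /memv_imgP[u _ ->] : v \in limg f by rewrite fs memvf.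
by rewrite -!comp_lfunE e.
Qed.

Lemma nt_app M N (s t : nattrans M N) : s = t -> forall V x, s V x = t V x.
Proof. by move=> ->. Qed.

Definition pinj M N (t : nattrans M N) := forall V, injective (t V).
Definition psurj M N (t : nattrans M N) := forall V, limg (t V) = fullv.

(** Objectwise exactness. It is equivalent to exactness in the category ([pexact_short_exact],
    [short_exact_pexact]) and is the form in which dimensions and weight spaces can be compared. *)
Definition pexact X Y Z (i : nattrans X Y) (p : nattrans Y Z) :=
  [/\ pinj i, psurj p & forall V y, p V y = 0 <-> exists x, i V x = y].

Lemma pexact_comp0 X Y Z (i : nattrans X Y) (p : nattrans Y Z) :
  pexact i p -> nt_comp p i = nt_zero X Z.
Proof.
move=> [_ _ ex]; apply: nattransP => V; apply/lfunP => x.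
by rewrite comp_lfunE zero_lfunE; apply/ex; exists x.
Qed.

Lemma pexact_dim X Y Z (i : nattrans X Y) (p : nattrans Y Z) V :
  pexact i p -> \dim {:Y V} = (\dim {:X V} + \dim {:Z V})%N.
Proof.
move=> [iI pS ex].
rewrite -(pS V) -(limg_ker_dim (p V) fullv) capfv; congr (_ + _)%N.
rewrite -(limg_dim_eq (f := i V)); last first.
  by rewrite capfv; apply/eqP/lker0P; apply: iI.
congr (\dim _); apply/vspaceP => y; rewrite memv_ker.
apply/eqP/memv_imgP => [/ex[x <-]|[x _ ->]]; first by exists x; rewrite ?memvf.
by apply/ex; exists x.
Qed.

Lemma pexact_kernel X Y Z (i : nattrans X Y) (p : nattrans Y Z) :
  pexact i p -> is_kernel (C := polyfunctor_cat k) i p.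
Proof.
move=> ex; split; first exact: pexact_comp0 ex.
case: ex => iI pS ex /= W g pg.
have gim V w : exists x, i V x = g V w.
  apply/ex; rewrite -comp_lfunE.
  by have /= -> := nt_app pg w; rewrite zero_lfunE.
have [h ih] : exists h : forall V, 'Hom(W V, X V), forall V, (i V \o h V = g V)%VF.
  (* [(i V)^-1] inverts [i V] on its image, which contains the image of [g V]; naturality of h then
     follows by cancelling the injective i. *)
  exists (fun V => ((i V)^-1 \o g V)%VF) => V.
  apply/lfunP => w; rewrite !comp_lfunE /= limg_lfunVK //.
  by have [x <-] := gim V w; apply: memv_img; rewrite memvf.
have hP V V' (f : 'Hom(V, V')) : (h V' \o pmap W f = pmap X f \o h V)%VF.
  apply: (lfun_inj_compl (@iI V')).
  by rewrite !comp_lfunA ih !ncompP -comp_lfunA ih.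
exists (NatTrans hP); split; first by apply: nattransP => V /=.
move=> h' e; apply: nattransP => V /=; apply: (lfun_inj_compl (@iI V)).
by rewrite ih -e.
Qed.

Lemma pexact_cokernel X Y Z (i : nattrans X Y) (p : nattrans Y Z) :
  pexact i p -> is_cokernel (C := polyfunctor_cat k) p i.
Proof.
move=> ex; split; first exact: pexact_comp0 ex.
case: ex => iI pS ex /= W g gi.
have g0 V y : p V y = 0 -> g V y = 0.
  move=> /ex[x <-]; rewrite -comp_lfunE.
  by have /= -> := nt_app gi x; rewrite zero_lfunE.
have [h hp] : exists h : forall V, 'Hom(Z V, W V), forall V, (h V \o p V = g V)%VF.
  (* Any section of [p V] gives the same map, because g vanishes on the kernel of p. *)
  exists (fun V => (g V \o (p V)^-1)%VF) => V.
  apply/lfunP => y; rewrite !comp_lfunE /=; apply/eqP; rewrite -subr_eq0 -linearB.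
  by apply/eqP/g0; rewrite linearB /= limg_lfunVK ?subrr // memv_img ?memvf.
have hP V V' (f : 'Hom(V, V')) : (h V' \o pmap Z f = pmap W f \o h V)%VF.
  apply: (lfun_surj_compr (pS V)).
  by rewrite -!comp_lfunA hp -!ncompP comp_lfunA hp.
exists (NatTrans hP); split; first by apply: nattransP => V /=.
move=> h' e; apply: nattransP => V /=; apply: (lfun_surj_compr (pS V)).
by rewrite hp -e.
Qed.

Lemma pexact_short_exact X Y Z (i : nattrans X Y) (p : nattrans Y Z) :
  pexact i p -> short_exact (C := polyfunctor_cat k) i p.
Proof. by move=> ex; split; [apply: pexact_kernel|apply: pexact_cokernel]. Qed.

(** * Subfunctors and quotient functors *)

Section SubQuotient.
Variables (M : polyfunctor k) (P : forall V, {vspace M V}).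
Hypothesis Pstab : forall V W (f : 'Hom(V, W)) x, x \in P V -> pmap M f x \in P W.

Definition sub_pf_map V W (f : 'Hom(V, W)) : 'Hom(subvs_of (P V), subvs_of (P W)) :=
  sub_map (P V) (P W) (pmap M f).

Lemma sub_pf_mapE V W (f : 'Hom(V, W)) u :
  vsval (sub_pf_map f u) = pmap M f (vsval u).
Proof. by apply: sub_mapE => x; apply: Pstab. Qed.

Lemma sub_pf_map1 V : sub_pf_map (\1 : 'End(V))%VF = \1%VF.
Proof. by apply/lfunP => u; apply: subvs_inj; rewrite sub_pf_mapE pmap1 !id_lfunE. Qed.

Lemma sub_pf_mapM U V W (g : 'Hom(V, W)) (f : 'Hom(U, V)) :
  sub_pf_map (g \o f)%VF = (sub_pf_map g \o sub_pf_map f)%VF.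
Proof.
by apply/lfunP => u; apply: subvs_inj; rewrite comp_lfunE !sub_pf_mapE pmapM comp_lfunE.
Qed.

Lemma sub_pf_le d V W : polymap_le d (@pmap k M V W) -> polymap_le d (@sub_pf_map V W).
Proof. by move=> hM; apply: polymap_postlin hM (@sub_map_lin _ _ _ _ _). Qed.

Lemma sub_pf_poly V W : polymap (@sub_pf_map V W).
Proof. by have [d hd] := @pmap_poly k M V W; exists d; apply: sub_pf_le. Qed.

Lemma sub_pf_deg : exists d, forall V, polymap_le d (@sub_pf_map V V).
Proof. by have [d hd] := pmap_deg M; exists d => V; apply: sub_pf_le. Qed.

Definition sub_pf : polyfunctor k :=
  PolyFunctor sub_pf_map1 sub_pf_mapM sub_pf_poly sub_pf_deg.

Lemma sub_pf_incP V W (f : 'Hom(V, W)) :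
  (linfun (@vsval _ _ (P W)) \o pmap sub_pf f = pmap M f \o linfun (@vsval _ _ (P V)))%VF.
Proof. by apply/lfunP => u; rewrite !comp_lfunE !lfunE /= sub_pf_mapE. Qed.

Definition sub_pf_inc : nattrans sub_pf M := NatTrans sub_pf_incP.

Lemma sub_pf_incE V u : sub_pf_inc V u = vsval (u : subvs_of (P V)).
Proof. by rewrite lfunE. Qed.

Definition quot_pf_map V W (f : 'Hom(V, W)) : 'Hom(vquot (P V), vquot (P W)) :=
  (vquot_pi (P W) \o (pmap M f \o vquot_sec (P V)))%VF.

Lemma quot_pf_mapE V W (f : 'Hom(V, W)) x :
  quot_pf_map f (vquot_pi (P V) x) = vquot_pi (P W) (pmap M f x).
Proof.
transitivity (vquot_pi (P W) (pmap M f (vquot_sec (P V) (vquot_pi (P V) x)))).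
  by etransitivity; [exact: comp_lfunE|congr (vquot_pi _ _); exact: comp_lfunE].
have [w wP ->] := vquot_secK (P V) x.
rewrite !linearB /=; have /eqP-> : vquot_pi (P W) (pmap M f w) == 0.
  by rewrite vquot_pi_eq0 Pstab.
by rewrite subr0.
Qed.

Lemma quot_pf_map1 V : quot_pf_map (\1 : 'End(V))%VF = \1%VF.
Proof. by apply/lfunP => q; rewrite -(vquot_piK q) quot_pf_mapE pmap1 !id_lfunE. Qed.

Lemma quot_pf_mapM U V W (g : 'Hom(V, W)) (f : 'Hom(U, V)) :
  quot_pf_map (g \o f)%VF = (quot_pf_map g \o quot_pf_map f)%VF.
Proof.
apply/lfunP => q; rewrite -(vquot_piK q).
by rewrite comp_lfunE !quot_pf_mapE pmapM comp_lfunE.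
Qed.

Lemma quot_pf_le d V W : polymap_le d (@pmap k M V W) -> polymap_le d (@quot_pf_map V W).
Proof.
move=> hM; apply: (polymap_postlin (l := fun f : 'Hom(M V, M W) =>
  (vquot_pi (P W) \o (f \o vquot_sec (P V)))%VF) hM) => a f g.
by rewrite comp_lfunDl comp_lfunDr -comp_lfunZl -comp_lfunZr.
Qed.

Lemma quot_pf_poly V W : polymap (@quot_pf_map V W).
Proof. by have [d hd] := @pmap_poly k M V W; exists d; apply: quot_pf_le. Qed.

Lemma quot_pf_deg : exists d, forall V, polymap_le d (@quot_pf_map V V).
Proof. by have [d hd] := pmap_deg M; exists d => V; apply: quot_pf_le. Qed.

Definition quot_pf : polyfunctor k :=
  PolyFunctor quot_pf_map1 quot_pf_mapM quot_pf_poly quot_pf_deg.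

Lemma quot_pf_piP V W (f : 'Hom(V, W)) :
  (vquot_pi (P W) \o pmap M f = pmap quot_pf f \o vquot_pi (P V))%VF.
Proof.
apply/lfunP => x; rewrite comp_lfunE; symmetry.
by etransitivity; [apply: comp_lfunE|apply: quot_pf_mapE].
Qed.

Definition quot_pf_pi : nattrans M quot_pf :=
  @NatTrans k M quot_pf (fun V => vquot_pi (P V)) quot_pf_piP.

Lemma sub_quot_pexact : pexact sub_pf_inc quot_pf_pi.
Proof.
split=> [V u v|V|V y].
- by rewrite !sub_pf_incE; apply: subvs_inj.
- apply/vspaceP => q; rewrite memvf; apply/memv_imgP.
  by exists (vquot_sec (P V) q); rewrite ?memvf //= vquot_piK.
split=> [/eqP|[x <-]]; last first.
  by apply/eqP; rewrite vquot_pi_eq0 sub_pf_incE subvsP.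
rewrite vquot_pi_eq0 => yP; exists (vsproj (P V) y).
by rewrite sub_pf_incE vsprojK.
Qed.

End SubQuotient.

Lemma ker_stab M N (t : nattrans M N) V W (f : 'Hom(V, W)) x :
  x \in lker (t V) -> pmap M f x \in lker (t W).
Proof. by rewrite !memv_ker -comp_lfunE ncompP comp_lfunE => /eqP->; rewrite linear0. Qed.

Lemma img_stab M N (t : nattrans M N) V W (f : 'Hom(V, W)) x :
  x \in limg (t V) -> pmap N f x \in limg (t W).
Proof.
move=> /memv_imgP[y _ ->].
by rewrite -comp_lfunE -ncompP comp_lfunE memv_img ?memvf.
Qed.

Definition ker_pf M N (t : nattrans M N) := sub_pf (@ker_stab M N t).
Definition coker_pf M N (t : nattrans M N) := quot_pf (@img_stab M N t).

Lemma inj_pexact M N (t : nattrans M N) : pinj t ->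
  pexact t (quot_pf_pi (@img_stab M N t)).
Proof.
move=> ti; have [_ pS _] := sub_quot_pexact (@img_stab M N t).
split=> // V y /=; split=> [/eqP|[x <-]]; last first.
  by apply/eqP; rewrite vquot_pi_eq0 memv_img ?memvf.
by rewrite vquot_pi_eq0 => /memv_imgP[x _ ->]; exists x.
Qed.

Lemma surj_pexact M N (t : nattrans M N) : psurj t ->
  pexact (sub_pf_inc (@ker_stab M N t)) t.
Proof.
move=> ts; have [iI _ _] := sub_quot_pexact (@ker_stab M N t).
split=> // V y; split=> [y0|[x <-]]; last first.
  by rewrite sub_pf_incE; apply/eqP; rewrite -memv_ker subvsP.
have yk : y \in lker (t V) by rewrite memv_ker y0.
by exists (vsproj (lker (t V)) y); rewrite sub_pf_incE vsprojK.
Qed.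

Lemma nt_comp0 L M N (t : nattrans M N) : nt_comp t (nt_zero L M) = nt_zero L N.
Proof. by apply: nattransP => V /=; rewrite comp_lfun0r. Qed.

Lemma nt_0comp L M N (t : nattrans L M) : nt_comp (nt_zero M N) t = nt_zero L N.
Proof. by apply: nattransP => V /=; rewrite comp_lfun0l. Qed.

Lemma mono_pinj M N (t : nattrans M N) : mono (C := polyfunctor_cat k) t -> pinj t.
Proof.
move=> tm V; apply/lker0P; rewrite -subv0; apply/subvP => x xk.
pose i := sub_pf_inc (@ker_stab M N t).
have i0 : i = nt_zero _ M.
  apply: (tm _ i (nt_zero _ M)); rewrite /= nt_comp0.
  apply: nattransP => W; apply/lfunP => u; rewrite comp_lfunE zero_lfunE sub_pf_incE.
  by apply/eqP; rewrite -memv_ker subvsP.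
have := nt_app i0 (vsproj (lker (t V)) x).
by rewrite sub_pf_incE vsprojK // zero_lfunE => ->; rewrite mem0v.
Qed.

Lemma epi_psurj M N (t : nattrans M N) : epi (C := polyfunctor_cat k) t -> psurj t.
Proof.
move=> te V; apply/eqP; rewrite eqEsubv subvf; apply/subvP => y _.
pose p := quot_pf_pi (@img_stab M N t).
have p0 : p = nt_zero N _.
  apply: (te _ p (nt_zero N _)); rewrite /= nt_0comp.
  apply: nattransP => W; apply/lfunP => u; rewrite comp_lfunE zero_lfunE /=.
  by apply/eqP; rewrite vquot_pi_eq0 memv_img ?memvf.
have := nt_app p0 y.
by rewrite zero_lfunE /= => /eqP; rewrite vquot_pi_eq0.
Qed.

(** The universal property is borrowed from the exact sequence ker t -> M -> M / ker t: a map killed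
    by t is also killed by the quotient map. *)
Lemma kernel_ker M N (t : nattrans M N) :
  is_kernel (C := polyfunctor_cat k) (sub_pf_inc (@ker_stab M N t)) t.
Proof.
pose i := sub_pf_inc (@ker_stab M N t).
pose p := quot_pf_pi (@ker_stab M N t).
have [_ ku] : is_kernel (C := polyfunctor_cat k) i p.
  exact/pexact_kernel/sub_quot_pexact.
split.
  apply: nattransP => W; apply/lfunP => u; rewrite comp_lfunE zero_lfunE sub_pf_incE.
  by apply/eqP; rewrite -memv_ker subvsP.
move=> /= W g tg; apply: ku; apply: nattransP => V; apply/lfunP => w.
rewrite comp_lfunE zero_lfunE; apply/eqP; rewrite vquot_pi_eq0 memv_ker -comp_lfunE.
by have /= -> := nt_app tg w; rewrite zero_lfunE.
Qed.

Lemma cokernel_coker M N (t : nattrans M N) :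
  is_cokernel (C := polyfunctor_cat k) (quot_pf_pi (@img_stab M N t)) t.
Proof.
pose i := sub_pf_inc (@img_stab M N t).
pose p := quot_pf_pi (@img_stab M N t).
have [_ ku] : is_cokernel (C := polyfunctor_cat k) p i.
  exact/pexact_cokernel/sub_quot_pexact.
split.
  apply: nattransP => W; apply/lfunP => u; rewrite comp_lfunE zero_lfunE /=.
  by apply/eqP; rewrite vquot_pi_eq0 memv_img ?memvf.
move=> /= W g gt; apply: ku; apply: nattransP => V; apply/lfunP => w.
rewrite comp_lfunE zero_lfunE sub_pf_incE; have /memv_imgP[x _ ->] := subvsP w.
rewrite -comp_lfunE.
by have /= -> := nt_app gt x; rewrite zero_lfunE.
Qed.

(** Uniqueness in the universal properties makes i mono and p epi, hence injective and surjective
    objectwise. In the middle, the inclusion of the objectwise kernel of p factors through i. This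
    is what makes the character well defined on [K0]. *)
Lemma short_exact_pexact X Y Z (i : nattrans X Y) (p : nattrans Y Z) :
  short_exact (C := polyfunctor_cat k) i p -> pexact i p.
Proof.
move=> [[pi0 ki] [_ kp]].
have iI : pinj i.
  apply: mono_pinj => /= W g h e.
  have [h' [_ u]] := ki W (nt_comp i g) (etrans (nt_compA p i g)
    (etrans (congr1 (fun s => nt_comp s g) pi0) (nt_0comp _ _))).
  by rewrite -(u g) // -(u h).
have pS : psurj p.
  apply: epi_psurj => /= W g h e.
  have [h' [_ u]] := kp W (nt_comp g p) (etrans (esym (nt_compA g p i))
    (etrans (congr1 (nt_comp g) pi0) (nt_comp0 _ _))).
  by rewrite -(u g) // -(u h).
split=> // V y; split=> [py|[x <-]].
  have [h [e _]] := ki _ _ (proj1 (kernel_ker p)).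
  have yk : y \in lker (p V) by rewrite memv_ker py.
  exists (h V (vsproj (lker (p V)) y)).
  by rewrite -comp_lfunE (nt_app e) sub_pf_incE vsprojK.
by rewrite -comp_lfunE (nt_app pi0) zero_lfunE.
Qed.

Section Const.
Variable T : vectType k.

Definition const_map V W (f : 'Hom(V, W)) : 'End(T) := \1%VF.

Lemma const_mapM U V W (g : 'Hom(V, W)) (f : 'Hom(U, V)) :
  const_map (g \o f)%VF = (const_map g \o const_map f)%VF.
Proof. by rewrite /const_map comp_lfun1l. Qed.

Lemma const_deg : exists d, forall V, polymap_le d (@const_map V V).
Proof. by exists 0%N => V; apply: polymapC. Qed.

Lemma const_poly V W : polymap (@const_map V W).
Proof. by exists 0%N; apply: polymapC. Qed.

Definition const_pf : polyfunctor k :=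
  @PolyFunctor k (fun _ => T) const_map (fun V => erefl) const_mapM const_poly const_deg.

End Const.

Definition zero_vect : vectType k := 'rV[k]_0.

Lemma zero_vect_dim : \dim {: zero_vect} = 0%N.
Proof. by rewrite dimvf dim_matrix. Qed.

(** * Direct sums *)

Section Product.
Variables M N : polyfunctor k.

Definition prod_map V W (f : 'Hom(V, W)) : 'Hom((M V * N V)%type, (M W * N W)%type) :=
  dsum_map (pmap M f) (pmap N f).

Lemma prod_mapE V W (f : 'Hom(V, W)) z :
  prod_map f z = (pmap M f z.1, pmap N f z.2).
Proof. exact: dsum_mapE. Qed.

Lemma prod_map1 V : prod_map (\1 : 'End(V))%VF = \1%VF.
Proof. by rewrite /prod_map !pmap1 dsum_map_id. Qed.

Lemma prod_mapM U V W (g : 'Hom(V, W)) (f : 'Hom(U, V)) :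
  prod_map (g \o f)%VF = (prod_map g \o prod_map f)%VF.
Proof. by rewrite /prod_map !pmapM dsum_map_comp. Qed.

Lemma dsum_map_linl (U U' V V' : vectType k) :
  linear (fun f : 'Hom(U, U') => dsum_map f (0 : 'Hom(V, V'))).
Proof.
move=> a f f'; apply/lfunP => x; rewrite homE !dsum_mapE homE.
by congr pair; rewrite /= !lfunE /= scaler0 addr0.
Qed.

Lemma dsum_map_linr (U U' V V' : vectType k) :
  linear (fun g : 'Hom(V, V') => dsum_map (0 : 'Hom(U, U')) g).
Proof.
move=> a f f'; apply/lfunP => x; rewrite homE !dsum_mapE homE.
by congr pair; rewrite /= !lfunE /= scaler0 addr0.
Qed.

Lemma prod_map_le d e V W : polymap_le d (@pmap k M V W) ->
  polymap_le e (@pmap k N V W) -> polymap_le (maxn d e) (@prod_map V W).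
Proof.
move=> hM hN.
pose F f := dsum_map (pmap M f) (0 : 'Hom(N V, N W)) +
            dsum_map (0 : 'Hom(M V, M W)) (pmap N f).
apply: (@polymap_ext _ _ _ _ F).
  move=> f; apply/lfunP => x; rewrite prod_mapE add_lfunE !dsum_mapE.
  by congr pair; rewrite /= !lfunE /= ?addr0 ?add0r.
apply: polymapD.
  apply: polymap_leW (leq_maxl _ _) _.
  exact: polymap_postlin hM (@dsum_map_linl _ _ _ _).
apply: polymap_leW (leq_maxr _ _) _.
exact: polymap_postlin hN (@dsum_map_linr _ _ _ _).
Qed.

Lemma prod_poly V W : polymap (@prod_map V W).
Proof.
have [d hd] := @pmap_poly k M V W; have [e he] := @pmap_poly k N V W.
by exists (maxn d e); apply: prod_map_le.
Qed.

Lemma prod_deg : exists d, forall V, polymap_le d (@prod_map V V).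
Proof.
have [d hd] := pmap_deg M; have [e he] := pmap_deg N.
by exists (maxn d e) => V; apply: prod_map_le.
Qed.

Definition prod_pf : polyfunctor k :=
  @PolyFunctor k (fun V => (M V * N V)%type) prod_map prod_map1 prod_mapM
    prod_poly prod_deg.

Definition inl_lfun (U V : vectType k) : 'Hom(U, (U * V)%type) := linfun (fun x => (x, 0)).
Definition inr_lfun (U V : vectType k) : 'Hom(V, (U * V)%type) := linfun (fun x => (0, x)).
Definition fst_lfun (U V : vectType k) : 'Hom((U * V)%type, U) := linfun fst.
Definition snd_lfun (U V : vectType k) : 'Hom((U * V)%type, V) := linfun snd.

Lemma inlE (U V : vectType k) x : inl_lfun U V x = (x, 0).
Proof. by rewrite linfunE // => a u v; congr pair; rewrite /= scaler0 addr0. Qed.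
Lemma inrE (U V : vectType k) x : inr_lfun U V x = (0, x).
Proof. by rewrite linfunE // => a u v; congr pair; rewrite /= scaler0 addr0. Qed.
Lemma fstE (U V : vectType k) x : fst_lfun U V x = x.1.
Proof. by rewrite linfunE. Qed.
Lemma sndE (U V : vectType k) x : snd_lfun U V x = x.2.
Proof. by rewrite linfunE. Qed.

Lemma prod_inlP V W (f : 'Hom(V, W)) :
  (inl_lfun (M W) (N W) \o pmap M f = pmap prod_pf f \o inl_lfun (M V) (N V))%VF.
Proof. by apply/lfunP => x; rewrite !comp_lfunE !inlE /= prod_mapE /= linear0. Qed.
Lemma prod_inrP V W (f : 'Hom(V, W)) :
  (inr_lfun (M W) (N W) \o pmap N f = pmap prod_pf f \o inr_lfun (M V) (N V))%VF.
Proof. by apply/lfunP => x; rewrite !comp_lfunE !inrE /= prod_mapE /= linear0. Qed.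
Lemma prod_fstP V W (f : 'Hom(V, W)) :
  (fst_lfun (M W) (N W) \o pmap prod_pf f = pmap M f \o fst_lfun (M V) (N V))%VF.
Proof. by apply/lfunP => x; rewrite !comp_lfunE !fstE /= prod_mapE. Qed.
Lemma prod_sndP V W (f : 'Hom(V, W)) :
  (snd_lfun (M W) (N W) \o pmap prod_pf f = pmap N f \o snd_lfun (M V) (N V))%VF.
Proof. by apply/lfunP => x; rewrite !comp_lfunE !sndE /= prod_mapE. Qed.

Definition prod_inl : nattrans M prod_pf :=
  @NatTrans k M prod_pf (fun V => inl_lfun (M V) (N V)) prod_inlP.
Definition prod_inr : nattrans N prod_pf :=
  @NatTrans k N prod_pf (fun V => inr_lfun (M V) (N V)) prod_inrP.
Definition prod_fst : nattrans prod_pf M :=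
  @NatTrans k prod_pf M (fun V => fst_lfun (M V) (N V)) prod_fstP.
Definition prod_snd : nattrans prod_pf N :=
  @NatTrans k prod_pf N (fun V => snd_lfun (M V) (N V)) prod_sndP.

Lemma prod_biproduct :
  is_biproduct (C := polyfunctor_cat k) prod_inl prod_inr prod_fst prod_snd.
Proof.
split; apply: nattransP => V; apply/lfunP => x.
- by rewrite comp_lfunE inlE fstE id_lfunE.
- by rewrite comp_lfunE inrE sndE id_lfunE.
- by rewrite comp_lfunE inrE fstE zero_lfunE.
- by rewrite comp_lfunE inlE sndE zero_lfunE.
rewrite id_lfunE /= add_lfunE !comp_lfunE inlE inrE fstE sndE.
by case: x => a b; congr pair; rewrite /= ?addr0 ?add0r.
Qed.

End Product.

Lemma biproduct_pexact X Y Z (i1 : nattrans X Y) (i2 : nattrans Z Y) p1 p2 :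
  is_biproduct (C := polyfunctor_cat k) i1 i2 p1 p2 -> pexact i1 p2.
Proof.
move=> [p1i1 p2i2 p1i2 p2i1 sum].
have E (A B C : polyfunctor k) (s : nattrans B C) (t : nattrans A B) u V x :
  nt_comp s t = u -> s V (t V x) = u V x by move=> <- /=; rewrite comp_lfunE.
split.
- move=> V x y e; have := congr1 (p1 V) e.
  by rewrite !(E _ _ _ _ _ _ _ _ p1i1) !id_lfunE.
- move=> V; apply/vspaceP => z; rewrite memvf; apply/memv_imgP.
  by exists (i2 V z); rewrite ?memvf // (E _ _ _ _ _ _ _ _ p2i2) id_lfunE.
move=> V y; split=> [py|[x <-]]; last first.
  by rewrite (E _ _ _ _ _ _ _ _ p2i1) zero_lfunE.
exists (p1 V y); have := congr1 (fun t : nattrans Y Y => t V y) sum.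
by rewrite /= add_lfunE !comp_lfunE py linear0 addr0 id_lfunE.
Qed.

Lemma polyfunctor_abelian : abelian (polyfunctor_cat k).
Proof.
split.
- exists (const_pf zero_vect); apply: nattransP => V; apply/lfunP => x.
  exact/dim0_eq/zero_vect_dim.
- move=> M N; exists (prod_pf M N); exists (prod_inl M N), (prod_inr M N).
  by exists (prod_fst M N), (prod_snd M N); apply: prod_biproduct.
- by move=> M N t; exists (ker_pf t), (sub_pf_inc (@ker_stab M N t)); apply: kernel_ker.
- by move=> M N t; exists (coker_pf t), (quot_pf_pi (@img_stab M N t)); apply: cokernel_coker.
- move=> M N t /mono_pinj ti; exists (coker_pf t), (quot_pf_pi (@img_stab M N t)).
  exact/pexact_kernel/inj_pexact.
move=> M N t /epi_psurj ts; exists (ker_pf t), (sub_pf_inc (@ker_stab M N t)).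
exact/pexact_cokernel/surj_pexact.
Qed.

End AbelianCategory.

(** * Weight decomposition *)

Section Curves.
Variables (k : fieldType) (k_infinite : infinite_set [set: k]%classic).
Implicit Types (U V W X : vectType k) (g h : k).

Lemma nonzero_seq n : exists s : seq k, [/\ uniq s, size s = n & all (fun g => g != 0) s].
Proof.
elim: n => [|n [s [us ss s0]]]; first by exists [::].
have [g gs] : exists g, g \notin 0 :: s.
  apply: contrapT => /forallNP all_in; apply: k_infinite.
  apply: (@sub_finite_set _ _ [set` 0 :: s]%classic); last exact: finite_seq.
  by move=> g _ /=; apply/negPn/negP/all_in.
move: gs; rewrite inE negb_or => /andP[g0 gs].
by exists (g :: s); rewrite /= us gs ss g0 s0.
Qed.

Lemma poly_infinite_eq0 (p : {poly k}) : (forall g, g != 0 -> p.[g] = 0) -> p = 0.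
Proof.
move=> hp; have [s [us ss s0]] := nonzero_seq (size p).
apply: (roots_geq_poly_eq0 (rs := s)) => //; last by rewrite ss.
by apply/allP => g /(allP s0) /hp /eqP.
Qed.

(** A polynomial function of g with values in W. The coefficients are indexed by all of nat, so that
    two curves can be compared without matching their degree bounds. *)
Definition coefs W (F : k -> W) (w : nat -> W) :=
  exists2 n, (forall i, (n <= i)%N -> w i = 0) &
    forall g, F g = \sum_(i < n) g ^+ i *: w i.

Lemma coefsW W (F : k -> W) w : coefs F w ->
  exists n, forall N, (n <= N)%N -> forall g, F g = \sum_(i < N) g ^+ i *: w i.
Proof.
move=> [n w0 hF]; exists n => N nN g; rewrite hF.
rewrite -[LHS](big_mkord xpredT (fun i => g ^+ i *: w i)).
rewrite -[RHS](big_mkord xpredT (fun i => g ^+ i *: w i)).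
rewrite [RHS](big_cat_nat (leq0n n) nN) //= [X in _ + X]big_nat_cond.
rewrite [X in _ + X]big1 ?addr0 // => i /andP[/andP[ni _] _].
by rewrite w0 ?scaler0.
Qed.

(** Each coordinate of the difference is a polynomial over k with infinitely many roots. Agreement
    is asked for g != 0 only because weight spaces are defined through GL(k). *)
Lemma coefs_uniq W (F F' : k -> W) w w' : coefs F w -> coefs F' w' ->
  (forall g, g != 0 -> F g = F' g) -> w =1 w'.
Proof.
move=> [n w0 hF] [n' w0' hF'] eF i.
have [m hm] : exists n, forall N, (n <= N)%N -> forall g, F g = \sum_(i < N) g ^+ i *: w i.
  by apply: coefsW; exists n.
have [m' hm'] : exists n, forall N, (n <= N)%N -> forall g, F' g = \sum_(i < N) g ^+ i *: w' i.
  by apply: coefsW; exists n'.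
pose N := maxn (maxn m m') i.+1.
have {}hm : forall g, F g = \sum_(i < N) g ^+ i *: w i by apply: hm; rewrite !leq_max leqnn.
have {}hm' : forall g, F' g = \sum_(i < N) g ^+ i *: w' i.
  by apply: hm'; rewrite !leq_max leqnn !orbT.
have iN : (i < N)%N by rewrite leq_max leqnn orbT.
apply/eqP; rewrite -subr_eq0; apply/eqP.
rewrite (vbasisE (w i - w' i)) big1 // => j _.
set c := coord _ j; suff : \poly_(a < N) c (w a - w' a) = 0.
  by move=> /polyP/(_ i); rewrite coef_poly iN coef0 => ->; rewrite scale0r.
apply: poly_infinite_eq0 => g g0; rewrite horner_poly.
transitivity (c (F g - F' g)); last by rewrite eF // subrr /c linear0.
rewrite hm hm' -sumrB /c linear_sum; apply: eq_bigr => a _.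
by rewrite -scalerBr linearZ /= mulrC.
Qed.

Lemma coefs_ext W (F F' : k -> W) w w' :
  F =1 F' -> w =1 w' -> coefs F w -> coefs F' w'.
Proof.
move=> eF ew [n w0 hF]; exists n => [i ni|g]; first by rewrite -ew w0.
by rewrite -eF hF; apply: eq_bigr => i _; rewrite ew.
Qed.

Lemma coefs_lin U W (l : 'Hom(U, W)) (F : k -> U) w :
  coefs F w -> coefs (fun g => l (F g)) (fun i => l (w i)).
Proof.
move=> [n w0 hF]; exists n => [i ni|g]; first by rewrite w0 ?linear0.
by rewrite hF linear_sum; apply: eq_bigr => i _; rewrite linearZ.
Qed.

Lemma coefs_app U W (F : k -> 'Hom(U, W)) (w : nat -> 'Hom(U, W)) u :
  coefs F w -> coefs (fun g => F g u) (fun i => w i u).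
Proof.
move=> [n w0 hF]; exists n => [i ni|g]; first by rewrite w0 ?zero_lfunE.
by rewrite hF sum_lfunE; apply: eq_bigr => i _; rewrite scale_lfunE.
Qed.

Lemma coefs_at0 W (F : k -> W) w : coefs F w -> F 0 = w 0%N.
Proof.
move=> /coefsW[n /(_ n.+1 (leqnSn n) 0)] ->.
rewrite big_ord_recl expr0 scale1r big1 ?addr0 // => i _.
by rewrite exprS mul0r scale0r.
Qed.

Lemma coefs_at1 W (F : k -> W) w : coefs F w -> exists n, F 1 = \sum_(i < n) w i.
Proof.
move=> [n _ hF]; exists n; rewrite hF; apply: eq_bigr => i _.
by rewrite expr1n scale1r.
Qed.

Lemma coefs_shift W (F : k -> W) w r : coefs F w ->
  coefs (fun g => g ^+ r *: F g) (fun i => if (i < r)%N then 0 else w (i - r)%N).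
Proof.
move=> [n w0 hF]; exists (r + n)%N => [i ni|g].
  by case: ifP => // _; rewrite w0 // leq_subRL // (leq_trans _ ni) ?leq_addr.
rewrite hF big_split_ord /= [X in _ = X + _]big1 ?add0r; last first.
  by move=> i _; rewrite /= ltn_ord scaler0.
rewrite scaler_sumr; apply: eq_bigr => i _.
by rewrite ltnNge leq_addr /= addKn exprD scalerA.
Qed.

Lemma coefsC W (x : W) : coefs (fun=> x) (fun i => if i == 0%N then x else 0).
Proof.
exists 1%N => [[]//|g]; by rewrite big_ord1 /= expr0 scale1r.
Qed.

Lemma coefs_monomial W (x : W) r :
  coefs (fun g => g ^+ r *: x) (fun i => if i == r then x else 0).
Proof.
apply: coefs_ext (coefs_shift r (coefsC x)) => // i /=.
by rewrite subn_eq0; case: ltngtP.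
Qed.

Lemma coefs_scale W (F : k -> W) w h : coefs F w ->
  coefs (fun g => F (h * g)) (fun i => h ^+ i *: w i).
Proof.
move=> [n w0 hF]; exists n => [i ni|g]; first by rewrite w0 ?scaler0.
by rewrite hF; apply: eq_bigr => i _; rewrite exprMn scalerA mulrC.
Qed.

Lemma coefs_eq0 W (F F' : k -> W) w w' : coefs F w -> coefs F' w' ->
  (forall g, g != 0 -> F g = F' g) -> F 0 = F' 0.
Proof. by move=> h h' e; rewrite (coefs_at0 h) (coefs_at0 h') (coefs_uniq h h' e). Qed.

(** A limit argument without topology: in the quotient by U the curve vanishes for g != 0, hence at
    0. *)
Lemma coefs_subspace W (F : k -> W) w (U : {vspace W}) :
  coefs F w -> (forall g, g != 0 -> F g \in U) -> F 0 \in U.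
Proof.
move=> h hU; rewrite -vquot_pi_eq0; apply/eqP.
apply: (coefs_eq0 (coefs_lin (vquot_pi U) h) (coefsC 0)) => g g0.
by apply/eqP; rewrite vquot_pi_eq0 hU.
Qed.

Lemma polyfun_poly d U (F : U -> k) (u : k -> U) : polyfun_le d F ->
  (forall i, exists c : k, forall g, coord (vbasis {:U}) i (u g) = g * c) ->
  exists2 p : {poly k}, (size p <= d.+1)%N & forall g, F (u g) = p.[g].
Proof.
move=> [p sp hp] hu; have [c hc] := all_sig (fun i => cid (hu i)).
exists (\sum_(m <- msupp p) (p@_m * \prod_i c i ^+ m i) *: 'X^(mdeg m)).
  rewrite big_seq; elim/big_ind: _ => [|q q' sq sq'|m mp]; first by rewrite size_poly0.
    by rewrite (leq_trans (size_polyD _ _)) // geq_max sq.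
  rewrite (leq_trans (size_scale_leq _ _)) // size_polyXn.
  exact: leq_trans (msize_mdeg_lt mp) sp.
move=> g; rewrite hp mevalE horner_sum; apply: eq_bigr => m _.
rewrite hornerZ hornerXn -mulrA; congr (_ * _).
under eq_bigr => i _ do rewrite hc exprMn.
by rewrite big_split /= mulrC mdegE expr_sum.
Qed.

(** The bound d is carried along because the degree of a polynomial functor is bounded uniformly in
    V; this becomes the bound on the total degree in [total_degree_exists]. *)
Lemma polymap_coefs d W (F : k^o -> W) : polymap_le d F ->
  exists2 w, (forall i, (d < i)%N -> w i = 0) & coefs (fun g : k => F g) w.
Proof.
move=> hF.
have hp j : exists p : {poly k}, (size p <= d.+1)%N /\
    forall g : k, coord (vbasis {:W}) j (F g) = p.[g].
  have [|p sp hp] := polyfun_poly (u := fun g : k => (g : k^o)) (hF j); last by exists p.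
  move=> i; exists (coord (vbasis {:k^o}) i (1 : k^o)) => g.
  by rewrite -linearZ /=; congr (coord _ i _); rewrite /GRing.scale /= mulr1.
have [p {}hp] := all_sig (fun j => cid (hp j)).
have w0 i : (d < i)%N -> \sum_j (p j)`_i *: (vbasis {:W})`_j = 0.
  move=> di; apply: big1 => j _; have [sp _] := hp j.
  by rewrite nth_default ?scale0r // (leq_trans sp).
exists (fun i => \sum_j (p j)`_i *: (vbasis {:W})`_j) => //; exists d.+1 => //.
move=> g; rewrite [LHS]vbasisE; under [RHS]eq_bigr => i _ do rewrite scaler_sumr.
rewrite exchange_big /=; apply: eq_bigr => j _; have [sp ->] := hp j.
rewrite (horner_coef_wide g sp) scaler_suml; apply: eq_bigr => i _.
by rewrite scalerA mulrC.
Qed.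

Lemma polymap_comp_coefs d W X (G : W -> X) (F : k^o -> W) :
  polymap_le d G -> polymap_le 1 F ->
  exists2 w, (forall i, (d < i)%N -> w i = 0) & coefs (fun g : k => G (F g)) w.
Proof. by move=> hG hF; apply: polymap_coefs (polymap_comp hG hF). Qed.

Lemma affine_polymap W (u v : W) : polymap_le 1 (fun g : k^o => u + g *: v).
Proof.
apply: polymapD (polymapC _ _ _) _; apply: polymap_lin => a g h.
by rewrite scalerDl scalerA.
Qed.

End Curves.

(** * Weight projections and exactness of A_r *)

Section Weights.
Variables (k : fieldType) (k_infinite : infinite_set [set: k]%classic).
Implicit Types (L M N X Y Z : polyfunctor k) (U V W : vectType k) (g h : k).

Lemma pmap_affine_coefs M V W (u v : 'Hom(V, W)) :
  exists w, coefs (fun g => pmap M (u + g *: v)) w.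
Proof.
have [d hd] := @pmap_poly k M V W.
by have [w _ hw] := polymap_comp_coefs hd (affine_polymap u v); exists w.
Qed.

Lemma gl1_actE V g z : gl1_act V g z = (z.1, g * z.2).
Proof. by rewrite dsum_mapE id_lfunE scale_lfunE id_lfunE. Qed.

Lemma gl1_act_affine V g :
  gl1_act V g = dsum_map (\1 : 'End(V))%VF 0 + g *: dsum_map 0 (\1 : 'End(k^o))%VF.
Proof.
apply/lfunP => z; rewrite add_lfunE scale_lfunE gl1_actE !dsum_mapE !lfunE /=.
by congr pair; rewrite /= ?scaler0 ?addr0 ?add0r.
Qed.

Lemma gl1_act1 V : gl1_act V 1 = \1%VF.
Proof. by rewrite /gl1_act scale1r dsum_map_id. Qed.

Lemma gl1_actM V g h : gl1_act V (g * h) = (gl1_act V g \o gl1_act V h)%VF.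
Proof.
by apply/lfunP => z; rewrite comp_lfunE !gl1_actE mulrA.
Qed.

Lemma wproj_subproof M V : exists w, coefs (fun g => pmap M (gl1_act V g)) w.
Proof.
have [w hw] := pmap_affine_coefs M (dsum_map (\1 : 'End(V))%VF 0)
  (dsum_map 0 (\1 : 'End(k^o))%VF).
by exists w; apply: coefs_ext hw => // g; rewrite gl1_act_affine.
Qed.

(** The coefficient of g^i in the operator M(1 ⊕ g). By [wproj_weight], [weight_wproj] and
    [wproj_sum] these operators are the projections of a weight decomposition. *)
Definition wproj M V : nat -> 'End(M (V * k^o)%type) := projT1 (cid (wproj_subproof M V)).

Lemma wproj_coefs M V : coefs (fun g => pmap M (gl1_act V g)) (wproj M V).
Proof. by rewrite /wproj; case: cid. Qed.

Lemma wproj_app M V x : coefs (fun g => pmap M (gl1_act V g) x) (fun i => wproj M V i x).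
Proof. exact/coefs_app/wproj_coefs. Qed.

Lemma wproj_intertwine M N V W (phi : 'Hom(M (V * k^o)%type, N (W * k^o)%type)) r x :
  (forall g, phi (pmap M (gl1_act V g) x) = pmap N (gl1_act W g) (phi x)) ->
  phi (wproj M V r x) = wproj N W r (phi x).
Proof.
move=> e; apply: (coefs_uniq k_infinite (coefs_lin phi (wproj_app x)) (wproj_app (phi x))).
by move=> g _; apply: e.
Qed.

Lemma wproj_nt M N (t : nattrans M N) V r x :
  t (V * k^o)%type (wproj M V r x) = wproj N V r (t (V * k^o)%type x).
Proof. by apply: wproj_intertwine => g; rewrite -!comp_lfunE ncompP. Qed.

Lemma wproj_stab M V W (f : 'Hom(V, W)) r x :
  pmap M (stab f) (wproj M V r x) = wproj M W r (pmap M (stab f) x).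
Proof. by apply: wproj_intertwine => g; rewrite -!comp_lfunE -!pmapM stab_act. Qed.

Lemma wproj_act M V r g x :
  wproj M V r (pmap M (gl1_act V g) x) = g ^+ r *: wproj M V r x.
Proof.
apply: (coefs_uniq k_infinite (wproj_app _) (coefs_scale g (wproj_app x)) _ r).
by move=> h _ /=; rewrite -comp_lfunE -pmapM -gl1_actM mulrC.
Qed.

Lemma act_wproj M V r g x :
  pmap M (gl1_act V g) (wproj M V r x) = g ^+ r *: wproj M V r x.
Proof.
rewrite -wproj_act; apply: wproj_intertwine => h.
by rewrite -!comp_lfunE -!pmapM -!gl1_actM mulrC.
Qed.

Lemma wproj_weight M V r x : wproj M V r x \in weight M r V.
Proof. by apply/weightP => g _; rewrite act_wproj. Qed.

Lemma weight_wprojE M V r x s : x \in weight M r V ->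
  wproj M V s x = if s == r then x else 0.
Proof.
move=> /weightP hx.
exact: (coefs_uniq k_infinite (wproj_app x) (coefs_monomial x r) hx s).
Qed.

Lemma weight_wproj M V r x : x \in weight M r V -> wproj M V r x = x.
Proof. by move=> /(weight_wprojE r) ->; rewrite eqxx. Qed.

(** The definition of [weight] speaks of nonzero g. Passing through the projection includes g = 0,
    where the action is V ⊕ k -> V -> V ⊕ k. *)
Lemma weight_act M V r g x : x \in weight M r V -> pmap M (gl1_act V g) x = g ^+ r *: x.
Proof. by move=> /weight_wproj <-; rewrite act_wproj. Qed.

Lemma wproj_sum M V x : exists n, x = \sum_(i < n) wproj M V i x.
Proof.
have [n e] := coefs_at1 (wproj_app x); exists n.
by rewrite -e gl1_act1 pmap1 id_lfunE.
Qed.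

(** A preimage of a vector of weight r can be replaced by its component of weight r, which is again
    a preimage because projections commute with natural transformations. *)
Lemma A_pexact r X Y Z (i : nattrans X Y) (p : nattrans Y Z) :
  pexact i p -> pexact (A_nattrans r i) (A_nattrans r p).
Proof.
move=> [iI pS ex]; split=> [V u v e|V|V y].
- apply/subvs_inj/(iI (V * k^o)%type).
  by rewrite -!A_ntE; congr (vsval _).
- apply/vspaceP => z; rewrite memvf; apply/memv_imgP.
  have /memv_imgP[y _ ey] : vsval z \in limg (p (V * k^o)%type) by rewrite pS memvf.
  exists (vsproj (weight Y r V) (wproj Y V r y)); rewrite ?memvf //.
  apply: subvs_inj; rewrite A_ntE vsprojK ?wproj_weight // wproj_nt -ey.
  by rewrite weight_wproj ?subvsP.
split=> [py|[x <-]]; last first.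
  by apply: subvs_inj; rewrite !A_ntE; apply/ex; exists (vsval x).
have /ex[x ix] : p (V * k^o)%type (vsval y) = 0 by rewrite -A_ntE /= py.
exists (vsproj (weight X r V) (wproj X V r x)).
apply: subvs_inj; rewrite A_ntE vsprojK ?wproj_weight // wproj_nt ix.
by rewrite weight_wproj ?subvsP.
Qed.

Lemma dim_iso V W : \dim {:V} = \dim {:W} ->
  exists f : 'Hom(V, W), exists2 f' : 'Hom(W, V), (f' \o f = \1)%VF & (f \o f' = \1)%VF.
Proof.
have half (X Y : vectType k) (e : \dim {:X} = \dim {:Y}) (e' : \dim {:Y} = \dim {:X}) x :
    \sum_j coord (vbasis {:Y}) j (\sum_i coord (vbasis {:X}) i x *:
      (vbasis {:Y})`_(cast_ord e i)) *: (vbasis {:X})`_(cast_ord e' j) = x.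
  have -> : \sum_i coord (vbasis {:X}) i x *: (vbasis {:Y})`_(cast_ord e i) =
      \sum_(j < \dim {:Y}) coord (vbasis {:X}) (cast_ord e' j) x *: (vbasis {:Y})`_j.
    rewrite (reindex (cast_ord e')) /=; last first.
      by exists (cast_ord e) => j _; apply: val_inj.
    by apply: eq_bigr => j _.
  rewrite [RHS]vbasisE (reindex (cast_ord e')) /=; last first.
    by exists (cast_ord e) => j _; apply: val_inj.
  apply: eq_bigr => j _.
  by rewrite (coord_sum_free (fun j => coord (vbasis {:X}) (cast_ord e' j) x))
    ?(basis_free (vbasisP _)).
move=> e; have e' := esym e.
have lin (X Y : vectType k) (d : \dim {:X} = \dim {:Y}) :
    linear (fun x : X => \sum_i coord (vbasis {:X}) i x *: (vbasis {:Y})`_(cast_ord d i)).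
  move=> a x y; rewrite scaler_sumr -big_split; apply: eq_bigr => i _ /=.
  by rewrite linearP scalerDl scalerA.
exists (linfun (fun x => \sum_i coord (vbasis {:V}) i x *: (vbasis {:W})`_(cast_ord e i))).
exists (linfun (fun x => \sum_i coord (vbasis {:W}) i x *: (vbasis {:V})`_(cast_ord e' i))).
  by apply/lfunP => x; rewrite comp_lfunE id_lfunE !(linfunE (lin _ _ _)) half.
by apply/lfunP => x; rewrite comp_lfunE id_lfunE !(linfunE (lin _ _ _)) half.
Qed.

Lemma iso_dim V W (f : 'Hom(V, W)) (f' : 'Hom(W, V)) :
  (f' \o f = \1)%VF -> (f \o f' = \1)%VF -> \dim {:V} = \dim {:W}.
Proof.
have half (X Y : vectType k) (h : 'Hom(X, Y)) (h' : 'Hom(Y, X)) :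
    (h' \o h = \1)%VF -> (\dim {:X} <= \dim {:Y})%N.
  move=> e; rewrite -(@limg_dim_eq _ _ _ h) ?dimvS ?subvf // capfv; apply/eqP/lker0P.
  by move=> x y exy; rewrite -[x](id_lfunE) -[y](id_lfunE) -e !comp_lfunE exy.
by move=> e e'; apply/eqP; rewrite eqn_leq (half _ _ _ _ e) (half _ _ _ _ e').
Qed.

Lemma pmap_iso M V W (f : 'Hom(V, W)) (f' : 'Hom(W, V)) :
  (f' \o f = \1)%VF -> (pmap M f' \o pmap M f = \1)%VF.
Proof. by move=> e; rewrite -pmapM e pmap1. Qed.

Lemma pf_dim_eq M V W : \dim {:V} = \dim {:W} -> \dim {:M V} = \dim {:M W}.
Proof.
by move=> /dim_iso[f [f' /(pmap_iso M) e /(pmap_iso M) e']]; apply: iso_dim e e'.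
Qed.

Lemma dim_prod V W : \dim {:(V * W)%type} = (\dim {:V} + \dim {:W})%N.
Proof. by rewrite !dimvf. Qed.

Lemma weights_dim0 M V : (forall r, \dim {: A_polyfunctor r M V} = 0%N) ->
  \dim {:M (V * k^o)%type} = 0%N.
Proof.
move=> h; apply/eqP; rewrite dimv_eq0 -subv0; apply/subvP => x _.
have [n ->] := wproj_sum x; rewrite memv0 big1 // => i _.
have z := dim0_eq (vsproj (weight M i V) (wproj M V i x) : A_polyfunctor i M V) 0 (h i).
by rewrite -[LHS](vsprojK (wproj_weight i x)) z.
Qed.

End Weights.

(** * Tensor and exterior powers *)

Section Tensors.
Variable k : fieldType.
Implicit Types (A B C T U V W X Y : vectType k).

Lemma pureDl a U V (u u' : U) (v : V) : pure (a *: u + u') v = a *: pure u v + pure u' v.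
Proof. by apply/lfunP => p; rewrite homE !pureE linearP scalerDl scalerA. Qed.

Lemma pureDr a U V (u : U) (v v' : V) : pure u (a *: v + v') = a *: pure u v + pure u v'.
Proof. by apply/lfunP => p; rewrite homE !pureE scalerDr !scalerA mulrC. Qed.

Definition pure_l U V (v : V) : 'Hom(U, tens U V) := linfun (fun u => pure u v).
Definition pure_r U V (u : U) : 'Hom(V, tens U V) := linfun (pure u).

Lemma pure_lE U V (v : V) (u : U) : pure_l U v u = pure u v.
Proof. by rewrite linfunE // => a x y; apply: pureDl. Qed.

Lemma pure_rE U V (u : U) (v : V) : pure_r V u v = pure u v.
Proof. by rewrite linfunE // => a x y; apply: pureDr. Qed.

Definition vcoord U (i : 'I_(\dim {:U})) : dual U :=
  linfun (coord (vbasis {:U}) i : U -> k^o).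

Lemma vcoordE U i (u : U) : vcoord i u = coord (vbasis {:U}) i u.
Proof. by rewrite linfunE // => a x y; rewrite linearP. Qed.

(** With U ⊗ V encoded as Hom(U^*, V), a tensor is determined by its values on the dual basis. This
    is why it suffices to compare linear maps on pure tensors ([tens_ext]). *)
Lemma tens_basis U V (t : tens U V) : t = \sum_(i < \dim {:U}) pure (vbasis {:U})`_i (t (vcoord i)).
Proof.
apply/lfunP => p; rewrite sum_lfunE.
have {1}-> : p = \sum_(i < \dim {:U}) (p (vbasis {:U})`_i : k) *: vcoord i.
  apply/lfunP => u; rewrite sum_lfunE {1}(vbasisE u) linear_sum; apply: eq_bigr => i _.
  by rewrite linearZ scale_lfunE vcoordE /GRing.scale /= mulrC.
by rewrite linear_sum; apply: eq_bigr => i _; rewrite linearZ pureE.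
Qed.

Lemma tens_ext U V W (f g : 'Hom(tens U V, W)) :
  (forall u v, f (pure u v) = g (pure u v)) -> f = g.
Proof.
move=> e; apply/lfunP => t; rewrite (tens_basis t) !linear_sum.
by apply: eq_bigr => i _; apply: e.
Qed.

Lemma tens_subspace U V (W : {vspace tens U V}) :
  (forall u v, pure u v \in W) -> forall t, t \in W.
Proof. by move=> h t; rewrite (tens_basis t) memv_suml. Qed.

Definition tens_lift U V W (b : U -> 'Hom(V, W)) : 'Hom(tens U V, W) :=
  linfun (fun t : tens U V => \sum_(i < \dim {:U}) b (vbasis {:U})`_i (t (vcoord i))).

Lemma tens_lift_pure U V W (b : U -> 'Hom(V, W)) u v :
  linear b -> tens_lift b (pure u v) = b u v.
Proof.
move=> lb; rewrite linfunE; last first.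
  move=> a s t; rewrite scaler_sumr -big_split; apply: eq_bigr => i _.
  by rewrite homE linearP.
pose L : 'Hom(U, 'Hom(V, W)) := linfun b.
have LE w : b w = L w by rewrite (linfunE lb).
rewrite [in RHS](vbasisE u) LE linear_sum sum_lfunE; apply: eq_bigr => i _.
by rewrite LE linearZ scale_lfunE pureE linearZ vcoordE.
Qed.

Definition tens_swap A B C : 'Hom(tens (tens A B) C, tens (tens A C) B) :=
  tens_lift (fun s : tens A B =>
    linfun (fun c : C => tens_map (pure_l A c) (\1 : 'End(B))%VF s)).

Lemma tens_swapE A B C (a : A) (b : B) (c : C) :
  tens_swap A B C (pure (pure a b) c) = pure (pure a c) b.
Proof.
have pl : linear (fun c : C => pure_l A c).
  by move=> x y z; apply/lfunP => u; rewrite homE !pure_lE pureDr.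
have lc (s : tens A B) : linear (fun c : C => tens_map (pure_l A c) (\1 : 'End(B))%VF s).
  by move=> x y z; rewrite pl tens_mapPl homE.
rewrite tens_lift_pure; last first.
  move=> x s t; apply/lfunP => d; rewrite homE !(linfunE (lc _)); exact: linearP.
by rewrite (linfunE (lc _)) tens_map_pure pure_lE id_lfunE.
Qed.

Lemma tens_ext3 A B C W (f g : 'Hom(tens (tens A B) C, W)) :
  (forall a b c, f (pure (pure a b) c) = g (pure (pure a b) c)) -> f = g.
Proof.
move=> e; apply: tens_ext => s c; rewrite -!pure_lE -!comp_lfunE.
congr (fun_of_lfun _ s); apply: tens_ext => a b.
by rewrite !comp_lfunE !pure_lE.
Qed.

Lemma tens_swap_nat A B C A' B' C' (f : 'Hom(A, A')) (g : 'Hom(B, B')) (h : 'Hom(C, C')) :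
  (tens_swap A' B' C' \o tens_map (tens_map f g) h =
   tens_map (tens_map f h) g \o tens_swap A B C)%VF.
Proof.
by apply: tens_ext3 => a b c; rewrite !comp_lfunE !(tens_map_pure, tens_swapE).
Qed.

Lemma tens_swapK A B C : (tens_swap A C B \o tens_swap A B C = \1)%VF.
Proof. by apply: tens_ext3 => a b c; rewrite comp_lfunE !tens_swapE id_lfunE. Qed.

Lemma tpow_ext r X W (f g : 'Hom(tpow r X, W)) :
  (forall v, f (tpure r v) = g (tpure r v)) -> f = g.
Proof.
elim: r W f g => [|r IH] W f g e.
  apply/lfunP => c; have -> : c = (c : k) *: (1 : k^o).
    by rewrite /GRing.scale /= mulr1.
  rewrite !linearZ; congr (_ *: _); exact: (e (fun=> 0)).
apply: tens_ext => x s; rewrite -!pure_rE -!comp_lfunE.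
congr (fun_of_lfun _ s); apply: IH => v; rewrite !comp_lfunE !pure_rE.
exact: (e (fun i => if i is i'.+1 then v i' else x)).
Qed.

Lemma tpow_subspace r X (W : {vspace tpow r X}) :
  (forall v, tpure r v \in W) -> forall t, t \in W.
Proof.
move=> h t; rewrite -vquot_pi_eq0; apply/eqP.
have -> : vquot_pi W = 0; last by rewrite zero_lfunE.
by apply: tpow_ext => v; rewrite zero_lfunE; apply/eqP; rewrite vquot_pi_eq0.
Qed.

Lemma alt_rel_ind r X (W : {vspace tpow r X}) :
  (forall v i j, (i < j)%N -> (j < r)%N -> v i = v j -> tpure r v \in W) ->
  forall t, t \in alt_rel r X -> t \in W.
Proof.
move=> h t; move: t; apply/subvP/vspan_sub => _ [v [[i [j [ij jr e]]] ->]].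
exact: h ij jr e.
Qed.

Lemma alt_rel_pure r X (v : nat -> X) i j :
  (i < j)%N -> (j < r)%N -> v i = v j -> tpure r v \in alt_rel r X.
Proof. by move=> ij jr e; apply: vspan_mem; exists v; split=> //; exists i, j. Qed.

Lemma alt_rel_cons r X (x : X) t : t \in alt_rel r X -> pure x t \in alt_rel r.+1 X.
Proof.
rewrite -pure_rE memv_preim; apply: alt_rel_ind => v i j ij jr e.
rewrite -memv_preim pure_rE.
by apply: (@alt_rel_pure r.+1 _ (fun i => if i is i'.+1 then v i' else x) i.+1 j.+1).
Qed.

Lemma alt_rel_dup r X (x : X) (t : tpow r X) : pure x (pure x t) \in alt_rel r.+2 X.
Proof.
rewrite -pure_rE -pure_rE -comp_lfunE memv_preim; apply: tpow_subspace => v.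
rewrite -memv_preim comp_lfunE !pure_rE.
by apply: (@alt_rel_pure r.+2 _ (fun i => if i is i'.+2 then v i' else x) 0%N 1%N).
Qed.

(** Polarization of [alt_rel_dup] at x + y. *)
Lemma alt_rel_swap r X (x y : X) (t : tpow r X) :
  pure x (pure y t) + pure y (pure x t) \in alt_rel r.+2 X.
Proof.
have pD (T' : vectType k) (u u' : X) (s : T') : pure (u + u') s = pure u s + pure u' s.
  by have := pureDl 1 u u' s; rewrite !scale1r.
have pD' (u : X) (s s' : tpow r.+1 X) : pure u (s + s') = pure u s + pure u s'.
  by have := pureDr 1 u s s'; rewrite !scale1r.
have := memvB (alt_rel_dup (x + y) t) (memvD (alt_rel_dup x t) (alt_rel_dup y t)).
by rewrite pD pD pD' pD' opprD addrACA addrK (addrC (pure x (pure x t))) addrK.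
Qed.

Definition tens_eval X T (eps : dual X) : 'Hom(tens X T, T) :=
  linfun (fun t : tens X T => t eps).

Lemma tens_evalE X T (eps : dual X) (t : tens X T) : tens_eval T eps t = t eps.
Proof. by rewrite linfunE // => a u v; rewrite homE. Qed.

Lemma tens_eval_pure X T (eps : dual X) x (t : T) :
  tens_eval T eps (pure x t) = (eps x : k) *: t.
Proof. by rewrite tens_evalE pureE. Qed.

(* Contraction with eps: x_0 ⊗ ... ⊗ x_r maps to the alternating sum over i of
   eps(x_i) times the tensor without its i-th factor. *)
Fixpoint contract r X (eps : dual X) : 'Hom(tpow r.+1 X, tpow r X) :=
  if r is r'.+1 then
    tens_eval (tpow r'.+1 X) eps - tens_map (\1 : 'End(X))%VF (contract r' eps)
  else tens_eval (tpow 0 X) eps.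

Lemma contract_pure0 X (eps : dual X) x (t : tpow 0 X) :
  contract 0 eps (pure x t) = (eps x : k) *: t.
Proof. exact: tens_eval_pure. Qed.

Lemma contract_pureS r X (eps : dual X) x (t : tpow r.+1 X) :
  contract r.+1 eps (pure x t) = (eps x : k) *: t - pure x (contract r eps t).
Proof.
have -> : contract r.+1 eps =
    tens_eval (tpow r.+1 X) eps - tens_map (\1 : 'End(X))%VF (contract r eps) by [].
by rewrite add_lfunE opp_lfunE tens_eval_pure tens_map_pure id_lfunE.
Qed.

Lemma contract_nat r X Y (f : 'Hom(X, Y)) (eps : dual Y) :
  (contract r eps \o tpow_map r.+1 f = tpow_map r f \o contract r (eps \o f))%VF.
Proof.
elim: r => [|r IH]; apply: tens_ext => x t; rewrite !comp_lfunE.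
  rewrite [tpow_map 1 f _](tens_map_pure f) !contract_pure0 linearZ comp_lfunE.
  by congr (_ *: _).
rewrite [tpow_map r.+2 f _](tens_map_pure f) !contract_pureS linearB linearZ comp_lfunE.
congr (_ *: _ - _).
by rewrite [RHS](tens_map_pure f) -comp_lfunE IH comp_lfunE.
Qed.

Lemma contract0 r X : contract r (0 : dual X) = 0.
Proof.
elim: r => [|r IH]; apply: tens_ext => x t; rewrite zero_lfunE.
  by rewrite contract_pure0 zero_lfunE scale0r.
rewrite contract_pureS !zero_lfunE scale0r add0r IH zero_lfunE.
by rewrite -pure_rE linear0 oppr0.
Qed.

Lemma pureZ X T a x (t : T) : pure x (a *: t) = a *: (pure x t : tens X T).
Proof. by rewrite -!pure_rE linearZ. Qed.

Lemma pureB X T x (t u : T) : pure x (t - u) = pure x t - pure x u :> tens X T.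
Proof. by rewrite -!pure_rE linearB. Qed.

(** The left side is the contraction of [pure x (tpure r.+1 v)], a tensor in which x occurs twice.
    Induction on the position j of the second x: [alt_rel_swap] moves x past the first factor of
    v. *)
Lemma contract_mem r X (eps : dual X) x (v : nat -> X) j :
  (j < r.+1)%N -> v j = x ->
  (eps x : k) *: tpure r.+1 v - pure x (contract r eps (tpure r.+1 v)) \in alt_rel r.+1 X.
Proof.
have tE n (w : nat -> X) : tpure n.+1 w = pure (w 0%N) (tpure n (fun i => w i.+1)) by [].
elim: j r v => [|j IH] r v.
  move=> _ v0; case: r => [|r]; rewrite tE v0.
    by rewrite contract_pure0 pureZ subrr mem0v.
  rewrite contract_pureS pureB pureZ opprB addrC subrK.
  exact: alt_rel_dup.
case: r => // r; rewrite ltnS => jr vj; rewrite tE.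
set t := tpure r.+1 _; set y := v 0%N.
rewrite contract_pureS pureB pureZ opprB.
have h1 := alt_rel_cons y (IH r (fun i => v i.+1) jr vj).
have h2 := alt_rel_swap x y (contract r eps t).
have h3 : pure x t \in alt_rel r.+2 X.
  apply: (@alt_rel_pure r.+2 _ (fun i => if i is i'.+1 then v i'.+1 else x) 0%N j.+1) => //.
move: h1; rewrite -/t pureB pureZ => h1.
have := memvB (memvD h1 h2) (memvZ (eps y : k) h3).
by rewrite [pure x _ + _]addrC addrA subrK addrA.
Qed.

(** A repetition that involves the first factor is the case of [contract_mem]. Otherwise the first
    term of the contraction keeps the repeated pair, and the second is covered by induction. *)
Lemma contract_alt r X (eps : dual X) t :
  t \in alt_rel r.+1 X -> contract r eps t \in alt_rel r X.
Proof.
rewrite memv_preim; apply: alt_rel_ind => v i j; rewrite -memv_preim.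
elim: r {t} v i j => [|r IH] v i [|j] // ij; rewrite ltnS => jr e.
have -> : tpure r.+2 v = pure (v 0%N) (tpure r.+1 (fun i => v i.+1)) by [].
rewrite contract_pureS; case: i ij e => [|i] ij e.
  exact: (@contract_mem r X eps _ (fun i => v i.+1) j).
apply: memvB; last exact/alt_rel_cons/(IH _ i j).
by apply: memvZ; apply: (@alt_rel_pure r.+1 _ (fun i => v i.+1) i j).
Qed.

Definition ext_ind r s X Y (f : 'Hom(tpow r X, tpow s Y)) : 'Hom(ext r X, ext s Y) :=
  (vquot_pi (alt_rel s Y) \o (f \o vquot_sec (alt_rel r X)))%VF.

Lemma ext_indE r s X Y (f : 'Hom(tpow r X, tpow s Y)) t :
  (forall t, t \in alt_rel r X -> f t \in alt_rel s Y) ->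
  ext_ind f (vquot_pi (alt_rel r X) t) = vquot_pi (alt_rel s Y) (f t).
Proof.
move=> hf; transitivity (vquot_pi (alt_rel s Y)
    (f (vquot_sec (alt_rel r X) (vquot_pi (alt_rel r X) t)))).
  by etransitivity; [exact: comp_lfunE|congr (vquot_pi _ _); exact: comp_lfunE].
have [w wW ->] := vquot_secK (alt_rel r X) t.
rewrite !linearB /=; have /eqP-> : vquot_pi (alt_rel s Y) (f w) == 0.
  by rewrite vquot_pi_eq0 hf.
by rewrite subr0.
Qed.

Lemma ext_lfunP r X W (f g : 'Hom(ext r X, W)) :
  (forall t, f (vquot_pi (alt_rel r X) t) = g (vquot_pi (alt_rel r X) t)) -> f = g.
Proof. by move=> e; apply/lfunP => q; rewrite -(vquot_piK q). Qed.

Lemma vquot_pi_eq V (W : {vspace V}) u v :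
  u - v \in W -> vquot_pi W u = vquot_pi W v.
Proof. by rewrite -vquot_pi_eq0 linearB subr_eq0 => /eqP. Qed.

(** * Exterior powers of V ⊕ k *)

Section Line.
Variable V : vectType k.
Let X : vectType k := (V * k^o)%type.

Definition inV : 'Hom(V, X) := inl_lfun V k^o.
Definition prV : 'Hom(X, V) := fst_lfun V k^o.
Definition prk : dual X := snd_lfun V k^o.
Definition vone : X := (0, 1).

Lemma inVE v : inV v = (v, 0). Proof. exact: inlE. Qed.
Lemma prVE z : prV z = z.1. Proof. exact: fstE. Qed.
Lemma prkE z : prk z = z.2. Proof. exact: sndE. Qed.

Definition twedge m : 'Hom(tpow m V, tpow m.+1 X) := (pure_r _ vone \o tpow_map m inV)%VF.

Lemma twedgeE m t : twedge m t = pure vone (tpow_map m inV t).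
Proof. by rewrite comp_lfunE pure_rE. Qed.

Lemma twedge_alt m t : t \in alt_rel m V -> twedge m t \in alt_rel m.+1 X.
Proof. by move=> h; rewrite twedgeE; apply/alt_rel_cons/alt_rel_map. Qed.

Definition tcontr m : 'Hom(tpow m.+1 X, tpow m V) := (tpow_map m prV \o contract m prk)%VF.

Lemma tcontrE m t : tcontr m t = tpow_map m prV (contract m prk t).
Proof. by rewrite comp_lfunE. Qed.

Lemma tcontr_alt m t : t \in alt_rel m.+1 X -> tcontr m t \in alt_rel m V.
Proof. by move=> h; rewrite tcontrE; apply/alt_rel_map/contract_alt. Qed.

(** Left multiplication by the basis vector [vone] of k; [contr] contracts with the coordinate on k
    and projects to V. With the maps induced by [inV] and [prV] they form the biproduct Λ^(m+1)(V ⊕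
    k) = Λ^(m+1) V ⊕ Λ^m V. *)
Definition wedge m : 'Hom(ext m V, ext m.+1 X) := ext_ind (twedge m).
Definition contr m : 'Hom(ext m.+1 X, ext m V) := ext_ind (tcontr m).

Lemma wedgeE m t :
  wedge m (vquot_pi (alt_rel m V) t) = vquot_pi (alt_rel m.+1 X) (twedge m t).
Proof. by apply: ext_indE; apply: twedge_alt. Qed.

Lemma contrE m t :
  contr m (vquot_pi (alt_rel m.+1 X) t) = vquot_pi (alt_rel m V) (tcontr m t).
Proof. by apply: ext_indE; apply: tcontr_alt. Qed.

Lemma prV_inV : (prV \o inV)%VF = \1%VF.
Proof. by apply/lfunP => v; rewrite comp_lfunE inVE prVE id_lfunE. Qed.

Lemma contract_inV m t : contract m prk (tpow_map m.+1 inV t) = 0.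
Proof.
rewrite -comp_lfunE contract_nat comp_lfunE.
have -> : (prk \o inV)%VF = 0.
  by apply/lfunP => v; rewrite comp_lfunE inVE prkE zero_lfunE.
by rewrite contract0 zero_lfunE linear0.
Qed.

Lemma contract_twedge m t : tcontr m (twedge m t) = t.
Proof.
have pi t' : tpow_map m prV (tpow_map m inV t') = t'.
  by rewrite -comp_lfunE -tpow_map_comp prV_inV tpow_map_id id_lfunE.
rewrite tcontrE twedgeE; case: m t pi => [|m] t pi.
  by rewrite contract_pure0 prkE scale1r pi.
by rewrite contract_pureS prkE scale1r contract_inV -pure_rE linear0 subr0 pi.
Qed.

Lemma contr_wedge m : (contr m \o wedge m = \1)%VF.
Proof.
by apply: ext_lfunP => t; rewrite comp_lfunE wedgeE contrE contract_twedge id_lfunE.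
Qed.

Lemma contr_inV m : (contr m \o ext_map m.+1 inV = 0)%VF.
Proof.
apply: ext_lfunP => t; rewrite comp_lfunE ext_map_pi contrE tcontrE contract_inV.
by rewrite !linear0 zero_lfunE.
Qed.

Lemma prV_wedge m : (ext_map m.+1 prV \o wedge m = 0)%VF.
Proof.
apply: ext_lfunP => t; rewrite comp_lfunE wedgeE ext_map_pi twedgeE.
rewrite [tpow_map m.+1 _ _](tens_map_pure prV) prVE -pure_lE linear0.
by rewrite !linear0 zero_lfunE.
Qed.

Lemma prV_ext_inV m : (ext_map m prV \o ext_map m inV = \1)%VF.
Proof. by rewrite -ext_map_comp prV_inV ext_map_id. Qed.

Let E m : 'End(tpow m X) := tpow_map m (inV \o prV)%VF.

Lemma line_split z : z = inV (prV z) + (prk z : k) *: vone.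
Proof.
rewrite inVE prVE prkE; case: z => v a; congr pair; rewrite /= ?scaler0 ?addr0 //.
by rewrite add0r /GRing.scale /= mulr1.
Qed.

(** Split every factor along V ⊕ k. Terms with two factors [vone] vanish in the exterior power, and
    those with exactly one are moved to the front, with the signs that [contract] records. The
    induction peels off the first factor x: [alt_rel_swap] exchanges x and [vone], and [alt_rel_dup]
    kills the product of [vone] with itself. *)
Lemma alt_split m (t : tpow m.+1 X) :
  t - (E m.+1 t + pure vone (E m (contract m prk t))) \in alt_rel m.+1 X.
Proof.
pose phi n := \1%VF - (E n.+1 + (pure_r _ vone \o (E n \o contract n prk)))%VF.
have phiE n s : phi n s = s - (E n.+1 s + pure vone (E n (contract n prk s))).
  by rewrite add_lfunE opp_lfunE add_lfunE !comp_lfunE pure_rE id_lfunE.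
have EZ n a s : E n (a *: s) = a *: E n s by exact: linearZ.
have EBZ n a s s' : E n (a *: s - s') = a *: E n s - E n s'.
  by rewrite -EZ; exact: linearB.
have Ep n x s : E n.+1 (pure x s) = pure (inV (prV x)) (E n s).
  by rewrite [LHS](tens_map_pure (inV \o prV)%VF) comp_lfunE.
have pl n x (s : tpow n X) : pure x s = pure (inV (prV x)) s + (prk x : k) *: pure vone s.
  by rewrite {1}(line_split x) addrC pureDl addrC.
rewrite -phiE; elim: m t => [|m IH] t; rewrite memv_preim; move: t;
  apply: tens_subspace => x s; rewrite -memv_preim.
  rewrite (phiE 0%N) (Ep 0%N) contract_pure0 (EZ 0%N) pureZ (pl 0%N x s).
  have Es : E 0 s = s by rewrite [LHS]id_lfunE.
  by rewrite !Es subrr mem0v.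
rewrite (phiE m.+1) (Ep m.+1) contract_pureS EBZ (Ep m) pureB pureZ.
have {}IH := IH s; rewrite phiE in IH.
set c := contract m prk s in IH *.
have h1 := alt_rel_cons x IH.
have h2 := alt_rel_swap x vone (E m c).
have h3 := memvZ (prk x : k) (alt_rel_dup vone (E m c)).
have := memvB (memvD h1 h2) h3.
have pD (y : X) (u w : tpow m.+1 X) : pure y (u + w) = pure y u + pure y w.
  by rewrite -!pure_rE linearD.
rewrite pureB pD (pl _ x (E m.+1 s)) (pl _ x (E m c)) pD pureZ.
set a := pure x s; set b := pure _ (E m.+1 s); set d := pure vone (E m.+1 s).
set g := _ *: pure vone (pure vone _).
set e := pure x (pure vone _); set f := pure vone (pure _ _).
suff -> : a - (b + prk x *: d + e) + (e + (f + g)) - g = a - (b + (prk x *: d - f)) by [].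
rewrite -!addrA; congr (_ + _); rewrite !opprD !opprK -!addrA; congr (_ + (_ + _)).
by rewrite addrA addNr add0r subrr addr0.
Qed.

Lemma ext_split m :
  ((ext_map m.+1 inV \o ext_map m.+1 prV) + (wedge m \o contr m) = \1)%VF.
Proof.
apply: ext_lfunP => t; rewrite add_lfunE (comp_lfunE (ext_map _ _)) (comp_lfunE (wedge m)) id_lfunE.
rewrite !ext_map_pi contrE wedgeE.
rewrite -linearD; apply/esym/vquot_pi_eq.
rewrite twedgeE tcontrE -(comp_lfunE (tpow_map m inV)) -(comp_lfunE (tpow_map m.+1 inV)).
rewrite -!tpow_map_comp; exact: alt_split.
Qed.

Lemma act_wedge m g : (ext_map m.+1 (gl1_act V g) \o wedge m = g *: wedge m)%VF.
Proof.
apply: ext_lfunP => t; rewrite comp_lfunE scale_lfunE wedgeE ext_map_pi -linearZ.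
congr (vquot_pi _ _); rewrite !twedgeE.
rewrite [LHS](tens_map_pure (gl1_act V g)) -comp_lfunE -tpow_map_comp.
have -> : (gl1_act V g \o inV)%VF = inV.
  by apply/lfunP => v; rewrite comp_lfunE inVE gl1_actE mulr0.
have -> : gl1_act V g vone = g *: vone + 0.
  by rewrite addr0 gl1_actE; congr pair; rewrite /= scaler0.
by rewrite pureDl -(pure_lE _ 0) linear0 addr0.
Qed.

Lemma act_ext_inV m g : (ext_map m (gl1_act V g) \o ext_map m inV = ext_map m inV)%VF.
Proof.
rewrite -ext_map_comp; congr (ext_map m _).
by apply/lfunP => v; rewrite comp_lfunE inVE gl1_actE mulr0.
Qed.

End Line.

Lemma stab_inV V W (f : 'Hom(V, W)) : (stab f \o inV V = inV W \o f)%VF.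
Proof. by apply/lfunP => v; rewrite !comp_lfunE !inVE dsum_mapE linear0. Qed.

Lemma stab_prV V W (f : 'Hom(V, W)) : (prV W \o stab f = f \o prV V)%VF.
Proof. by apply/lfunP => v; rewrite !comp_lfunE !prVE dsum_mapE. Qed.

Lemma stab_wedge m V W (f : 'Hom(V, W)) :
  (ext_map m.+1 (stab f) \o wedge V m = wedge W m \o ext_map m f)%VF.
Proof.
apply: ext_lfunP => t; rewrite (comp_lfunE (ext_map _ _)) (comp_lfunE (wedge W m)).
rewrite ext_map_pi !wedgeE ext_map_pi.
congr (vquot_pi _ _); rewrite !twedgeE [LHS](tens_map_pure (stab f)).
rewrite dsum_mapE linear0 id_lfunE -!comp_lfunE -!tpow_map_comp; congr (pure _ (tpow_map m _ t)).
exact: stab_inV.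
Qed.

Lemma stab_contr m V W (f : 'Hom(V, W)) :
  (contr W m \o ext_map m.+1 (stab f) = ext_map m f \o contr V m)%VF.
Proof.
apply: ext_lfunP => t; rewrite (comp_lfunE (ext_map _ _)) (comp_lfunE (contr W m)).
rewrite ext_map_pi !contrE ext_map_pi.
congr (vquot_pi _ _); rewrite !tcontrE -(comp_lfunE (contract m _)) contract_nat.
have -> : (prk W \o stab f)%VF = prk V.
  by apply/lfunP => v; rewrite !comp_lfunE !prkE dsum_mapE id_lfunE.
by rewrite comp_lfunE -!comp_lfunE -!tpow_map_comp stab_prV.
Qed.

End Tensors.

(** * Commutation of the functors A and B *)

Section Relations.
Variables (k : fieldType) (k_infinite : infinite_set [set: k]%classic).
Implicit Types (L M N : polyfunctor k) (T U V W : vectType k).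

Lemma coefs_add W (F F' : k -> W) w w' : coefs F w -> coefs F' w' ->
  coefs (fun g => F g + F' g) (fun i => w i + w' i).
Proof.
move=> hF hF'; have [n hn] := coefsW hF; have [n' hn'] := coefsW hF'.
case: hF hF' => [a wa _] [a' wa' _]; exists (maxn (maxn n n') (maxn a a')).
  by move=> i; rewrite !geq_max => /andP[/andP[_ _] /andP[ai a'i]]; rewrite wa ?wa' ?addr0.
move=> g; rewrite (hn (maxn (maxn n n') (maxn a a'))) ?leq_max ?leqnn //.
rewrite (hn' (maxn (maxn n n') (maxn a a'))) ?leq_max ?leqnn ?orbT //.
by rewrite -big_split; apply: eq_bigr => i _; rewrite scalerDr.
Qed.

Lemma tens_map0r U U' V V' (f : 'Hom(U, U')) :
  tens_map f (0 : 'Hom(V, V')) = 0.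
Proof. by apply: tens_ext => u v; rewrite tens_map_pure !zero_lfunE -pure_rE linear0. Qed.

Lemma tens_mapZr U U' V V' (f : 'Hom(U, U')) (g : 'Hom(V, V')) a :
  tens_map f (a *: g) = a *: tens_map f g.
Proof. by have := tens_mapPr f a g 0; rewrite tens_map0r !addr0. Qed.

Lemma tens_map0l U U' V V' (g : 'Hom(V, V')) :
  tens_map (0 : 'Hom(U, U')) g = 0.
Proof. by apply: tens_ext => u v; rewrite tens_map_pure !zero_lfunE -pure_lE linear0. Qed.

Lemma tens_mapZl U U' V V' (f : 'Hom(U, U')) (g : 'Hom(V, V')) a :
  tens_map (a *: f) g = a *: tens_map f g.
Proof. by have := tens_mapPl g a f 0; rewrite tens_map0l !addr0. Qed.

Lemma tens_mapDr U U' V V' (f : 'Hom(U, U')) (g h : 'Hom(V, V')) :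
  tens_map f (g + h) = tens_map f g + tens_map f h.
Proof. by have := tens_mapPr f 1 g h; rewrite !scale1r. Qed.

Section Inclusion.
Variables (V : vectType k) (U : {vspace V}).
Definition vin : 'Hom(subvs_of U, V) := linfun (@vsval _ _ U).
Definition vpr : 'Hom(V, subvs_of U) := linfun (vsproj U).
Lemma vinE u : vin u = vsval u. Proof. by rewrite lfunE. Qed.
Lemma vprE v : vpr v = vsproj U v. Proof. by rewrite lfunE. Qed.
Lemma vin_inj : injective vin.
Proof. by move=> u v; rewrite !vinE; apply: subvs_inj. Qed.
Lemma vin_in u : vin u \in U. Proof. by rewrite vinE subvsP. Qed.
Lemma vin_vpr v : v \in U -> vin (vpr v) = v.
Proof. by move=> vU; rewrite vinE vprE vsprojK. Qed.
Lemma vin_lift T (J : 'Hom(T, V)) : (forall t, J t \in U) ->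
  (vin \o linfun (fun t => vsproj U (J t)) = J)%VF.
Proof.
move=> h; apply/lfunP => t; rewrite comp_lfunE vinE linfunE; first exact: vsprojK.
by move=> a x y; rewrite !linearP.
Qed.

Lemma vin_cancel T (f g : 'Hom(T, subvs_of U)) : (vin \o f = vin \o g)%VF -> f = g.
Proof. exact: (lfun_inj_compl (@vin_inj)). Qed.
End Inclusion.

Section WeightInclusion.
Variables (M : polyfunctor k) (n : nat).

(** Identities between maps of weight spaces are proved in M(V ⊕ k): compose with the injective
    [win], compute there, and cancel. *)
Definition win V : 'Hom(A_ob n M V, M (V * k^o)%type) := vin (weight M n V).
Definition wpr V : 'Hom(M (V * k^o)%type, A_ob n M V) :=
  linfun (fun x => vsproj (weight M n V) (wproj M V n x)).

Lemma win_cancel T V (f g : 'Hom(T, A_ob n M V)) : (win V \o f = win V \o g)%VF -> f = g.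
Proof. exact: vin_cancel. Qed.

Lemma win_wpr V : (win V \o wpr V = wproj M V n)%VF.
Proof. by apply: vin_lift => x; apply: wproj_weight. Qed.

Lemma wpr_win V : (wpr V \o win V = \1)%VF.
Proof.
apply: win_cancel; rewrite comp_lfunA win_wpr comp_lfun1r.
by apply/lfunP => u; rewrite comp_lfunE (weight_wproj k_infinite (vin_in u)).
Qed.

Lemma act_win V g : (pmap M (gl1_act V g) \o win V = g ^+ n *: win V)%VF.
Proof.
by apply/lfunP => u; rewrite comp_lfunE scale_lfunE (weight_act k_infinite g (vin_in u)).
Qed.

Lemma win_stab V W (f : 'Hom(V, W)) : (win W \o A_map n M f = pmap M (stab f) \o win V)%VF.
Proof. by apply/lfunP => u; rewrite !comp_lfunE !vinE A_mapE. Qed.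

Lemma wpr_stab V W (f : 'Hom(V, W)) : (wpr W \o pmap M (stab f) = A_map n M f \o wpr V)%VF.
Proof.
apply: win_cancel; rewrite !comp_lfunA win_wpr win_stab -comp_lfunA win_wpr.
by apply/lfunP => x; rewrite !comp_lfunE wproj_stab.
Qed.

End WeightInclusion.

Lemma win_nt M N (t : nattrans M N) n V :
  (win N n V \o A_nt n t V = t (V * k^o)%type \o win M n V)%VF.
Proof. by apply/lfunP => u; rewrite !comp_lfunE !vinE A_ntE. Qed.

Lemma wpr_nt M N (t : nattrans M N) n V :
  (wpr N n V \o t (V * k^o)%type = A_nt n t V \o wpr M n V)%VF.
Proof.
apply: win_cancel; rewrite !comp_lfunA win_wpr win_nt -comp_lfunA win_wpr.
by apply/lfunP => x; rewrite !comp_lfunE wproj_nt.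
Qed.

(** * The composite of A_n and B_m *)

Section AB.
Variables (n m : nat) (M : polyfunctor k).

Section Components.
Variable V : vectType k.

(** Index 1 belongs to the summand where the exterior factor lies in Λ^m V and has weight 0. Index 2
    belongs to the summand [vone] ∧ Λ^m V, where [vone] adds 1 to the weight and to the exterior
    degree. J and P live on the whole tensor product, i and p on its weight space. *)
Definition AB_J1 : 'Hom(tens (A_ob n M V) (ext m V),
    tens (M (V * k^o)%type) (ext m (V * k^o)%type)) :=
  tens_map (win M n V) (ext_map m (inV V)).

Definition AB_J2 : 'Hom(tens (A_ob n M V) (ext m V),
    tens (M (V * k^o)%type) (ext m.+1 (V * k^o)%type)) :=
  tens_map (win M n V) (wedge V m).

Definition AB_P1 : 'Hom(tens (M (V * k^o)%type) (ext m (V * k^o)%type),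
    tens (A_ob n M V) (ext m V)) :=
  tens_map (wpr M n V) (ext_map m (prV V)).

Definition AB_P2 : 'Hom(tens (M (V * k^o)%type) (ext m.+1 (V * k^o)%type),
    tens (A_ob n M V) (ext m V)) :=
  tens_map (wpr M n V) (contr V m).

Lemma AB_J1_weight t : AB_J1 t \in weight (B_polyfunctor m M) n V.
Proof.
apply/weightP => g _; rewrite -comp_lfunE -tens_map_comp act_win act_ext_inV.
by rewrite tens_mapZl scale_lfunE.
Qed.

Lemma AB_J2_weight t : AB_J2 t \in weight (B_polyfunctor m.+1 M) n.+1 V.
Proof.
apply/weightP => g _; rewrite -comp_lfunE -tens_map_comp act_win act_wedge.
by rewrite tens_mapZl tens_mapZr !scale_lfunE scalerA exprSr.
Qed.

Definition AB_i1 : 'Hom(tens (A_ob n M V) (ext m V), A_ob n (B_polyfunctor m M) V) :=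
  linfun (fun t => vsproj (weight (B_polyfunctor m M) n V) (AB_J1 t)).
Definition AB_i2 : 'Hom(tens (A_ob n M V) (ext m V), A_ob n.+1 (B_polyfunctor m.+1 M) V) :=
  linfun (fun t => vsproj (weight (B_polyfunctor m.+1 M) n.+1 V) (AB_J2 t)).
Definition AB_p1 := (AB_P1 \o win (B_polyfunctor m M) n V)%VF.
Definition AB_p2 := (AB_P2 \o win (B_polyfunctor m.+1 M) n.+1 V)%VF.

Lemma win_i1 : (win (B_polyfunctor m M) n V \o AB_i1 = AB_J1)%VF.
Proof. exact: vin_lift AB_J1_weight. Qed.

Lemma win_i2 : (win (B_polyfunctor m.+1 M) n.+1 V \o AB_i2 = AB_J2)%VF.
Proof. exact: vin_lift AB_J2_weight. Qed.

Lemma AB_P1J1 : (AB_P1 \o AB_J1 = \1)%VF.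
Proof. by rewrite -tens_map_comp wpr_win prV_ext_inV tens_map_id. Qed.

Lemma AB_P2J2 : (AB_P2 \o AB_J2 = \1)%VF.
Proof. by rewrite -tens_map_comp wpr_win contr_wedge tens_map_id. Qed.

End Components.

Lemma AB_i1P V W (f : 'Hom(V, W)) :
  (AB_i1 W \o pmap (B_polyfunctor m (A_polyfunctor n M)) f =
   pmap (A_polyfunctor n (B_polyfunctor m M)) f \o AB_i1 V)%VF.
Proof.
apply: win_cancel; rewrite !comp_lfunA.
transitivity (pmap (B_polyfunctor m M) (stab f) \o AB_J1 V)%VF.
  rewrite win_i1 -!tens_map_comp win_stab -!ext_map_comp; congr (tens_map _ (ext_map m _)).
  by rewrite stab_inV.
by rewrite [in RHS](win_stab (B_polyfunctor m M) n f) -comp_lfunA win_i1.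
Qed.

Lemma AB_i2P V W (f : 'Hom(V, W)) :
  (AB_i2 W \o pmap (B_polyfunctor m (A_polyfunctor n M)) f =
   pmap (A_polyfunctor n.+1 (B_polyfunctor m.+1 M)) f \o AB_i2 V)%VF.
Proof.
apply: win_cancel; rewrite !comp_lfunA.
transitivity (pmap (B_polyfunctor m.+1 M) (stab f) \o AB_J2 V)%VF.
  by rewrite win_i2 -!tens_map_comp win_stab stab_wedge.
by rewrite [in RHS](win_stab (B_polyfunctor m.+1 M) n.+1 f) -comp_lfunA win_i2.
Qed.

Lemma AB_p1P V W (f : 'Hom(V, W)) :
  (AB_p1 W \o pmap (A_polyfunctor n (B_polyfunctor m M)) f =
   pmap (B_polyfunctor m (A_polyfunctor n M)) f \o AB_p1 V)%VF.
Proof.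
rewrite -[LHS]comp_lfunA (win_stab (B_polyfunctor m M) n f) !comp_lfunA.
congr (_ \o _)%VF; rewrite -!tens_map_comp wpr_stab -!ext_map_comp.
by rewrite stab_prV.
Qed.

Lemma AB_p2P V W (f : 'Hom(V, W)) :
  (AB_p2 W \o pmap (A_polyfunctor n.+1 (B_polyfunctor m.+1 M)) f =
   pmap (B_polyfunctor m (A_polyfunctor n M)) f \o AB_p2 V)%VF.
Proof.
rewrite -[LHS]comp_lfunA (win_stab (B_polyfunctor m.+1 M) n.+1 f) !comp_lfunA.
by congr (_ \o _)%VF; rewrite -!tens_map_comp wpr_stab stab_contr.
Qed.

Definition AB_i1_nt : nattrans (B_polyfunctor m (A_polyfunctor n M))
    (A_polyfunctor n (B_polyfunctor m M)) :=
  @NatTrans k (B_polyfunctor m (A_polyfunctor n M))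
    (A_polyfunctor n (B_polyfunctor m M)) AB_i1 AB_i1P.
Definition AB_i2_nt : nattrans (B_polyfunctor m (A_polyfunctor n M))
    (A_polyfunctor n.+1 (B_polyfunctor m.+1 M)) :=
  @NatTrans k (B_polyfunctor m (A_polyfunctor n M))
    (A_polyfunctor n.+1 (B_polyfunctor m.+1 M)) AB_i2 AB_i2P.
Definition AB_p1_nt : nattrans (A_polyfunctor n (B_polyfunctor m M))
    (B_polyfunctor m (A_polyfunctor n M)) :=
  @NatTrans k (A_polyfunctor n (B_polyfunctor m M))
    (B_polyfunctor m (A_polyfunctor n M)) AB_p1 AB_p1P.
Definition AB_p2_nt : nattrans (A_polyfunctor n.+1 (B_polyfunctor m.+1 M))
    (B_polyfunctor m (A_polyfunctor n M)) :=
  @NatTrans k (A_polyfunctor n.+1 (B_polyfunctor m.+1 M))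
    (B_polyfunctor m (A_polyfunctor n M)) AB_p2 AB_p2P.

Lemma AB_p1i1 : nt_comp AB_p1_nt AB_i1_nt = nt_id _.
Proof.
apply: nattransP => V /=; rewrite -[LHS]comp_lfunA win_i1; exact: AB_P1J1.
Qed.

Lemma AB_p2i2 : nt_comp AB_p2_nt AB_i2_nt = nt_id _.
Proof.
apply: nattransP => V /=; rewrite -[LHS]comp_lfunA win_i2; exact: AB_P2J2.
Qed.

End AB.

Lemma AB_p1i2 n m M : nt_comp (AB_p1_nt n.+1 m.+1 M) (AB_i2_nt n m M) = nt_zero _ _.
Proof.
apply: nattransP => V /=; rewrite -[LHS]comp_lfunA win_i2 -[LHS]tens_map_comp.
by rewrite prV_wedge tens_map0r.
Qed.

Lemma AB_p2i1 n m M : nt_comp (AB_p2_nt n m M) (AB_i1_nt n.+1 m.+1 M) = nt_zero _ _.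
Proof.
apply: nattransP => V /=; rewrite -[LHS]comp_lfunA win_i1 -[LHS]tens_map_comp.
by rewrite contr_inV tens_map0r.
Qed.

Lemma AB_J1P1 n m M V :
  (AB_J1 n m M V \o AB_P1 n m M V =
   tens_map (wproj M V n) (ext_map m (inV V) \o ext_map m (prV V)))%VF.
Proof. by rewrite -tens_map_comp win_wpr. Qed.

Lemma AB_J2P2 n m M V :
  (AB_J2 n m M V \o AB_P2 n m M V = tens_map (wproj M V n) (wedge V m \o contr V m))%VF.
Proof. by rewrite -tens_map_comp win_wpr. Qed.

Lemma tens_map_coefs m M V (E : 'End(ext m (V * k^o)%type)) t :
  coefs (fun g => tens_map (pmap M (gl1_act V g)) E t)
        (fun i => tens_map (wproj M V i) E t).
Proof.
have lin : linear (fun f : 'End(M (V * k^o)%type) => tens_map f E t).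
  by move=> a f g; rewrite tens_mapPl homE.
pose l := linfun (fun f : 'End(M (V * k^o)%type) => tens_map f E t).
apply: coefs_ext (coefs_lin l (wproj_coefs M V)) => [g|i]; exact: linfunE lin _.
Qed.

(** By [ext_split], g acts as M(1 ⊕ g) tensored with the projection to Λ^(m+1) V, plus g M(1 ⊕ g)
    tensored with the projection to the terms that contain [vone]. In the coefficient of g^r the
    second part contributes weight r - 1 of M, and nothing if r = 0. *)
Lemma B_weight_split m M V r t : t \in weight (B_polyfunctor m.+1 M) r V ->
  t = tens_map (wproj M V r) (ext_map m.+1 (inV V) \o ext_map m.+1 (prV V))%VF t +
      (if r is r'.+1 then tens_map (wproj M V r') (wedge V m \o contr V m)%VF t else 0).
Proof.
move=> /weightP ht.
have h := coefs_add (@tens_map_coefs _ M V (ext_map m.+1 (inV V) \o ext_map m.+1 (prV V))%VF t)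
  (coefs_shift 1 (@tens_map_coefs _ M V (wedge V m \o contr V m)%VF t)).
have := coefs_uniq k_infinite h (coefs_monomial t r) _ r; rewrite eqxx => e.
rewrite -[LHS]e; first by congr (_ + _); case: r {ht e} => [|r] //=; rewrite subn1.
move=> g g0; rewrite -ht // expr1 -scale_lfunE -tens_mapZr -add_lfunE -tens_mapDr.
congr (fun_of_lfun (tens_map _ _) t).
rewrite -[RHS]comp_lfun1r -ext_split comp_lfunDr.
rewrite (comp_lfunA (ext_map _ (gl1_act V g)) (ext_map _ (inV V))) act_ext_inV.
by rewrite (comp_lfunA (ext_map _ (gl1_act V g)) (wedge V m)) act_wedge comp_lfunZl.
Qed.

Lemma ext_map0 V (f : 'Hom(V, V)) : ext_map 0 f = \1%VF.
Proof. by apply: ext_lfunP => t; rewrite ext_map_pi !id_lfunE. Qed.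

Lemma AB_sum n m M :
  nt_add (nt_comp (AB_i1_nt n.+1 m.+1 M) (AB_p1_nt n.+1 m.+1 M))
         (nt_comp (AB_i2_nt n m M) (AB_p2_nt n m M)) = nt_id _.
Proof.
apply: nattransP => V /=; apply: win_cancel.
rewrite comp_lfun1r comp_lfunDr !comp_lfunA win_i1 win_i2 AB_J1P1 AB_J2P2.
apply/lfunP => t; rewrite add_lfunE !(comp_lfunE (tens_map _ _)).
by rewrite [RHS](@B_weight_split _ _ _ n.+1) ?vin_in.
Qed.

(** For m = 0 the factor Λ^0 carries no weight; for n = 0 the second summand of [B_weight_split] is
    absent. *)
Lemma AB_i1p1 n m M : (n == 0)%N || (m == 0)%N ->
  nt_comp (AB_i1_nt n m M) (AB_p1_nt n m M) = nt_id _.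
Proof.
move=> nm; apply: nattransP => V /=; apply: win_cancel.
rewrite comp_lfun1r !comp_lfunA win_i1 AB_J1P1.
apply/lfunP => t; rewrite (comp_lfunE (tens_map _ _)).
have tw := vin_in t; case: m nm t tw => [|m] nm t tw.
  rewrite -ext_map_comp ext_map0 //; set u := win _ _ _ _.
  move/weightP: tw => tw.
  have := coefs_uniq k_infinite (@tens_map_coefs _ M V \1%VF u) (coefs_monomial u n) _ n.
  rewrite eqxx => -> // g g0; rewrite -tw //=; congr (tens_map _ _ _).
  by rewrite ext_map0.
move: nm t tw; rewrite orbF => /eqP -> t tw.
by have := B_weight_split tw; rewrite addr0 => <-.
Qed.

Lemma relation_AB n m :
  nat_iso_sum (fcomp (functorA k n.+1) (functorB k m.+1))
    (fcomp (functorB k m.+1) (functorA k n.+1)) (fcomp (functorB k m) (functorA k n)).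
Proof.
exists (AB_i1_nt n.+1 m.+1), (AB_i2_nt n m), (AB_p1_nt n.+1 m.+1), (AB_p2_nt n m).
split.
- move=> M N t; apply: nattransP => V /=; apply: win_cancel; rewrite !comp_lfunA win_i1.
  rewrite [in RHS](win_nt (B_nattrans m.+1 t) n.+1 V) -[RHS]comp_lfunA win_i1.
  rewrite -[LHS]tens_map_comp -[RHS]tens_map_comp win_nt.
  by rewrite comp_lfun1l comp_lfun1r.
- move=> M N t; apply: nattransP => V /=; apply: win_cancel; rewrite !comp_lfunA win_i2.
  rewrite [in RHS](win_nt (B_nattrans m.+1 t) n.+1 V) -[RHS]comp_lfunA win_i2.
  rewrite -[LHS]tens_map_comp -[RHS]tens_map_comp win_nt.
  by rewrite comp_lfun1l comp_lfun1r.
- move=> M N t; apply: nattransP => V /=.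
  rewrite -[LHS]comp_lfunA (win_nt (B_nattrans m.+1 t) n.+1 V) !comp_lfunA.
  congr (_ \o _)%VF; rewrite -[LHS]tens_map_comp -[RHS]tens_map_comp wpr_nt.
  by rewrite comp_lfun1l comp_lfun1r.
- move=> M N t; apply: nattransP => V /=.
  rewrite -[LHS]comp_lfunA (win_nt (B_nattrans m.+1 t) n.+1 V) !comp_lfunA.
  congr (_ \o _)%VF; rewrite -[LHS]tens_map_comp -[RHS]tens_map_comp wpr_nt.
  by rewrite comp_lfun1l comp_lfun1r.
move=> M; split.
- exact: AB_p1i1.
- exact: AB_p2i2.
- exact: AB_p1i2.
- exact: AB_p2i1.
exact: AB_sum.
Qed.

Lemma relation_AB0 n m : (n == 0)%N || (m == 0)%N ->
  nat_iso (fcomp (functorA k n) (functorB k m)) (fcomp (functorB k m) (functorA k n)).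
Proof.
move=> nm; exists (AB_p1_nt n m), (AB_i1_nt n m); split.
  move=> M N t; apply: nattransP => V /=.
  rewrite -[LHS]comp_lfunA (win_nt (B_nattrans m t) n V) !comp_lfunA.
  congr (_ \o _)%VF; rewrite -[LHS]tens_map_comp -[RHS]tens_map_comp wpr_nt.
  by rewrite comp_lfun1l comp_lfun1r.
by move=> M; split; [apply: AB_i1p1|apply: AB_p1i1].
Qed.

(** * The functors B commute *)

Section BB.
Variables (n m : nat).

Lemma BB_P M V W (f : 'Hom(V, W)) :
  (tens_swap (M W) (ext m W) (ext n W) \o pmap (B_polyfunctor n (B_polyfunctor m M)) f =
   pmap (B_polyfunctor m (B_polyfunctor n M)) f \o tens_swap (M V) (ext m V) (ext n V))%VF.
Proof. exact: tens_swap_nat. Qed.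

Definition BB_nt M : nattrans (B_polyfunctor n (B_polyfunctor m M))
    (B_polyfunctor m (B_polyfunctor n M)) :=
  @NatTrans k (B_polyfunctor n (B_polyfunctor m M))
    (B_polyfunctor m (B_polyfunctor n M))
    (fun V => tens_swap (M V) (ext m V) (ext n V)) (@BB_P M).

End BB.

Lemma relation_BB n m :
  nat_iso (fcomp (functorB k n) (functorB k m)) (fcomp (functorB k m) (functorB k n)).
Proof.
exists (BB_nt n m), (BB_nt m n); split.
  by move=> M N t; apply: nattransP => V; apply: tens_swap_nat.
by move=> M; split; apply: nattransP => V; apply: tens_swapK.
Qed.

(** * The functors A commute *)

Section AA.
Variables (n m : nat).

Definition flip V : 'End(((V * k^o) * k^o)%type) :=
  linfun (fun z : ((V * k^o) * k^o)%type => ((z.1.1, z.2), z.1.2)).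

Lemma flipE V z : flip V z = ((z.1.1, z.2), z.1.2).
Proof. by rewrite linfunE. Qed.

Lemma flipK V : (flip V \o flip V = \1)%VF.
Proof. by apply/lfunP => -[[v a] b]; rewrite comp_lfunE !flipE id_lfunE. Qed.

Lemma flip_stab2 V W (f : 'Hom(V, W)) :
  (flip W \o stab (stab f) = stab (stab f) \o flip V)%VF.
Proof.
by apply/lfunP => -[[v a] b]; rewrite !comp_lfunE !flipE !dsum_mapE /= ?dsum_mapE.
Qed.

Lemma flip_act V g : (gl1_act (V * k^o)%type g \o flip V = flip V \o stab (gl1_act V g))%VF.
Proof.
apply/lfunP => -[[v a] b].
by rewrite !comp_lfunE !flipE gl1_actE dsum_mapE /= gl1_actE /= id_lfunE.
Qed.

Lemma flip_stab_act V g :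
  (stab (gl1_act V g) \o flip V = flip V \o gl1_act (V * k^o)%type g)%VF.
Proof.
by rewrite -[LHS]comp_lfun1l -(flipK V) -comp_lfunA (comp_lfunA _ (stab _)) -flip_act
  -!comp_lfunA flipK comp_lfun1r.
Qed.

Variable M : polyfunctor k.

Definition win2 i j V : 'Hom(A_ob i (A_polyfunctor j M) V, M ((V * k^o) * k^o)%type) :=
  (win M j (V * k^o)%type \o win (A_polyfunctor j M) i V)%VF.

Lemma win2_inj i j V : injective (win2 i j V).
Proof. by move=> x y; rewrite !comp_lfunE => /vin_inj /vin_inj. Qed.

(** A_n A_m M at V consists of the vectors of M((V ⊕ k) ⊕ k) on which the inner copy of k has weight
    n ([h1]) and the outer copy has weight m ([h2]). The flip exchanges the two copies. *)
Lemma win2_flip V u : exists u', win2 m n V u' = pmap M (flip V) (win2 n m V u).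
Proof.
have h1 g : g != 0 -> pmap M (stab (gl1_act V g)) (win2 n m V u) = g ^+ n *: win2 n m V u.
  move=> g0; rewrite comp_lfunE -(comp_lfunE (pmap _ _)) -win_stab comp_lfunE.
  rewrite -linearZ; congr (win _ _ _ _).
  by have /weightP -> := vin_in (u : subvs_of (weight (A_polyfunctor m M) n V)).
have h2 g : g != 0 -> pmap M (gl1_act (V * k^o)%type g) (win2 n m V u) = g ^+ m *: win2 n m V u.
  by move=> g0; rewrite comp_lfunE -(comp_lfunE (pmap _ _)) act_win scale_lfunE.
set x := win2 n m V u in h1 h2 *.
have w1 : pmap M (flip V) x \in weight M n (V * k^o)%type.
  apply/weightP => g g0; rewrite -comp_lfunE -pmapM flip_act pmapM comp_lfunE h1 //.
  by rewrite linearZ.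
pose y : A_polyfunctor n M (V * k^o)%type := vpr (weight M n (V * k^o)%type) (pmap M (flip V) x).
have ey : win M n (V * k^o)%type y = pmap M (flip V) x by apply: vin_vpr.
have w2 : y \in weight (A_polyfunctor n M) m V.
  apply/weightP => g g0; apply: (@vin_inj _ (weight M n (V * k^o)%type)).
  transitivity (g ^+ m *: win M n (V * k^o)%type y); last by symmetry; apply: linearZ.
  transitivity ((win M n (V * k^o)%type \o A_map n M (gl1_act V g))%VF y).
    by symmetry; apply: comp_lfunE.
  rewrite win_stab comp_lfunE ey.
  by rewrite -comp_lfunE -pmapM flip_stab_act pmapM comp_lfunE h2 // linearZ.
exists (vpr (weight (A_polyfunctor n M) m V) y).
by rewrite comp_lfunE [X in win M n _ X]vin_vpr.
Qed.

Definition AA_map V : 'Hom(A_ob n (A_polyfunctor m M) V, A_ob m (A_polyfunctor n M) V) :=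
  ((win2 m n V)^-1 \o (pmap M (flip V) \o win2 n m V))%VF.

Lemma AA_mapE V : (win2 m n V \o AA_map V = pmap M (flip V) \o win2 n m V)%VF.
Proof.
apply/lfunP => u; rewrite comp_lfunE (comp_lfunE (_^-1)%VF) limg_lfunVK // comp_lfunE.
by have [u' <-] := win2_flip u; apply: memv_img; rewrite memvf.
Qed.

Lemma win2_map i j V W (f : 'Hom(V, W)) :
  (win2 i j W \o pmap (A_polyfunctor i (A_polyfunctor j M)) f =
   pmap M (stab (stab f)) \o win2 i j V)%VF.
Proof.
rewrite -[LHS]comp_lfunA (win_stab (A_polyfunctor j M) i f) !comp_lfunA.
by rewrite (win_stab M j (stab f)).
Qed.

Lemma AA_P V W (f : 'Hom(V, W)) :
  (AA_map W \o pmap (A_polyfunctor n (A_polyfunctor m M)) f =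
   pmap (A_polyfunctor m (A_polyfunctor n M)) f \o AA_map V)%VF.
Proof.
apply: (lfun_inj_compl (@win2_inj m n W)).
rewrite [LHS]comp_lfunA AA_mapE -[LHS]comp_lfunA win2_map [LHS]comp_lfunA -pmapM flip_stab2.
by rewrite [RHS]comp_lfunA win2_map -[RHS]comp_lfunA AA_mapE [RHS]comp_lfunA -pmapM.
Qed.

Definition AA_nt : nattrans (A_polyfunctor n (A_polyfunctor m M))
    (A_polyfunctor m (A_polyfunctor n M)) :=
  @NatTrans k (A_polyfunctor n (A_polyfunctor m M))
    (A_polyfunctor m (A_polyfunctor n M)) AA_map AA_P.

End AA.

Lemma AA_mapK n m M V : (AA_map m n M V \o AA_map n m M V = \1)%VF.
Proof.
apply: (lfun_inj_compl (@win2_inj M n m V)).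
rewrite [LHS]comp_lfunA AA_mapE -[LHS]comp_lfunA AA_mapE [LHS]comp_lfunA -pmapM flipK pmap1.
by rewrite comp_lfun1l comp_lfun1r.
Qed.

Lemma win2_nt M N (t : nattrans M N) i j V :
  (win2 N i j V \o A_nt i (A_nattrans j t) V = t ((V * k^o) * k^o)%type \o win2 M i j V)%VF.
Proof.
rewrite -[LHS]comp_lfunA (win_nt (A_nattrans j t) i V) !comp_lfunA.
by rewrite (win_nt t j).
Qed.

Lemma relation_AA n m :
  nat_iso (fcomp (functorA k n) (functorA k m)) (fcomp (functorA k m) (functorA k n)).
Proof.
exists (AA_nt n m), (AA_nt m n); split; last first.
  by move=> M; split; apply: nattransP => V; apply: AA_mapK.
move=> M N t; apply: nattransP => V; apply: (lfun_inj_compl (@win2_inj N m n V)).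
rewrite [LHS]comp_lfunA AA_mapE -[LHS]comp_lfunA win2_nt [LHS]comp_lfunA -ncompP.
by rewrite [RHS]comp_lfunA win2_nt -[RHS]comp_lfunA AA_mapE [RHS]comp_lfunA.
Qed.

End Relations.

(** * Symmetric functions *)

Section SymmetricFunctions.
Implicit Types (f g : BZ) (a b : seq nat) (r s n : nat).

Definition ev n f : {mpoly int[n]} := (f : symfun) n.

Lemma ev_is_additive n : additive (ev n). Proof. by []. Qed.
HB.instance Definition _ n :=
  GRing.isAdditive.Build BZ {mpoly int[n]} (ev n) (ev_is_additive n).
Lemma ev_is_multiplicative n : multiplicative (ev n).
Proof. by split=> //=; rewrite mpolyC1. Qed.
HB.instance Definition _ n :=
  GRing.isMultiplicative.Build BZ {mpoly int[n]} (ev n) (ev_is_multiplicative n).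

Lemma evM n f g : ev n (f * g) = ev n f * ev n g. Proof. by []. Qed.

Lemma ev1 n : ev n 1 = 1. Proof. exact: mpolyC1. Qed.
Lemma ev0 n : ev n 0 = 0. Proof. exact: mpolyC0. Qed.

(* The coefficient of x_0^(a_0) ... x_(l-1)^(a_(l-1)) in f, l = size a. *)
Definition cf f a : int := (ev (size a) f)@_(Multinom (in_tuple a)).

Lemma cf_tuple f n (t : n.-tuple nat) : cf f t = (ev n f)@_(Multinom t).
Proof.
case: t => a ea; have e := eqP ea; rewrite /cf /=.
by case: n / e ea => ea; congr (_@_(Multinom _)); apply: val_inj.
Qed.

Lemma mdeg_tuple n (t : n.-tuple nat) : mdeg (Multinom t) = sumn t.
Proof. by rewrite mdegE sumnE [RHS]big_tuple. Qed.

Lemma cf_ext f g : cf f =1 cf g -> f = g.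
Proof.
move=> e; apply: symfunP => n; apply/mpolyP => -[t].
by have := e t; rewrite !cf_tuple.
Qed.

Lemma cf_perm f a b : perm_eq a b -> cf f a = cf f b.
Proof.
move=> ab; have sb : size b == size a by rewrite (perm_size ab).
pose t := Tuple sb; have /tuple_permP[p ea] : perm_eq a t by [].
rewrite [in LHS]ea -[b]/(tval t) !cf_tuple.
have [/(_ (size a))/issymP/(_ p) fs _ _] := sfunP f.
rewrite [in RHS]/ev -fs mcoeff_sym; congr (_@_ _).
Qed.

Lemma cf_rcons0 f a : cf f (rcons a 0%N) = cf f a.
Proof.
have -> : rcons a 0%N = rcons_tuple (in_tuple a) 0%N by [].
rewrite cf_tuple /cf; have [_ fr _] := sfunP f.
rewrite [in RHS]/ev -fr mcoeff_restr; congr (_@_ _); apply/mnmP => i.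
rewrite multinomE (tnth_nth 0%N) nth_rcons.
case: (unliftP ord_max i) => [j|] ->; last by rewrite mext_max /= ltnn eqxx.
by rewrite mext_lift multinomE (tnth_nth 0%N) lift_max ltn_ord.
Qed.

Lemma cf_cons0 f a : cf f (0%N :: a) = cf f a.
Proof. by rewrite -[RHS]cf_rcons0; apply: cf_perm; rewrite perm_sym perm_rcons. Qed.

Lemma cf_bounded f : exists d, forall a, (d <= sumn a)%N -> cf f a = 0.
Proof.
have [_ _ [d hd]] := sfunP f; exists d => a da; rewrite /cf.
apply/memN_msupp_eq0/msize_mdeg_ge; rewrite mdeg_tuple.
exact: leq_trans (hd _) da.
Qed.

Section OfCoefficients.
Variable c : seq nat -> int.
Hypothesis c_perm : forall a b, perm_eq a b -> c a = c b.
Hypothesis c_cons0 : forall a, c (0%N :: a) = c a.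
Hypothesis c_bounded : exists d, forall a, (d <= sumn a)%N -> c a = 0.

(** Both [hskew] and the character are built in this way, from coefficients alone. Invariance under
    permutations gives symmetry, invariance under inserting 0 gives compatibility with restriction,
    and the bound makes each polynomial a finite sum. *)
Lemma symfun_of_coefs : exists f : BZ, cf f =1 c.
Proof.
have [d cd] := c_bounded.
pose F n : {mpoly int[n]} := \sum_(m : 'X_{1..n < d}) (c (multinom_val m) *: 'X_[m]).
have FE n m : (F n)@_m = c (multinom_val m).
  have [md|md] := ltnP (mdeg m) d.
    by rewrite (mcoeff_mpoly (fun m : 'X_{1..n} => c (multinom_val m))).
  case: m md => t; rewrite mdeg_tuple => md; rewrite cd // raddf_sum big1 // => -[m' hm'] _ /=.
  rewrite mcoeffZ mcoeffX; case: eqP => [em|_]; last by rewrite mulr0.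
  by move: hm'; rewrite em mdeg_tuple ltnNge md.
have FP : is_symfun F.
  split=> [n|n|].
  - apply/issymP => s; apply/mpolyP => m; rewrite mcoeff_sym !FE; apply: c_perm.
    by apply/tuple_permP; exists s; congr tval.
  - apply/mpolyP => m; rewrite mcoeff_restr !FE.
    rewrite -[RHS]c_cons0; apply: c_perm.
    have -> : multinom_val (mext m) = rcons_tuple (multinom_val m) 0%N.
      apply: eq_from_tnth => i; rewrite -[LHS]/(mext m i) (tnth_nth 0%N) nth_rcons size_tuple.
      case: (unliftP ord_max i) => [j|] ->; last by rewrite mext_max /= ltnn eqxx.
      by rewrite mext_lift lift_max ltn_ord -tnth_nth.
    by rewrite perm_rcons.
  exists d => n; rewrite msizeE; apply/bigmax_leqP_seq => m + _.
  rewrite mcoeff_msupp FE; case: m => t; rewrite mdeg_tuple; apply: contraNT.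
  by rewrite -ltnNge ltnS => /cd ->.
exists (SymFun FP) => a; rewrite /cf /ev /=.
by rewrite FE.
Qed.

End OfCoefficients.

Lemma skew_subproof s f : exists g : BZ, forall a, cf g a = cf f (s :: a).
Proof.
apply: symfun_of_coefs.
- by move=> a b ab; apply: cf_perm; rewrite perm_cons.
- move=> a; rewrite -[RHS]cf_cons0; apply: cf_perm.
  by rewrite -[X in perm_eq X]/([:: s] ++ [:: 0%N] ++ a) perm_catCA.
have [d hd] := cf_bounded f; exists d => a da; apply: hd.
exact: leq_trans da (leq_addl _ _).
Qed.

(* The adjoint of multiplication by h_s: the coefficient of t^s in
   f(t, x_0, x_1, ...). *)
Definition hskew s f : BZ := projT1 (cid (skew_subproof s f)).

Lemma cf_skew s f a : cf (hskew s f) a = cf f (s :: a).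
Proof. by rewrite /hskew; case: cid => g /= ->. Qed.

Lemma cfD a f g : cf (f + g) a = cf f a + cf g a.
Proof. exact: mcoeffD. Qed.
Lemma cfN a f : cf (- f) a = - cf f a.
Proof. exact: mcoeffN. Qed.
Lemma cf0 a : cf 0 a = 0.
Proof. by rewrite /cf /ev /= mpolyC0 mcoeff0. Qed.

Lemma skewC r s f : hskew r (hskew s f) = hskew s (hskew r f).
Proof.
apply: cf_ext => a; rewrite !cf_skew; apply: cf_perm.
by rewrite -[X in perm_eq X]/([:: s] ++ [:: r] ++ a) perm_catCA.
Qed.

Lemma skew0 f : hskew 0 f = f.
Proof. by apply: cf_ext => a; rewrite cf_skew cf_cons0. Qed.

Lemma skewD s : {morph hskew s : f g / f + g}.
Proof. by move=> f g; apply: cf_ext => a; rewrite !(cf_skew, cfD). Qed.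

Lemma skew_is_additive s : additive (hskew s).
Proof. by move=> f g; apply: cf_ext => a; rewrite !(cf_skew, cfD, cfN). Qed.
HB.instance Definition _ s :=
  GRing.isAdditive.Build BZ BZ (hskew s) (skew_is_additive s).

Lemma muni_coef n (p : {mpoly int[n.+1]}) s (t : n.-tuple nat) :
  ((muni p)`_s)@_(Multinom t) = p@_(Multinom (rcons_tuple t s)).
Proof.
rewrite muniE coef_sum [in RHS](mpolyE p) !raddf_sum /=; apply: eq_bigr => m _.
rewrite coefZ coefXn mulr_natr mcoeffMn !mcoeffZ !mcoeffX -mulrnAr -mulrnA mulnb.
congr (_ * (nat_of_bool _)%:R); apply/andP/eqP => [[/eqP em /eqP es]|->].
  apply/mnmP => i; rewrite multinomE (tnth_nth 0%N) nth_rcons size_tuple.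
  case: (unliftP ord_max i) => [j|] ->; last by rewrite /= ltnn eqxx es.
  rewrite lift_max ltn_ord -tnth_nth -(multinomE t) -em mnmE.
  by congr (m _); apply: ord_inj; rewrite lift_max.
split; apply/eqP.
  apply/mnmP => i; rewrite mnmE !multinomE !(tnth_nth 0%N) nth_rcons size_tuple /=.
  by rewrite ltn_ord.
by rewrite multinomE (tnth_nth 0%N) nth_rcons size_tuple /= ltnn eqxx.
Qed.

(** By symmetry the skewed exponent may be that of the last variable. Skewing is then extraction of
    a coefficient of a univariate polynomial, and [skewM] is the formula for the coefficients of a
    product. *)
Lemma ev_skew n s f : ev n (hskew s f) = (muni (ev n.+1 f))`_s.
Proof.
apply/mpolyP => -[t]; rewrite muni_coef -!cf_tuple cf_skew.
by apply: cf_perm; rewrite perm_sym perm_rcons.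
Qed.

Lemma skewM s f g : hskew s (f * g) = \sum_(i < s.+1) hskew i f * hskew (s - i) g.
Proof.
apply: symfunP => n; rewrite -/(ev n _) -/(ev n (\sum_(i < s.+1) _)) ev_skew.
rewrite [ev _ (f * g)](rmorphM (ev n.+1)) muniM coefM rmorph_sum; apply: eq_bigr => i _.
transitivity (ev n (hskew i f) * ev n (hskew (s - i) g)); first by rewrite !ev_skew.
exact: esym (rmorphM (ev n) _ _).
Qed.

Lemma cf_e r a : cf (e_ r) a = ((sumn a == r) && all (fun x => x <= 1)%N a)%:R.
Proof.
rewrite /cf /ev /= mcoeff_mesym /mechar mdeg_tuple; congr ((nat_of_bool (_ && _))%:R).
apply/forallP/allP => [h x /(nthP 0%N)[i ia <-]|h i]; last first.
  by rewrite multinomE (tnth_nth 0%N) h // mem_nth.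
by have := h (Ordinal ia); rewrite multinomE (tnth_nth 0%N).
Qed.

Lemma cf_h r a : cf (h_ r) a = (sumn a == r)%:R.
Proof. by rewrite /cf /ev /= mcoeff_complete mdeg_tuple. Qed.

Lemma cf1 a : cf 1 a = (sumn a == 0%N)%:R.
Proof. by rewrite /cf rmorph1 mcoeff1 -mdeg_eq0 mdeg_tuple. Qed.

Lemma e0 : e_ 0 = 1.
Proof.
apply: cf_ext => a; rewrite cf_e cf1; case: eqP => //= a0.
by elim: a a0 => //= -[|x] a IH //=; rewrite add0n.
Qed.

Lemma h0 : h_ 0 = 1.
Proof. by apply: cf_ext => a; rewrite cf_h cf1. Qed.

Lemma skew1 s : hskew s 1 = (s == 0%N)%:R.
Proof.
apply: cf_ext => a; rewrite cf_skew cf1 /= addn_eq0.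
by case: eqP => _; rewrite ?cf1 ?cf0.
Qed.

Lemma skew_e0 r : hskew 0 (e_ r) = e_ r. Proof. exact: skew0. Qed.

Lemma skew_e1 r : hskew 1 (e_ r.+1) = e_ r.
Proof. by apply: cf_ext => a; rewrite cf_skew !cf_e. Qed.

Lemma skew_eS s r : hskew s.+2 (e_ r) = 0.
Proof. by apply: cf_ext => a; rewrite cf_skew cf_e cf0 /= andbF. Qed.

Lemma skew_h s r : (s <= r)%N -> hskew s (h_ r) = h_ (r - s).
Proof.
move=> sr; apply: cf_ext => a; rewrite cf_skew !cf_h /=.
by rewrite -{1}(subnKC sr) eqn_add2l.
Qed.

Lemma skew_h0 s r : (r < s)%N -> hskew s (h_ r) = 0.
Proof.
move=> rs; apply: cf_ext => a; rewrite cf_skew cf_h cf0 /=.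
by case: eqP => // e; move: rs; rewrite -e ltnNge leq_addr.
Qed.

(** Only i = 0 and i = 1 survive in [skewM], as monomials of e have exponents at most 1. The result
    is the third defining relation of H_Z. *)
Lemma skew_mul_e r s f :
  hskew r.+1 (e_ s.+1 * f) = e_ s.+1 * hskew r.+1 f + e_ s * hskew r f.
Proof.
rewrite skewM !big_ord_recl /= big1 => [|i _]; last by rewrite /bump /= !add1n skew_eS mul0r.
by rewrite addr0 skew_e0 skew_e1 /bump /= subSS !subn0.
Qed.

Lemma cf_nilM f g : cf (f * g) [::] = cf f [::] * cf g [::].
Proof.
have e (h : BZ) : cf h [::] = mcoeff 0%MM (ev 0 h).
  by rewrite /cf; congr (_@_ _); apply/mnmP => -[].
by rewrite !e !rmorphM.
Qed.

Lemma skew_eq f g : cf f [::] = cf g [::] ->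
  (forall s, hskew s.+1 f = hskew s.+1 g) -> f = g.
Proof.
move=> e0 es; apply: cf_ext; elim=> // -[|s] a IH; first by rewrite !cf_cons0.
by rewrite -!cf_skew es.
Qed.

Lemma skew_hS s r : hskew s.+1 (h_ r.+1) = hskew s (h_ r).
Proof. by apply: cf_ext => a; rewrite !cf_skew !cf_h. Qed.

Lemma skew_e s r f : hskew s.+1 (e_ r * f) =
  e_ r * hskew s.+1 f + (if r is r'.+1 then e_ r' * hskew s f else 0).
Proof.
case: r => [|r]; last exact: skew_mul_e.
by rewrite e0 !mul1r addr0.
Qed.

(** After skewing by s + 1, the product of e_i with [hskew s] of a complete function occurs twice
    with opposite signs: from the h of the term i and from the e of the term i + 1. *)
Lemma eh_relation r : (0 < r)%N -> \sum_(i < r.+1) (-1) ^+ i * (e_ i * h_ (r - i)) = 0.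
Proof.
move=> r0; apply: skew_eq.
  rewrite cf0; have cfn := big_morph (fun f => cf f [::]) (cfD [::]) (cf0 [::]).
  rewrite cfn big1 // => i _; rewrite !cf_nilM cf_e cf_h /=.
  case: (posnP i) => [i0|ip]; last by rewrite eq_sym (gtn_eqF ip) mul0r mulr0.
  by rewrite i0 subn0 (ltn_eqF r0) !mulr0.
case: r r0 => // r _ s; rewrite raddf_sum raddf0.
under eq_bigr => i _ do rewrite raddfMsign /= skew_e mulrDr.
rewrite big_split /= big_ord_recr /= subnn skew_h0 // !mulr0 addr0.
rewrite [X in _ + X]big_ord_recl /= mulr0 add0r -big_split big1 //= => i _.
rewrite /bump /= add1n subSS exprS mulN1r mulNr subSn ?skew_hS ?subrr //.
by rewrite -ltnS.
Qed.

Lemma cf_filter f a : cf f [seq x <- a | x != 0%N] = cf f a.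
Proof.
suff h b : cf f (b ++ [seq x <- a | x != 0%N]) = cf f (b ++ a) by apply: (h [::]).
elim: a b => //= x a IH b; case: eqP => [->|_] /=; last by rewrite -!cat_rcons IH.
have -> : cf f (b ++ 0%N :: a) = cf f (0%N :: (b ++ a)).
  by apply: cf_perm; rewrite -cat1s perm_catCA.
by rewrite cf_cons0 IH.
Qed.

(** An exponent sequence with sum at most n has at most n nonzero entries, so its coefficient is
    visible in n variables. *)
Lemma low_degree_eq0 n f : ev n f = 0 -> (forall a, cf f a != 0 -> (sumn a <= n)%N) -> f = 0.
Proof.
move=> f0 df; apply: cf_ext => a; rewrite cf0; apply/eqP/negPn/negP => fa.
have an := df _ fa; move: fa; rewrite -cf_filter; set b := filter _ a.
have bn : (size b <= n)%N.
  apply: leq_trans an; rewrite /b; elim: (a) => //= -[|x] a' IH //=.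
  by rewrite addSn ltnS (leq_trans IH) // leq_addl.
have -> : cf f b = cf f (b ++ nseq (n - size b) 0%N).
  by rewrite -cf_filter -[RHS]cf_filter filter_cat filter_nseq eqxx cats0.
have st : size (b ++ nseq (n - size b) 0%N) == n.
  by rewrite size_cat size_nseq subnKC.
by rewrite -[b ++ _]/(tval (Tuple st)) cf_tuple f0 mcoeff0 eqxx.
Qed.

Definition degree_le d f := forall n, (msize (ev n f) <= d.+1)%N.

Lemma degree_leM d d' f g : degree_le d f -> degree_le d' g -> degree_le (d + d') (f * g).
Proof.
move=> hf hg n; rewrite evM.
have [->|p0] := eqVneq (ev n f) 0; first by rewrite mul0r msize0.
have [->|q0] := eqVneq (ev n g) 0; first by rewrite mulr0 msize0.
rewrite msizeM // -ltnS prednK; last by rewrite addn_gt0 !lt0n !msize_poly_eq0 p0.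
by rewrite -addSn -addnS leq_add.
Qed.

Lemma degree_le1 : degree_le 0 1.
Proof. by move=> n; rewrite rmorph1 msize1. Qed.

Lemma degree_le_e r : degree_le r (e_ r).
Proof.
move=> n; rewrite msizeE; apply/bigmax_leqP_seq => m + _; rewrite mem_msupp_mesym.
by case/andP => /eqP ->.
Qed.

Lemma degree_le_prod_e n (m : 'X_{1..n}) :
  degree_le (mnmwgt m) (\prod_(i < n) e_ i.+1 ^+ m i).
Proof.
rewrite /mnmwgt; elim/big_ind2: _ => [|d f d' g|i _]; first exact: degree_le1.
  exact: degree_leM.
elim: (m i) => [|j IH]; first by rewrite mul0n; apply: degree_le1.
by rewrite mulSn exprS; apply: degree_leM => //; apply: degree_le_e.
Qed.

Lemma degree_le_cf d f a : degree_le d f -> cf f a != 0 -> (sumn a <= d)%N.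
Proof.
move=> hf; rewrite -ltnS -(mdeg_tuple (in_tuple a)) /cf -mcoeff_msupp.
by move=> /msize_mdeg_lt h; apply: leq_trans h (hf _).
Qed.

(** * Generators of the ring of symmetric functions *)

Section Generation.
Variable P : BZ -> Prop.
Hypotheses (P1 : P 1) (PB : forall f g, P f -> P g -> P (f - g)).

Lemma gen0 : P 0. Proof. by rewrite -(subrr 1); apply: PB. Qed.
Lemma genN f : P f -> P (- f).
Proof. by move=> Pf; rewrite -sub0r; apply: PB => //; apply: gen0. Qed.
Lemma genD f g : P f -> P g -> P (f + g).
Proof. by move=> Pf Pg; rewrite -[g]opprK; apply: PB => //; apply: genN. Qed.
Lemma genMn f n : P f -> P (f *+ n).
Proof. by move=> Pf; elim: n => [|n IH]; [apply: gen0|rewrite mulrS; apply: genD]. Qed.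
Lemma genMz f (c : int) : P f -> P (f *~ c).
Proof. by move=> Pf; case: c => n; [|apply: genN]; apply: genMn. Qed.
Lemma gen_sum I (r : seq I) (Q : pred I) F :
  (forall i, Q i -> P (F i)) -> P (\sum_(i <- r | Q i) F i).
Proof. by move=> h; elim/big_ind: _ => //; [apply: gen0|apply: genD]. Qed.

Hypotheses (PM : forall f g, P f -> P g -> P (f * g)).

(** Apply the fundamental theorem in d variables, where d bounds the size of all f n. The resulting
    polynomial g in the e_r agrees with f in d variables; the weight bound of that theorem keeps the
    degree of g below d as well, so [low_degree_eq0] gives equality in all variables. *)
Lemma e_generate : (forall r, P (e_ r)) -> forall f, P f.
Proof.
move=> Pe f; have [fs _ [d hd]] := sfunP f.
have [t [et wt]] := sym_fundamental (fs d).
pose g : BZ := \sum_(m <- msupp t) (\prod_(i < d) e_ i.+1 ^+ m i) *~ t@_m.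
have eg : ev d g = ev d f.
  rewrite [RHS]/ev -et comp_mpolyEX [LHS](raddf_sum (ev d)); apply: eq_bigr => m _.
  rewrite [LHS](raddfMz (ev d)) -scaler_int intz; congr (_ *: _).
  rewrite [LHS](rmorph_prod (ev d)) comp_mpolyX; apply: eq_bigr => i _.
  by rewrite [LHS](rmorphXn (ev d)) tnth_mktuple.
suff <- : g = f.
  apply: gen_sum => m _; apply: genMz; elim/big_ind: _ => // i _.
  by elim: (m i) => // j IH; rewrite exprS; apply: PM.
apply/eqP; rewrite -subr_eq0; apply/eqP; apply: (low_degree_eq0 (n := d)).
  by rewrite raddfB /= eg subrr.
move=> a; rewrite cfD cfN => h; apply: contraT; rewrite -ltnNge => ad.
case/eqP: h; have -> : cf f a = 0.
  apply/memN_msupp_eq0/msize_mdeg_ge; rewrite mdeg_tuple.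
  exact: leq_trans (hd _) (ltnW ad).
rewrite subr0 /g (big_morph _ (cfD a) (cf0 a)) big_seq big1 // => m mt.
have cfMz x (c : int) : cf x a = 0 -> cf (x *~ c) a = 0.
  by move=> x0; rewrite /cf raddfMz /= raddfMz /= -/(cf _ _) x0 mul0rz.
apply: cfMz; apply/eqP/negPn/negP => /(degree_le_cf (degree_le_prod_e m)) am.
have : (mnmwgt m < d)%N.
  apply: leq_trans (leq_trans wt (hd d)); exact: mmeasure_mnm_lt.
by rewrite ltnNge (leq_trans (ltnW ad) am).
Qed.

Lemma h_generate : (forall r, P (h_ r)) -> forall f, P f.
Proof.
move=> Ph; apply: e_generate => r.
elim/ltn_ind: r => -[|r] IH; first by rewrite e0.
have := eh_relation (ltn0Sn r); rewrite big_ord_recr /= subnn h0 mulr1 => /eqP.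
rewrite addr_eq0 => /eqP e.
have Psign x n : P x -> P ((-1) ^+ n * x).
  move=> Px; rewrite -signr_odd; case: odd; rewrite ?expr1 ?mulN1r ?expr0 ?mul1r //.
  exact: genN.
rewrite -(signrMK r.+1 (e_ r.+1)); apply/(Psign _ r.+1).
have -> : (-1) ^+ r.+1 * e_ r.+1 =
    - \sum_(i < r.+1) (-1) ^+ i * (e_ i * h_ (r.+1 - i)) by rewrite e opprK.
by apply/genN/gen_sum => i _; apply: Psign; apply: PM => //; apply: IH.
Qed.

End Generation.

(** * The form on B_Z *)

Definition hprod a : BZ := \prod_(r <- a) h_ r.
Definition hcomb (l : seq (int * seq nat)) : BZ := \sum_(p <- l) hprod p.2 *~ p.1.

Lemma hcomb_ex f : exists l, f = hcomb l.
Proof.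
move: f; apply: h_generate => [|f g [l ->] [m ->]|f g [l ->] [m ->]|r].
- by exists [:: (1, [::])]; rewrite /hcomb big_seq1 /hprod big_nil.
- exists (l ++ [seq (- p.1, p.2) | p <- m]).
  rewrite /hcomb big_cat big_map -sumrN /=; congr (_ + _).
  by apply: eq_bigr => p _; rewrite mulrNz.
- exists [seq (p.1 * q.1, p.2 ++ q.2) | p <- l, q <- m].
  rewrite /hcomb big_allpairs_dep /= mulr_suml; apply: eq_bigr => p _.
  rewrite mulr_sumr; apply: eq_bigr => q _.
  by rewrite /hprod big_cat /= mulrzAr mulrzAl -mulrzA.
by exists [:: (1, [:: r])]; rewrite /hcomb big_seq1 /hprod /= big_seq1.
Qed.

(** Cutting the sum at the minimum makes its range symmetric in r and s, which lets [skew_hprod] use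
    one list of indices for two different expansions. *)
Lemma skew_mul_hE r s f :
  hskew r (h_ s * f) = \sum_(i <- iota 0 (minn r s).+1) h_ (s - i) * hskew (r - i) f.
Proof.
rewrite skewM -(big_mkord xpredT (fun i => hskew i (h_ s) * hskew (r - i) f)).
have mr : ((minn r s).+1 <= r.+1)%N by rewrite ltnS geq_minl.
rewrite (big_cat_nat (leq0n _) mr) /= [X in _ + X]big_nat_cond [X in _ + X]big1 ?addr0.
  rewrite /index_iota subn0; apply: eq_big_seq => i; rewrite mem_iota add0n ltnS leq_min.
  by case/and3P => _ _ /skew_h ->.
move=> i /andP[/andP[mi ir] _]; rewrite skew_h0 ?mul0r //.
by move: mi ir; rewrite gtn_min ltnS [(r < i)%N]ltnNge => /orP[/negP|].
Qed.

(** The list contains the results of subtracting from the entries of a amounts with total j. The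
    same sequences occur when h_j is skewed out of h_a and when a coefficient of h_j g is expanded;
    this is the source of the symmetry [cf_hprod_sym]. *)
Lemma skew_hprod j a : exists l : seq (seq nat),
  hskew j (hprod a) = \sum_(b <- l) hprod b /\
  forall g, cf (h_ j * g) a = \sum_(b <- l) cf g b.
Proof.
elim: a j => [|x a IH] j.
  case: j => [|j]; [exists [:: [::]]|exists [::]].
    by split=> [|g]; rewrite ?skew0 big_seq1 // h0 mul1r.
  split=> [|g]; rewrite big_nil; first by rewrite /hprod big_nil skew1.
  by rewrite cf_nilM cf_h mul0r.
have [l hl] := all_sig (fun j => cid (IH j)).
exists (flatten [seq [seq (x - i)%N :: b | b <- l (j - i)%N] | i <- iota 0 (minn j x).+1]).
split=> [|g]; rewrite big_flatten big_map /=.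
  rewrite /hprod big_cons -/(hprod a) skew_mul_hE; apply: eq_bigr => i _.
  have [-> _] := hl (j - i)%N; rewrite big_map mulr_sumr; apply: eq_bigr => b _.
  by rewrite /hprod big_cons.
rewrite -cf_skew skew_mul_hE minnC (big_morph _ (cfD a) (cf0 a)); apply: eq_bigr => i _.
have [_ ->] := hl (j - i)%N; rewrite big_map; apply: eq_bigr => b _.
by rewrite cf_skew.
Qed.

Lemma cf_hprod_sym a b : cf (hprod a) b = cf (hprod b) a.
Proof.
elim: b a => [|r b IH] a.
  rewrite {2}/hprod big_nil cf1; elim: a => [|x a IH]; first by rewrite /hprod big_nil cf1.
  rewrite /hprod big_cons -/(hprod a) cf_nilM IH cf_h /= eq_sym addn_eq0.
  by case: (x == 0%N); rewrite ?mul1r ?mul0r.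
have [l [hl hl']] := skew_hprod r a.
rewrite -cf_skew hl (big_morph _ (cfD b) (cf0 b)).
rewrite {2}/hprod big_cons -/(hprod b) hl'; apply: eq_bigr => c _.
exact: IH.
Qed.

Lemma cf_hcomb l a : cf (hcomb l) a = \sum_(p <- l) cf (hprod p.2) a * p.1.
Proof.
rewrite /hcomb (big_morph _ (cfD a) (cf0 a)); apply: eq_bigr => p _.
by rewrite /cf raddfMz /= raddfMz /= mulrzz.
Qed.

(* The form with <h_a, g> = coefficient of x^a in g. *)
Definition hform f g : int :=
  \sum_(p <- projT1 (cid (hcomb_ex f))) cf g p.2 * p.1.

(** Exchanging the sums by [cf_hprod_sym] eliminates the chosen expansion of f; a second exchange in
    [hform_hcombl] shows that any expansion gives the same value. *)
Lemma hform_hcombr f m : hform f (hcomb m) = \sum_(q <- m) cf f q.2 * q.1.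
Proof.
rewrite /hform; case: cid => l /= ->.
under eq_bigr => p _ do rewrite cf_hcomb mulr_suml.
rewrite exchange_big; apply: eq_bigr => q _ /=.
rewrite cf_hcomb mulr_suml; apply: eq_bigr => p _.
by rewrite cf_hprod_sym mulrAC.
Qed.

Lemma hform_hcombl l g : hform (hcomb l) g = \sum_(p <- l) cf g p.2 * p.1.
Proof.
have [m ->] := hcomb_ex g; rewrite hform_hcombr.
under eq_bigr => p _ do rewrite cf_hcomb mulr_suml.
rewrite exchange_big; apply: eq_bigr => q _ /=.
rewrite cf_hcomb mulr_suml; apply: eq_bigr => p _.
by rewrite cf_hprod_sym mulrAC.
Qed.

Lemma hformDl f f' g : hform (f + f') g = hform f g + hform f' g.
Proof.
have [m ->] := hcomb_ex g; rewrite !hform_hcombr -big_split; apply: eq_bigr => q _.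
by rewrite cfD mulrDl.
Qed.

Lemma hformDr f g g' : hform f (g + g') = hform f g + hform f g'.
Proof.
have [l ->] := hcomb_ex f; rewrite !hform_hcombl -big_split; apply: eq_bigr => q _.
by rewrite cfD mulrDl.
Qed.

Lemma hform_hprod a g : hform (hprod a) g = cf g a.
Proof.
have -> : hprod a = hcomb [:: (1, a)] by rewrite /hcomb big_seq1.
by rewrite hform_hcombl big_seq1 mulr1.
Qed.

Lemma hform_adjoint r f g : hform (h_ r * f) g = hform f (hskew r g).
Proof.
have [l ->] := hcomb_ex f.
have -> : h_ r * hcomb l = hcomb [seq (p.1, r :: p.2) | p <- l].
  rewrite /hcomb big_map mulr_sumr; apply: eq_bigr => p _.
  by rewrite mulrzAr /hprod /= big_cons.
rewrite !hform_hcombl big_map; apply: eq_bigr => p _.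
by rewrite cf_skew.
Qed.

Lemma hform0l g : hform 0 g = 0.
Proof. by apply: (addrI (hform 0 g)); rewrite -hformDl !addr0. Qed.

Lemma hformNl f g : hform (- f) g = - hform f g.
Proof. by apply: (addrI (hform f g)); rewrite -hformDl !subrr hform0l. Qed.

Lemma hform_sign n f g : hform ((-1) ^+ n * f) g = (-1) ^+ n * hform f g.
Proof.
by rewrite -[in LHS]signr_odd -[in RHS]signr_odd; case: odd;
  rewrite ?expr1 ?mulN1r ?expr0 ?mul1r ?hformNl.
Qed.

(** * The Fock space representation *)

Fixpoint act_term (t : hterm) (f : BZ) : BZ :=
  match t with
  | HE r => e_ r.+1 * f
  | HH r => hskew r.+1 f
  | HZero => 0
  | HOne => f
  | HOpp t => - act_term t f
  | HAdd t u => act_term t f + act_term u f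
  | HMul t u => act_term t (act_term u f)
  end.

Lemma act_termD t f g : act_term t (f + g) = act_term t f + act_term t g.
Proof.
elim: t f g => /= [r|r||//|t IH|t IHt u IHu|t IHt u IHu] f g.
- by rewrite mulrDr.
- by rewrite skewD.
- by rewrite addr0.
- by rewrite IH opprD.
- by rewrite IHt IHu addrACA.
by rewrite IHu IHt.
Qed.

Lemma act_he r f : act_term (he r) f = e_ r * f.
Proof. by case: r => //=; rewrite e0 mul1r. Qed.

Lemma act_hh r f : act_term (hh r) f = hskew r f.
Proof. by case: r => //=; rewrite skew0. Qed.

Lemma act_term_rel t u : hrel t u -> act_term t =1 act_term u.
Proof.
elim=> {t u}.
- by [].
- by move=> s t _ e f; rewrite e.
- by move=> s t u _ e _ e' f; rewrite e e'.
- by move=> s s' _ e f /=; rewrite e.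
- by move=> s s' t t' _ e _ e' f /=; rewrite e e'.
- by move=> s s' t t' _ e _ e' f /=; rewrite e e'.
- by move=> s t u f /=; rewrite addrA.
- by move=> s t f /=; rewrite addrC.
- by move=> s f /=; rewrite add0r.
- by move=> s f /=; rewrite addNr.
- by [].
- by [].
- by [].
- by [].
- by move=> s t u f /=; rewrite act_termD.
- by move=> r s f /=; rewrite mulrCA.
- by move=> r s f /=; rewrite skewC.
move=> r s f; rewrite -[LHS]/(act_term (hh r.+1) (act_term (he s.+1) f)).
rewrite -[RHS]/(act_term (he s.+1) (act_term (hh r.+1) f) +
                act_term (he s) (act_term (hh r) f)).
by rewrite !act_he !act_hh; apply: skew_mul_e.
Qed.

Definition fock_act (x : HZ) (f : zmod_abgroup BZ) : zmod_abgroup BZ :=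
  act_term (repr x) f.

Lemma fock_act_cl t f : fock_act (hcl t) f = act_term t f.
Proof. exact: act_term_rel (hrepr t) f. Qed.

Lemma fock_actDr x (f g : zmod_abgroup BZ) :
  fock_act x (gadd f g) = gadd (fock_act x f) (fock_act x g).
Proof. exact: act_termD. Qed.

Lemma fock_actDl x y (f : zmod_abgroup BZ) :
  fock_act (x + y) f = gadd (fock_act x f) (fock_act y f).
Proof. by rewrite -[x]hclK -[y]hclK [_ + _]HZ_addE !fock_act_cl. Qed.

Lemma fock_actM x y (f : zmod_abgroup BZ) :
  fock_act (x * y) f = fock_act x (fock_act y f).
Proof. by rewrite -[x]hclK -[y]hclK [_ * _]HZ_mulE !fock_act_cl. Qed.

Lemma fock_act1 (f : zmod_abgroup BZ) : fock_act 1 f = f.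
Proof. by rewrite -[RHS]/(act_term HOne f) -fock_act_cl. Qed.

Definition fock : representation HZ (zmod_abgroup BZ) :=
  Representation fock_actDr fock_actDl fock_actM fock_act1.

Lemma fock_e r f : fock (He r) f = e_ r * f.
Proof. by rewrite [LHS]fock_act_cl act_he. Qed.

Lemma fock_h r f : fock (Hh r) f = hskew r f.
Proof. by rewrite [LHS]fock_act_cl act_hh. Qed.

End SymmetricFunctions.

(** * Schur functions *)

Section Schur.
Implicit Types (f g : BZ) (la mu : seq nat) (r s n : nat).

(** The convention h_i = 0 for i < 0; truncated subtraction alone would give h_0 = 1. *)
Definition h_diff a b : BZ := if (b <= a)%N then h_ (a - b) else 0.

Definition jacobi_trudi n la : BZ :=
  \det (\matrix_(i < n, j < n) h_diff (nth 0%N la i + j) i).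

(** Beyond the length of la the last row of the matrix is 0, ..., 0, 1. *)
Lemma jacobi_trudiS n la : (size la <= n)%N -> jacobi_trudi n.+1 la = jacobi_trudi n la.
Proof.
move=> ln; rewrite /jacobi_trudi (expand_det_row _ ord_max) (bigD1 ord_max) //= big1 => [|j jm].
  rewrite mxE /= nth_default // add0n /h_diff leqnn subnn h0 mul1r addr0.
  rewrite /cofactor addnn -signr_odd odd_double expr0 mul1r; congr (\det _).
  by apply/matrixP => i j; rewrite !mxE !lift_max.
rewrite mxE /= nth_default // add0n /h_diff leqNgt.
by rewrite ltn_neqAle -ltnS ltn_ord andbT [X in ~~ X](_ : _ = true) ?mul0r.
Qed.

Lemma jacobi_trudi_stable n la : (size la <= n)%N ->
  jacobi_trudi n la = jacobi_trudi (size la) la.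
Proof.
move=> /subnKC <-; elim: (n - _)%N => [|d IH]; first by rewrite addn0.
by rewrite addnS jacobi_trudiS ?leq_addr.
Qed.

Lemma horner_prod_XsubC0 (R : comNzRingType) n (x : 'I_n -> R) k :
  (\prod_(i < n) ('X - (x i)%:P)).[x k] = 0.
Proof. by rewrite horner_prod (bigD1 k) //= hornerXsubC subrr mul0r. Qed.

(** * Jacobi-Trudi determinants and alternants *)

Section Variables.
Variable n : nat.

(* Up to sign, the elementary symmetric polynomial e_j of the variables other
   than X_k. *)
Fixpoint punctured_e (k : 'I_n) j : {mpoly int[n]} :=
  if j is j'.+1 then 'X_k * punctured_e k j' + (-1) ^+ j * mesym n int j else 1.

Lemma punctured_eE k (j : nat) :
  punctured_e k j = \sum_(i < j.+1) (-1) ^+ i * mesym n int i * 'X_k ^+ (j - i).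
Proof.
elim: j => [|j IH] /=; first by rewrite big_ord1 mesym0E !expr0 !mulr1.
rewrite big_ord_recr /= subnn expr0 mulr1 IH mulr_sumr; congr (_ + _).
apply: eq_bigr => i _; rewrite subSn; last by rewrite -ltnS.
by rewrite exprS mulrCA.
Qed.

(** For j = n this is Viete's formula for the polynomial with roots X_i, evaluated at its root X_k.
    Larger j follow from the recursion, where the elementary polynomials vanish. *)
Lemma punctured_e_ge k j : (n <= j)%N -> punctured_e k j = 0.
Proof.
move=> /subnKC <-; elim: (j - n)%N => [|d IH]; last first.
  by rewrite addnS /= IH mulr0 add0r mesym_geqnE ?mulr0 // ltnS leq_addr.
rewrite addn0 punctured_eE.
rewrite -[RHS](horner_prod_XsubC0 (fun i => 'X_i : {mpoly int[n]}) k) (Viete n) horner_sum.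
by apply: eq_bigr => i _; rewrite !hornerZ hornerXn mulrA.
Qed.

(** In generating functions: the series of the h_r times the product of the 1 - X_i t over i != k is
    1 / (1 - X_k t). The induction replaces power series by [eh_relation]. *)
Lemma power_punctured k m :
  'X_k ^+ m = \sum_(j < m.+1) ev n (h_ (m - j)) * punctured_e k j.
Proof.
elim: m => [|m IH]; first by rewrite big_ord1 subnn h0 ev1 mulr1 expr0.
rewrite exprS IH mulr_sumr [RHS]big_ord_recl subn0 mulr1.
under [X in _ = _ + X]eq_bigr => j _ do rewrite lift0 subSS /= mulrDr.
rewrite big_split /= addrCA -[LHS]addr0; congr (_ + _).
  by apply: eq_bigr => j _; rewrite mulrCA.
rewrite -[LHS](ev0 n) -[in LHS](eh_relation (ltn0Sn m)) [LHS](raddf_sum (ev n)) [LHS]big_ord_recl.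
congr (_ + _); first by rewrite expr0 mul1r e0 mul1r subn0.
apply: eq_bigr => j _; rewrite lift0 subSS.
etransitivity; first exact: evM.
rewrite evM mulrA [LHS]mulrC; congr (_ * (_ * _)).
exact: (rmorph_sign (ev n)).
Qed.

(** Cut off at n terms and read backwards, the expansion becomes an entry of a product of two n x n
    matrices. *)
Lemma power_rev k m : 'X_k ^+ m =
  \sum_(l < n) ev n (if (n.-1 - l <= m)%N then h_ (m - (n.-1 - l)) else 0) *
    punctured_e k (n.-1 - l).
Proof.
pose F j := (if (j <= m)%N then ev n (h_ (m - j)) * punctured_e k j else 0).
transitivity (\sum_(j < maxn n m.+1) F j).
  rewrite power_punctured (big_ord_widen_cond _ xpredT
    (fun j => ev n (h_ (m - j)) * punctured_e k j) (leq_maxr n m.+1)) big_mkcond.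
  by apply: eq_bigr => j _.
transitivity (\sum_(j < n) F j).
  rewrite (big_ord_widen_cond _ xpredT F (leq_maxl n m.+1)) [RHS]big_mkcond.
  apply: eq_bigr => j _ /=; case: ltnP => // nj.
  by rewrite /F punctured_e_ge // mulr0 if_same.
rewrite (reindex_inj rev_ord_inj); apply: eq_bigr => l _ /=.
have -> : (n - l.+1)%N = (n.-1 - l)%N by rewrite -subn1 -subnDA add1n.
by rewrite /F; case: leqP => _; rewrite ?ev0 ?mul0r.
Qed.

(** Every alternant is a Jacobi-Trudi determinant times the same [\det C]. The empty partition has
    Jacobi-Trudi determinant 1, which identifies [\det C] with its alternant. *)
Lemma jacobi_trudi_alternant la : (size la <= n)%N ->
  ev n (jacobi_trudi n la) * alternant n [::] = alternant n la.
Proof.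
pose C := \matrix_(l < n, k < n) punctured_e k (n.-1 - l).
have H mu : alternant n mu = ev n (jacobi_trudi n mu) * \det C.
  rewrite /jacobi_trudi -(det_map_mx (ev n)) -det_mulmx /alternant -det_tr.
  congr (\det _); apply/matrixP => k i; rewrite !mxE power_rev.
  apply: eq_bigr => l _; rewrite !mxE; congr (ev n _ * _).
  have [iN lN] : (i <= n.-1)%N /\ (l <= n.-1)%N.
    by split; rewrite -ltnS prednK // (leq_trans _ (ltn_ord i)).
  have il : (n.-1 - l <= nth 0%N mu i + (n.-1 - i))%N = (i <= nth 0%N mu i + l)%N.
    by lia.
  rewrite /h_diff il; case: ifP => // h; congr h_.
  by lia.
move=> _; rewrite (H [::]) (H la) (@jacobi_trudi_stable n [::]) //.
by rewrite {2}/jacobi_trudi det_mx00 ev1 mul1r.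
Qed.

Definition shifted_part la : 'X_{1..n} := [multinom (nth 0%N la i + (n.-1 - i))%N | i < n].

Lemma mcoeffMXE (p : {mpoly int[n]}) m u :
  (p * 'X_[m])@_u = if (m <= u)%MM then p@_(u - m)%MM else 0.
Proof.
case: ifP => [mu|mu]; first by rewrite -{1}(submK mu) addmC mcoeffMX.
apply/memN_msupp_eq0; rewrite (perm_mem (msuppMX p m)).
by apply/negP => /mapP[m' _ e]; rewrite e lem_addr in mu.
Qed.

Lemma hform_sum I (r : seq I) (P : pred I) F g :
  hform (\sum_(i <- r | P i) F i) g = \sum_(i <- r | P i) hform (F i) g.
Proof.
exact: (big_morph (fun f => hform f g) (fun f f' => hformDl f f' g) (hform0l g)).
Qed.

Lemma alternant_nil : alternant n [::] =
  \sum_(s : 'S_n) (-1) ^+ s * 'X_[[multinom (n.-1 - s i)%N | i < n]].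
Proof.
apply: eq_bigr => s _; congr (_ * _); rewrite mpolyXE_id; apply: eq_bigr => i _.
by rewrite mxE mnmE nth_nil.
Qed.

(* Expanding both determinants, the form against a Jacobi-Trudi determinant
   becomes a single coefficient. *)
Lemma hform_jacobi_trudi la g :
  hform (jacobi_trudi n la) g = (ev n g * alternant n [::])@_(shifted_part la).
Proof.
rewrite alternant_nil mulr_sumr raddf_sum hform_sum; apply: eq_bigr => s _.
have sgn (p : {mpoly int[n]}) m u :
    (p * ((-1) ^+ s * 'X_[m]))@_u = (-1) ^+ s * (p * 'X_[m])@_u.
  by case: (odd_perm s); rewrite ?expr1 ?expr0 ?mul1r // !mulN1r mulrN mcoeffN.
rewrite [RHS]sgn hform_sign; congr (_ * _); rewrite mcoeffMXE.
have ltn1 (i : 'I_n) : (i <= n.-1)%N by have := ltn_ord i; lia.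
have cond (i : 'I_n) : (n.-1 - s i <= nth 0%N la i + (n.-1 - i))%N = (i <= nth 0%N la i + s i)%N.
  by have := ltn1 i; have := ltn1 (s i); lia.
(* A permutation with la_i + s(i) < i for some i contributes 0 on both sides: the product has a zero
   entry, and the monomial of the alternant does not divide the one with exponent
   [shifted_part la]. *)
case: (boolP [forall i : 'I_n, i <= nth 0%N la i + s i]%N) => [/forallP ok|nok].
  rewrite ifT; last by apply/mnm_lepP => i; rewrite !mnmE cond.
  pose t := [tuple (nth 0%N la i + s i - i)%N | i < n].
  transitivity (cf g t); last first.
    rewrite cf_tuple; congr (_@_ _); apply/mnmP => i.
    rewrite multinomE tnth_mktuple mnmBE !mnmE.
    by have := ok i; have := ltn1 i; have := ltn1 (s i); lia.
  rewrite -hform_hprod; congr (hform _ g).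
  rewrite /hprod big_tuple; apply: eq_bigr => i _.
  by rewrite tnth_mktuple mxE /h_diff ok.
rewrite ifF; last first.
  apply/negbTE; apply: contra nok => /mnm_lepP h; apply/forallP => i.
  by have := h i; rewrite !mnmE cond.
move: nok; rewrite negb_forall => /existsP[i]; rewrite -ltnNge => hi.
by rewrite (bigD1 i) //= mxE /h_diff leqNgt hi mul0r hform0l.
Qed.

Lemma sorted_geq_nth la i j : sorted geq la -> (i <= j)%N -> (nth 0 la j <= nth 0 la i)%N.
Proof.
move=> sla ij; have [jl|lj] := ltnP j (size la); last by rewrite nth_default.
have tr : transitive geq by move=> x y z /= yx zy; apply: leq_trans zy yx.
by apply: (sorted_leq_nth tr leqnn 0%N sla) => //; rewrite inE ?(leq_ltn_trans ij).
Qed.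

Lemma shifted_part_lt la (i j : 'I_n) : sorted geq la -> (i < j)%N ->
  (shifted_part la j < shifted_part la i)%N.
Proof.
move=> sla ij; rewrite !mnmE.
by have := sorted_geq_nth sla (ltnW ij); have := ltn_ord j; lia.
Qed.

(** Increasing maps satisfy i <= s(i), and the inverse of s is increasing too. *)
Lemma increasing_perm (s : 'S_n) : (forall i j : 'I_n, (i < j)%N -> (s i < s j)%N) -> s = 1%g.
Proof.
have ge (t : 'S_n) : (forall i j : 'I_n, (i < j)%N -> (t i < t j)%N) ->
    forall i : 'I_n, (i <= t i)%N.
  move=> ht i; have [m] := ubnP (i : nat); elim: m i => // m IH i.
  case: i => -[|i] //= ltin; rewrite ltnS => im.
  have ltin' : (i < n)%N by apply: ltnW.
  have := ht (Ordinal ltin') (Ordinal ltin) (ltnSn i).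
  by apply: leq_ltn_trans; apply: IH.
move=> hs; apply/permP => i; rewrite perm1; apply/val_inj/eqP; rewrite eqn_leq ge // andbT.
have := ge (s^-1)%g _ (s i); rewrite permK; apply=> a b ab.
rewrite ltnNge leq_eqVlt; apply/negP => /orP[/eqP e|/hs].
  have /perm_inj e' : (s^-1)%g b = (s^-1)%g a by apply: val_inj.
  by rewrite e' ltnn in ab.
by rewrite !permKV ltnNge (ltnW ab).
Qed.

(** Both shifted partitions are strictly decreasing, so a permutation that carries one exponent to
    the other preserves the order. *)
Lemma alternant_coef la mu : sorted geq la -> sorted geq mu ->
  (alternant n mu)@_(shifted_part la) = (shifted_part la == shifted_part mu)%:R.
Proof.
move=> sla smu; rewrite /alternant -det_tr raddf_sum.
have term (s : 'S_n) : ((-1) ^+ s * \prod_i (\matrix_(i < n, j < n)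
    ('X_i ^+ (nth 0%N mu j + (n.-1 - j))%N : {mpoly int[n]}))^T i (s i))@_(shifted_part la) =
    (-1) ^+ s * (shifted_part la == [multinom shifted_part mu ((s^-1)%g i) | i < n])%:R.
  have -> : \prod_i (\matrix_(i < n, j < n)
      ('X_i ^+ (nth 0%N mu j + (n.-1 - j))%N : {mpoly int[n]}))^T i (s i) =
      'X_[[multinom shifted_part mu ((s^-1)%g i) | i < n]].
    rewrite mpolyXE_id (reindex_inj (@perm_inj _ (s^-1)%g)) /=; apply: eq_bigr => i _.
    by rewrite !mxE permKV !mnmE.
  case: (odd_perm s); rewrite ?expr1 ?expr0 ?mul1r ?mulN1r ?mcoeffN mcoeffX eq_sym //.
rewrite (eq_bigr _ (fun (s : 'S_n) _ => term s)).
rewrite (bigD1 (1%g : 'S_n)) //= big1 ?addr0 => [|s s1].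
  rewrite odd_perm1 expr0 mul1r; congr ((nat_of_bool (_ == _))%:R).
  by apply/mnmP => i; rewrite !mnmE invg1 perm1.
case: eqP => [e|]; last by rewrite mulr0.
case/eqP: s1; apply: (can_inj (@invgK _)); rewrite invg1; apply: increasing_perm => i j ij.
have := shifted_part_lt sla ij; rewrite e ![[multinom _ | _ < _] _]mnmE => h.
rewrite ltnNge leq_eqVlt; apply/negP => /orP[/eqP/val_inj e'|/(shifted_part_lt smu)].
  by rewrite e' ltnn in h.
by rewrite !mnmE ltnNge (ltnW h).
Qed.

End Variables.

Lemma shifted_part_inj n la mu : (size la <= n)%N -> (size mu <= n)%N ->
  is_part la -> is_part mu -> shifted_part n la = shifted_part n mu -> la = mu.
Proof.
move=> ln mn /andP[_ la0] /andP[_ mu0] e.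
have en i : nth 0%N la i = nth 0%N mu i.
  have [lin|ni] := ltnP i n; last by rewrite !nth_default // (leq_trans _ ni).
  have /mnmP/(_ (Ordinal lin)) := e; rewrite !mnmE /=; lia.
have half x y : (0%N \notin x) -> (forall i, nth 0%N y i = nth 0%N x i) ->
    (size x <= size y)%N.
  move=> x0 exy; rewrite leqNgt; apply: contra x0 => lt.
  by rewrite -(nth_default 0%N (leqnn (size y))) exy mem_nth.
apply: (@eq_from_nth _ 0%N) => [|i _]; last exact: en.
by apply/eqP; rewrite eqn_leq !half.
Qed.

Lemma alternant_nil_neq0 n : alternant n [::] != 0.
Proof.
apply/negP => /eqP /(congr1 (mcoeff (shifted_part n [::]))).
by rewrite alternant_coef // eqxx mcoeff0 => /eqP; rewrite oner_eq0.
Qed.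

Lemma is_schur_jacobi_trudi la : is_schur la (jacobi_trudi (size la) la).
Proof.
move=> n ln; rewrite -(jacobi_trudi_stable ln).
exact: jacobi_trudi_alternant.
Qed.

(** In at least [size la] variables the alternant of the empty partition can be cancelled; fewer
    variables are reached by restriction. *)
Lemma is_schur_uniq la f g : is_schur la f -> is_schur la g -> f = g.
Proof.
move=> hf hg; apply: symfunP => n.
have large m : (size la <= m)%N -> (f : symfun) m = (g : symfun) m.
  by move=> lm; apply: (mulIf (alternant_nil_neq0 m)); rewrite hf ?hg.
have [_ fr _] := sfunP f; have [_ gr _] := sfunP g.
have [d dE] : exists d, (size la <= n + d)%N by exists (size la); rewrite leq_addl.
elim: d n dE => [|d IH] n; first by rewrite addn0; apply: large.
by rewrite addnS -addSn => /IH e; rewrite -fr e gr.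
Qed.

Lemma schurE la : schur la = jacobi_trudi (size la) la.
Proof.
apply: (@is_schur_uniq la); last exact: is_schur_jacobi_trudi.
apply: (@xgetPex _ 0 [set f | is_schur la f]%classic).
by exists (jacobi_trudi (size la) la); apply: is_schur_jacobi_trudi.
Qed.

Lemma hform_schur : is_schur_form hform.
Proof.
split; [by move=> *; apply: hformDl|by move=> *; apply: hformDr|move=> la mu pla pmu].
pose n := maxn (size la) (size mu).
have ln : (size la <= n)%N by apply: leq_maxl.
have mn : (size mu <= n)%N by apply: leq_maxr.
rewrite !schurE -(jacobi_trudi_stable ln) -(jacobi_trudi_stable mn).
rewrite hform_jacobi_trudi jacobi_trudi_alternant //.
have [[sla _] [smu _]] := (andP pla, andP pmu).
rewrite alternant_coef //; congr ((nat_of_bool _)%:R).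
by apply/eqP/eqP => [/shifted_part_inj->|->].
Qed.

Lemma is_Fock_fock : is_Fock fock.
Proof.
exists hform; first exact: hform_schur.
by move=> r; split=> [f|f g]; rewrite ?fock_e // fock_h hform_adjoint.
Qed.

End Schur.

(** * Characters *)

Section Characters.
Variables (k : fieldType) (k_infinite : infinite_set [set: k]%classic).
Implicit Types (L M N X Y Z : polyfunctor k) (U V W : vectType k) (a b : seq nat).

(* chi [:: r_1; ...; r_l] M is the dimension of A_(r_l) ... A_(r_1) M at 0, that
   is, of the weight (r_1, ..., r_l) subspace of M(k^l). *)
Fixpoint chi a M : nat :=
  if a is r :: a' then chi a' (A_polyfunctor r M) else \dim {:M (zero_vect k)}.

Lemma chi_pexact a X Y Z (i : nattrans X Y) (p : nattrans Y Z) :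
  pexact i p -> chi a Y = (chi a X + chi a Z)%N.
Proof.
elim: a X Y Z i p => [|r a IH] X Y Z i p ex /=; first exact: pexact_dim ex.
exact: IH (A_pexact k_infinite r ex).
Qed.

Lemma chi_eq0 a M : (forall V, \dim {:M V} = 0%N) -> chi a M = 0%N.
Proof.
elim: a M => [|r a IH] M M0 /=; first exact: M0.
apply: IH => V; apply/eqP; rewrite -leqn0 -(M0 (V * k^o)%type).
by rewrite [X in (X <= _)%N](dim_subvs (weight M r V)) dimvS ?subvf.
Qed.

Lemma chi_zero a : chi a (const_pf (zero_vect k)) = 0%N.
Proof. by apply: chi_eq0 => V; apply: zero_vect_dim. Qed.

(** Seen as a short exact sequence with third term 0, an isomorphism preserves [chi] by
    additivity. *)
Lemma iso_pexact M N (t : nattrans M N) (s : nattrans N M) :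
  nt_comp s t = nt_id M -> nt_comp t s = nt_id N ->
  pexact t (nt_zero N (const_pf (zero_vect k))).
Proof.
move=> st ts.
have stE V x : s V (t V x) = x by rewrite -comp_lfunE (nt_app st) id_lfunE.
have tsE V y : t V (s V y) = y by rewrite -comp_lfunE (nt_app ts) id_lfunE.
split=> [V x y e|V|V y].
- by rewrite -(stE V x) e stE.
- by apply/vspaceP => z; rewrite memvf (dim0_eq z 0 (zero_vect_dim k)) mem0v.
by rewrite zero_lfunE; split=> // _; exists (s V y).
Qed.

Lemma chi_iso a M N (t : nattrans M N) (s : nattrans N M) :
  nt_comp s t = nt_id M -> nt_comp t s = nt_id N -> chi a M = chi a N.
Proof. by move=> st ts; rewrite (chi_pexact a (iso_pexact st ts)) chi_zero addn0. Qed.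

Lemma chi_nat_iso a (F G : functor (polyfunctor_cat k) (polyfunctor_cat k)) M :
  nat_iso F G -> chi a (F M) = chi a (G M).
Proof. by move=> [t [s [_ /(_ M)[st ts]]]]; apply: chi_iso st ts. Qed.

Lemma chi_nat_iso_sum a (F G H : functor (polyfunctor_cat k) (polyfunctor_cat k)) M :
  nat_iso_sum F G H -> chi a (F M) = (chi a (G M) + chi a (H M))%N.
Proof.
move=> [i1 [i2 [p1 [p2 [_ _ _ _ /(_ M)/biproduct_pexact ex]]]]].
exact: chi_pexact ex.
Qed.

Lemma chi_swap r s a M : chi (r :: s :: a) M = chi (s :: r :: a) M.
Proof. exact: (chi_nat_iso a M (relation_AA k_infinite s r)). Qed.

Lemma chi_move r a b M : chi (a ++ r :: b) M = chi (r :: a ++ b) M.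
Proof.
elim: a M => //= s a IH M; rewrite IH.
exact: (chi_swap s r).
Qed.

Lemma chi_perm a b M : perm_eq a b -> chi a M = chi b M.
Proof.
elim: a b M => [|r a IH] b M; first by rewrite perm_sym => /perm_nilP ->.
move=> ab; have rb : r \in b by rewrite -(perm_mem ab) mem_head.
case/splitPr: rb ab => b1 b2 ab; rewrite chi_move /=; apply: IH.
by rewrite -(perm_cons r) (perm_trans ab) // -cat1s perm_catCA.
Qed.

Lemma act0_inV_prV V : gl1_act V 0 = (inV V \o prV V)%VF.
Proof. by apply/lfunP => z; rewrite gl1_actE comp_lfunE inVE prVE mul0r. Qed.

Lemma pmap_inV_weight M V x : pmap M (inV V) x \in weight M 0 V.
Proof.
apply/weightP => g _; rewrite -comp_lfunE -pmapM expr0 scale1r; congr (pmap M _ x).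
by apply/lfunP => v; rewrite comp_lfunE inVE gl1_actE mulr0.
Qed.

Definition A0_map M V : 'Hom(M V, A_ob 0 M V) :=
  linfun (fun x => vsproj (weight M 0 V) (pmap M (inV V) x)).

Lemma win_A0_map M V : (win M 0 V \o A0_map M V = pmap M (inV V))%VF.
Proof. exact: (vin_lift (@pmap_inV_weight M V)). Qed.

Lemma A0_map_nat M V W (f : 'Hom(V, W)) :
  (A0_map M W \o pmap M f = pmap (A_polyfunctor 0 M) f \o A0_map M V)%VF.
Proof.
apply: win_cancel; rewrite [LHS]comp_lfunA win_A0_map.
by rewrite [RHS]comp_lfunA (win_stab M 0 f) -[RHS]comp_lfunA win_A0_map -!pmapM stab_inV.
Qed.

Lemma A0_inv_nat M V W (f : 'Hom(V, W)) :
  ((pmap M (prV W) \o win M 0 W) \o pmap (A_polyfunctor 0 M) f =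
   pmap M f \o (pmap M (prV V) \o win M 0 V))%VF.
Proof.
rewrite -[LHS]comp_lfunA (win_stab M 0 f) [LHS]comp_lfunA [RHS]comp_lfunA.
by rewrite -!pmapM stab_prV.
Qed.

(** A_0 M is isomorphic to M through [inV] and [prV]. On the weight 0 space the composite through V
    is the action of g = 0, which is the scalar 0^0 = 1. *)
Lemma chi_cons0 a M : chi (0%N :: a) M = chi a M.
Proof.
pose t : nattrans M (A_polyfunctor 0 M) :=
  @NatTrans k _ (A_polyfunctor 0 M) (A0_map M) (@A0_map_nat M).
pose s : nattrans (A_polyfunctor 0 M) M :=
  @NatTrans k (A_polyfunctor 0 M) _ _ (@A0_inv_nat M).
symmetry; apply: (@chi_iso a M (A_polyfunctor 0 M) t s).
  apply: nattransP => V /=; rewrite -[LHS]comp_lfunA win_A0_map -pmapM prV_inV.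
  exact: pmap1.
apply: nattransP => V /=; apply: win_cancel.
rewrite [LHS]comp_lfunA win_A0_map [LHS]comp_lfunA -pmapM -act0_inV_prV act_win //.
by rewrite expr0 scale1r comp_lfun1r.
Qed.

(* Scalars act on M through their powers of exponent less than d. *)
Definition total_degree_lt d M := forall V (x : M V), exists2 w : nat -> M V,
  (forall i, (d <= i)%N -> w i = 0) & coefs (fun g => pmap M (g *: \1%VF) x) w.

Lemma total_degree_exists M : exists d, total_degree_lt d M.
Proof.
have [d hd] := pmap_deg M; exists d.+1 => V x.
have [w w0 hw] := polymap_comp_coefs (hd V) (affine_polymap 0 (\1%VF : 'End(V))).
exists (fun i => w i x) => [i di|]; first by rewrite w0 // zero_lfunE.
by apply: coefs_ext (coefs_app x hw) => // g; rewrite add0r.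
Qed.

Lemma scalar_stab V g : (g *: \1 : 'End((V * k^o)%type))%VF = (stab (g *: \1)%VF \o gl1_act V g)%VF.
Proof.
apply/lfunP => z; rewrite comp_lfunE gl1_actE dsum_mapE !scale_lfunE !id_lfunE.
by case: z.
Qed.

(** The scalar g on V ⊕ k is g on V followed by g on k, and the latter acts on weight r as g^r;
    these r powers of g are lost in A_r M. *)
Lemma total_degree_A r d M :
  total_degree_lt d M -> total_degree_lt (d - r) (A_polyfunctor r M).
Proof.
move=> hM V x; have [w' hw'] := pmap_affine_coefs (A_polyfunctor r M) 0 (\1%VF : 'End(V)).
pose w i := w' i x.
have hw : coefs (fun g => pmap (A_polyfunctor r M) (g *: \1%VF) x) w.
  by apply: coefs_ext (coefs_app x hw') => // g; rewrite add0r.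
exists w => // i di; have [u u0 hu] := hM _ (win M r V x).
have e g : g != 0 -> g ^+ r *: win M r V (pmap (A_polyfunctor r M) (g *: \1%VF) x) =
    pmap M (g *: \1%VF) (win M r V x).
  move=> _; rewrite scalar_stab pmapM comp_lfunE -(comp_lfunE (pmap M (gl1_act V g))).
  rewrite act_win // scale_lfunE linearZ; congr (_ *: _).
  by rewrite -[RHS](comp_lfunE (pmap M _)) -win_stab comp_lfunE.
have := coefs_uniq k_infinite (coefs_shift r (coefs_lin (win M r V) hw)) hu e (i + r)%N.
rewrite ltnNge leq_addl /= addnK u0; last by lia.
by rewrite -(linear0 (win M r V)) => /vin_inj.
Qed.

Lemma chi_total_degree d a M : total_degree_lt d M -> (d <= sumn a)%N -> chi a M = 0%N.
Proof.
elim: a d M => [|r a IH] d M hM /= da; last first.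
  by apply: (IH _ _ (@total_degree_A r _ _ hM)); rewrite leq_subLR.
apply/eqP; rewrite dimv_eq0 -subv0; apply/subvP => x _.
(* The bound has dropped to 0, so all coefficients vanish, and g = 1 acts as the identity. *)
have [w w0 /coefs_at1[n e]] := hM _ x.
rewrite memv0 -[x](id_lfunE) -pmap1 -[\1%VF]scale1r e big1 // => i _.
by rewrite w0 // (leq_trans da).
Qed.

Lemma chi_bounded M : exists d, forall a, (d <= sumn a)%N -> chi a M = 0%N.
Proof. by have [d hd] := total_degree_exists M; exists d => a; apply: chi_total_degree. Qed.

Lemma ch_subproof M : exists f : BZ, cf f =1 (fun a => (chi a M)%:Z).
Proof.
apply: symfun_of_coefs => [a b /chi_perm-> //|a|]; first by rewrite chi_cons0.
by have [d hd] := chi_bounded M; exists d => a /hd ->.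
Qed.

Definition ch M : BZ := projT1 (cid (ch_subproof M)).

Lemma cf_ch M a : cf (ch M) a = (chi a M)%:Z.
Proof. by rewrite /ch; case: cid => f /= ->. Qed.

Lemma ch_pexact X Y Z (i : nattrans X Y) (p : nattrans Y Z) :
  pexact i p -> ch Y = ch X + ch Z.
Proof. by move=> ex; apply: cf_ext => a; rewrite cfD !cf_ch (chi_pexact a ex). Qed.

Lemma ch_A r M : ch (A_polyfunctor r M) = hskew r (ch M).
Proof. by apply: cf_ext => a; rewrite cf_skew !cf_ch. Qed.

Lemma dim_tens U V : \dim {:tens U V} = (\dim {:U} * \dim {:V})%N.
Proof. by rewrite !dimvf -[LHS]/((dim U * 1) * dim V)%N muln1. Qed.

Lemma dim_ext_zero r : \dim {:ext r (zero_vect k)} = (0 == r).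
Proof.
have -> : \dim {:ext r (zero_vect k)} =
    (\dim {:tpow r (zero_vect k)} - \dim (alt_rel r (zero_vect k)))%N.
  by rewrite [LHS](dim_subvs (_^C)%VS) dimv_compl.
case: r => [|r]; last first.
  by rewrite [\dim {:tpow _ _}](dim_tens (zero_vect k)) zero_vect_dim mul0n.
have -> : alt_rel 0 (zero_vect k) = 0%VS.
  apply/eqP; rewrite -subv0; apply/subvP => t; apply: alt_rel_ind => v i j //.
by rewrite dimv0 subn0; apply: (dimvf k^o).
Qed.

Lemma ch_B r M : ch (B_polyfunctor r M) = e_ r * ch M.
Proof.
apply: cf_ext => a; elim: a r M => [|[|s] a IH] r M.
- rewrite cf_nilM cf_e !cf_ch /= andbT [\dim {:B_ob _ _ _}]dim_tens dim_ext_zero.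
  by rewrite PoszM mulrC natz.
- by rewrite !cf_cons0 IH.
rewrite cf_ch; case: r => [|r].
  have := chi_nat_iso a M (@relation_AB0 k k_infinite s.+1 0%N (orbT _)).
  rewrite /= => ->; rewrite -cf_ch IH ch_A e0 !mul1r.
  by rewrite cf_skew.
have := chi_nat_iso_sum a M (relation_AB k_infinite s r).
rewrite /= => ->; rewrite PoszD -!cf_ch !IH !ch_A -cf_skew skew_mul_e.
by rewrite cfD.
Qed.

Lemma ch_const : ch (const_pf (k^o : vectType k)) = 1.
Proof.
apply: skew_eq; first by rewrite cf_ch cf1 /= dimvf.
move=> s; rewrite -ch_A skew1; apply: cf_ext => a; rewrite cf_ch cf0 chi_eq0 // => V.
apply/eqP; rewrite dimv_eq0 -subv0; apply/subvP => x _; rewrite memv0; apply/eqP.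
apply: (@vin_inj _ _ (weight (const_pf (k^o : vectType k)) s.+1 V)); rewrite linear0.
(* On a constant functor g = 0 acts as the identity, but as 0 on a vector of positive weight. *)
have := weight_act k_infinite 0 (vin_in x).
by rewrite exprS mul0r scale0r => <-; rewrite /= id_lfunE.
Qed.

Lemma dim_rV n : \dim {:('rV[k]_n : vectType k)} = n.
Proof. by rewrite dimvf dim_matrix; apply: mul1n. Qed.

(** Induction on the dimension: V is isomorphic to k^n ⊕ k, where M is the sum of its weight spaces,
    and these are the values of A_r M at k^n. *)
Lemma chi_vanish M : (forall a, chi a M = 0%N) -> forall V, \dim {:M V} = 0%N.
Proof.
move=> h V; move: {2}(\dim {:V}) (erefl (\dim {:V})) => n.
elim: n M V h => [|n IH] M V h dV.
  by rewrite (@pf_dim_eq _ M V (zero_vect k)) ?zero_vect_dim //; apply: (h [::]).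
have dW : \dim {: (('rV[k]_n : vectType k) * k^o)%type} = \dim {:V}.
  by rewrite dim_prod dim_rV dV dimvf addn1.
rewrite -(pf_dim_eq M dW); apply: (weights_dim0 k_infinite) => r.
apply: IH; last exact: dim_rV.
by move=> a; apply: (h (r :: a)).
Qed.

Lemma nonzero_dim M V (x : M V) : x != 0 -> exists a, chi a M != 0%N.
Proof.
move=> x0; apply: contrapT => /forallNP h.
case/eqP: x0; apply: dim0_eq; apply: chi_vanish => a; apply/eqP/negPn/negP; exact: h.
Qed.

End Characters.

(** * Common subquotients *)

Section HighestWeight.
Variables (k : fieldType) (k_infinite : infinite_set [set: k]%classic).
Implicit Types (L M N X Y Z : polyfunctor k) (U V W : vectType k) (a b : seq nat).

Definition top_weight r M := forall s V (x : M (V * k^o)%type), (r < s)%N -> wproj M V s x = 0.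

(** * Shears and the block factorization *)

Section Shears.
Variables (M : polyfunctor k) (V : vectType k) (r : nat).
Implicit Type x : M (V * k^o)%type.

Lemma wproj_coefs_app (u v : 'End((V * k^o)%type)) s x :
  exists w, coefs (fun g => wproj M V s (pmap M (u + g *: v) x)) w.
Proof.
have [w hw] := pmap_affine_coefs M u v.
by exists (fun i => wproj M V s (w i x)); apply: coefs_lin (coefs_app x hw).
Qed.

(** Conjugation by g turns N into g N, so the component of weight s of M(1 + N) x, times g^s, is
    divisible by g^r as a polynomial in g. This excludes s < r, the hypothesis on M excludes s > r,
    and g = 0 shows that the component of weight r is x. *)
Lemma weight_shear (N : 'End((V * k^o)%type)) x :
  top_weight r M -> x \in weight M r V ->
  (forall g, gl1_act V g \o (\1 + N) = (\1 + g *: N) \o gl1_act V g)%VF ->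
  pmap M (\1 + N)%VF x = x.
Proof.
move=> top xr comm.
have step s g : g ^+ s *: wproj M V s (pmap M (\1 + N)%VF x) =
    g ^+ r *: wproj M V s (pmap M (\1 + g *: N)%VF x).
  rewrite -wproj_act // -comp_lfunE -pmapM comm pmapM comp_lfunE.
  by rewrite (weight_act k_infinite g xr) !linearZ.
have pr : wproj M V r (pmap M (\1 + N)%VF x) = x.
  have [w hw] := wproj_coefs_app \1%VF N r x.
  have := coefs_eq0 k_infinite (coefsC (wproj M V r (pmap M (\1 + N)%VF x))) hw.
  rewrite scale0r addr0 pmap1 id_lfunE (weight_wproj k_infinite xr); apply=> g g0.
  by apply: (scalerI (expf_neq0 r g0)); rewrite step.
have [n e] := wproj_sum (pmap M (\1 + N)%VF x).
have z s : (s != r)%N -> wproj M V s (pmap M (\1 + N)%VF x) = 0.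
  case: ltngtP => // [sr|rs] _; last exact: top.
  have [w hw] := wproj_coefs_app \1%VF N s x.
  have := coefs_uniq k_infinite (coefs_monomial (wproj M V s (pmap M (\1 + N)%VF x)) s)
    (coefs_shift r hw) (fun g _ => step s g) s.
  by rewrite eqxx sr.
rewrite -[RHS]pr [LHS]e; have [rn|nr] := ltnP r n.
  rewrite (bigD1 (Ordinal rn)) //= big1 ?addr0 // => i ir; apply: z.
  by apply: contra ir => /eqP ir; apply/eqP/val_inj.
have x0 : pmap M (\1 + N)%VF x = 0.
  by rewrite e big1 // => i _; apply: z; rewrite neq_ltn (leq_trans (ltn_ord i) nr).
by rewrite -e x0 linear0.
Qed.

(** Here N is scaled in the opposite direction and M(1 + N) x may have components of other weights.
    In weight r the powers of g cancel, and g = 0 gives x. *)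
Lemma wproj_shear (N : 'End((V * k^o)%type)) x :
  x \in weight M r V ->
  (forall g, gl1_act V g \o (\1 + g *: N) = (\1 + N) \o gl1_act V g)%VF ->
  wproj M V r (pmap M (\1 + N)%VF x) = x.
Proof.
move=> xr comm; have [w hw] := wproj_coefs_app \1%VF N r x.
have := coefs_eq0 k_infinite (coefsC (wproj M V r (pmap M (\1 + N)%VF x))) hw.
rewrite scale0r addr0 pmap1 id_lfunE (weight_wproj k_infinite xr); apply=> g g0.
apply: (scalerI (expf_neq0 r g0)).
rewrite -[RHS]wproj_act // -(comp_lfunE (pmap M _)) -pmapM comm pmapM comp_lfunE.
by rewrite (weight_act k_infinite g xr) !linearZ.
Qed.

End Shears.

Section Blocks.
Variables (V W : vectType k) (f : 'Hom((V * k^o)%type, (W * k^o)%type)).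
Let d : k := (f (0, 1)).2.
Let b : W := (f (0, 1)).1.

Definition schur_complement : 'Hom(V, W) :=
  linfun (fun v => (f (v, 0)).1 - ((f (v, 0)).2 / d : k) *: b).

Lemma pair_lin (a : k) (u v : V) : (a *: u + v, 0) = a *: (u, 0) + (v, 0) :> (V * k^o)%type.
Proof. by congr pair; rewrite /= scaler0 addr0. Qed.

Lemma schur_complementE v :
  schur_complement v = (f (v, 0)).1 - ((f (v, 0)).2 / d : k) *: b.
Proof.
rewrite linfunE // => c u w; rewrite pair_lin linearP /=.
by rewrite mulrDl scalerDl scalerBr scalerA mulrA opprD addrACA.
Qed.

Definition upper_shear : 'End((W * k^o)%type) :=
  linfun (fun z : W * k^o => (((z.2 : k) / d) *: b, 0)).
Definition lower_shear : 'End((V * k^o)%type) :=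
  linfun (fun z : V * k^o => (0, (f (z.1, 0)).2 / d : k^o)).

Lemma upper_shearE z : upper_shear z = (((z.2 : k) / d) *: b, 0).
Proof.
rewrite linfunE // => c [u s] [w t] /=; congr pair; rewrite /= ?scaler0 ?addr0 //.
by rewrite mulrDl scalerDl scalerA mulrA.
Qed.

Lemma lower_shearE z : lower_shear z = (0, (f (z.1, 0)).2 / d).
Proof.
rewrite linfunE // => c [u s] [w t] /=; congr pair; rewrite /= ?scaler0 ?addr0 //.
by rewrite pair_lin linearP /= mulrDl -mulrA.
Qed.

Lemma block_factor : d != 0 ->
  f = ((\1 + upper_shear) \o ((stab schur_complement \o gl1_act V d) \o (\1 + lower_shear)))%VF.
Proof.
move=> d0; apply/lfunP => -[v t].
have lowE : (\1 + lower_shear)%VF (v, t) = (v, t + (f (v, 0)).2 / d).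
  by rewrite add_lfunE id_lfunE lower_shearE; congr pair; rewrite /= addr0.
rewrite !comp_lfunE lowE gl1_actE dsum_mapE id_lfunE /=.
rewrite add_lfunE id_lfunE upper_shearE schur_complementE /=.
have -> : (v, t) = (v, 0) + (t : k) *: (0, 1) :> (V * k^o)%type.
  by congr pair; rewrite /= ?scaler0 ?addr0 // add0r [_ *: _]mulr1.
rewrite linearD linearZ /=.
rewrite [f (v, 0)]surjective_pairing [f (0, 1)]surjective_pairing -/b -/d.
congr pair; rewrite /=.
  have -> : d * (t + (f (v, 0)).2 / d) / d = t + (f (v, 0)).2 / d.
    by rewrite mulrAC divff // mul1r.
  by rewrite scalerDl [t *: b + _]addrC addrA subrK.
by rewrite addr0 mulrDr [d * (_ / d)]mulrCA divff // mulr1 addrC [d * t]mulrC.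
Qed.

End Blocks.

(** Of the three factors of f, the lower shear fixes a vector of top weight, the diagonal one acts
    through the corner and the Schur complement, and the upper shear is invisible after projection
    to weight r. *)
Lemma wpr_block M V W r (f : 'Hom((V * k^o)%type, (W * k^o)%type)) (x : A_ob r M V) :
  top_weight r M -> (f (0, 1)).2 != 0 ->
  wpr M r W (pmap M f (win M r V x)) =
    (f (0, 1)).2 ^+ r *: pmap (A_polyfunctor r M) (schur_complement f) x.
Proof.
move=> top d0; apply: (@vin_inj _ _ (weight M r W)).
transitivity (wproj M W r (pmap M f (win M r V x))).
  by rewrite -win_wpr // comp_lfunE.
rewrite {1}(block_factor d0) pmapM comp_lfunE pmapM comp_lfunE.
rewrite (weight_shear top (vin_in x)); last first.
  move=> g; apply/lfunP => z; rewrite !comp_lfunE !gl1_actE !add_lfunE scale_lfunE !id_lfunE.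
  rewrite !lower_shearE /=; congr pair; rewrite /= ?scaler0 ?addr0 //.
  exact: mulrDr.
set y := pmap (A_polyfunctor r M) (schur_complement f) x.
have -> : pmap M (stab (schur_complement f) \o gl1_act V (f (0, 1)).2)%VF (win M r V x) =
    (f (0, 1)).2 ^+ r *: win M r W y.
  rewrite pmapM comp_lfunE (weight_act k_infinite _ (vin_in x)) linearZ; congr (_ *: _).
  by rewrite -[LHS]comp_lfunE -win_stab comp_lfunE.
rewrite !linearZ; congr (_ *: _); apply: wproj_shear; first exact: vin_in.
move=> g; apply/lfunP => z; rewrite !comp_lfunE !gl1_actE !add_lfunE scale_lfunE !id_lfunE.
rewrite !upper_shearE /=; congr pair; rewrite /= ?scaler0 ?addr0 //.
by rewrite scalerA mulrA.
Qed.

(** * Subfunctors generated in top weight *)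

Section Generated.
Variables (M N : polyfunctor k) (r : nat).
Hypotheses (topM : top_weight r M) (topN : top_weight r N).
Variable R : forall V, {vspace (A_polyfunctor r M V * A_polyfunctor r N V)%type}.
Hypothesis Rstab : forall V W (f : 'Hom(V, W)) z, z \in R V ->
  (pmap (A_polyfunctor r M) f z.1, pmap (A_polyfunctor r N) f z.2) \in R W.

Definition gen_pred W (z : (M W * N W)%type) := exists V (f : 'Hom((V * k^o)%type, W)) u,
  u \in R V /\ z = (pmap M f (win M r V u.1), pmap N f (win N r V u.2)).

Definition generated W : {vspace (M W * N W)%type} := vspan (@gen_pred W).

Lemma generated_stab V W (f : 'Hom(V, W)) z :
  z \in generated V -> (pmap M f z.1, pmap N f z.2) \in generated W.
Proof.
rewrite -[X in X \in generated W](dsum_mapE (pmap M f) (pmap N f)) memv_preim.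
move: z; apply/subvP/vspan_sub => _ [U [g [u [uR ->]]]].
rewrite -memv_preim dsum_mapE /=; apply: vspan_mem; exists U, (f \o g)%VF, u.
by split; rewrite // !pmapM !comp_lfunE.
Qed.

Lemma generated_top W z : z \in generated (W * k^o)%type ->
  (wpr M r W z.1, wpr N r W z.2) \in R W.
Proof.
rewrite -(dsum_mapE (wpr M r W) (wpr N r W)) memv_preim.
move: z; apply/subvP/vspan_sub => _ [V [f [u [uR ->]]]].
rewrite -memv_preim dsum_mapE /=.
pose E : 'Hom((V * k^o)%type, (W * k^o)%type) := dsum_map 0 (\1 : 'End(k^o))%VF.
have [d0|dn0] := eqVneq (f (0, 1)).2 0; last first.
  rewrite !wpr_block //; set h := schur_complement f.
  have -> : forall (a : k) (x : A_polyfunctor r M W) (y : A_polyfunctor r N W),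
      (a *: x, a *: y) = a *: ((x, y) : (A_polyfunctor r M W * A_polyfunctor r N W)%type) by [].
  exact/memvZ/Rstab.
(* The corner of f is 0 and f has no block factorization. The corner of f + g E is g, so the claim
   holds for g != 0 by the previous case and passes to g = 0 by [coefs_subspace]. *)
pose F g := (wpr M r W (pmap M (f + g *: E) (win M r V u.1)),
             wpr N r W (pmap N (f + g *: E) (win N r V u.2))).
suff : F 0 \in R W by rewrite /F scale0r addr0.
have [w hw] := pmap_affine_coefs M f E; have [w' hw'] := pmap_affine_coefs N f E.
have hF := coefs_add
  (coefs_lin (inl_lfun _ (A_ob r N W)) (coefs_lin (wpr M r W) (coefs_app (win M r V u.1) hw)))
  (coefs_lin (inr_lfun (A_ob r M W) _) (coefs_lin (wpr N r W) (coefs_app (win N r V u.2) hw'))).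
have eF g : F g = inl_lfun _ (A_ob r N W) (wpr M r W (pmap M (f + g *: E) (win M r V u.1))) +
    inr_lfun (A_ob r M W) _ (wpr N r W (pmap N (f + g *: E) (win N r V u.2))).
  by rewrite inlE inrE; congr pair; rewrite /= ?addr0 ?add0r.
rewrite eF; apply: (coefs_subspace k_infinite hF) => g g0; rewrite -eF /F.
have dg : ((f + g *: E)%VF (0, 1)).2 = g.
  by rewrite add_lfunE scale_lfunE dsum_mapE /= d0 add0r id_lfunE [LHS]mulr1.
rewrite !wpr_block ?dg //; set h := schur_complement _.
have -> : forall (a : k) (x : A_polyfunctor r M W) (y : A_polyfunctor r N W),
    (a *: x, a *: y) = a *: ((x, y) : (A_polyfunctor r M W * A_polyfunctor r N W)%type) by [].
exact/memvZ/Rstab.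
Qed.

End Generated.

Definition stable_pairs M N (R : forall V, {vspace (M V * N V)%type}) :=
  forall V W (f : 'Hom(V, W)) z, z \in R V -> (pmap M f z.1, pmap N f z.2) \in R W.

Lemma top_weightP r M : (forall s a, (r < s)%N -> chi (s :: a) M = 0%N) -> top_weight r M.
Proof.
move=> h s V x rs.
have z := dim0_eq (wpr M s V x) 0 (chi_vanish k_infinite (fun a => h s a rs) V).
by rewrite -win_wpr // comp_lfunE z linear0.
Qed.

(* Two functors with the same character have a common nonzero subquotient,
   encoded by a subfunctor R of M x N as in Goursat's lemma. *)
Lemma common_subquotient M N : (forall a, chi a M = chi a N) -> (exists a, chi a M != 0%N) ->
  exists R : forall V, {vspace (M V * N V)%type}, stable_pairs R /\
    exists V x y, (x, y) \in R V /\ (x, 0) \notin R V.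
Proof.
have [d hd] := chi_bounded k_infinite M; move: d M N hd.
apply: ltn_ind => d IH M N hd e [a ha].
have [r [[b hb] rmax]] : exists r, (exists b, chi (r :: b) M != 0%N) /\
    forall s b, (r < s)%N -> chi (s :: b) M = 0%N.
  have exP : exists r, `[< exists b, chi (r :: b) M != 0%N >].
    by exists 0%N; apply/asboolP; exists a; rewrite chi_cons0.
  have ubP r : `[< exists b, chi (r :: b) M != 0%N >] -> (r <= d)%N.
    move=> /asboolP[b]; rewrite leqNgt; apply: contra => dr.
    by rewrite hd //= (leq_trans (ltnW dr)) ?leq_addr.
  exists (ex_maxn exP ubP); case: ex_maxnP => r /asboolP hr rm; split=> // s b rs.
  apply/eqP/negPn/negP => sb; have : (s <= r)%N by apply: rm; apply/asboolP; exists b.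
  by rewrite leqNgt rs.
(* If the largest weight is 0, then M and N are nonzero at the zero space. Transporting one nonzero
   vector of each along 0 -> V gives R. *)
case: r hb rmax => [|r] hb rmax.
  have nil0 : chi [::] M != 0%N.
    move: hb; rewrite chi_cons0 //; elim: b => // -[|s] b IHb; first by rewrite chi_cons0.
    by rewrite rmax.
  have [x x0] : exists x : M (zero_vect k), x != 0.
    exists (vpick fullv); rewrite vpick0; apply: contra nil0 => /eqP f0.
    by rewrite /= f0 dimv0.
  have [y y0] : exists y : N (zero_vect k), y != 0.
    exists (vpick fullv); rewrite vpick0; move: nil0; rewrite e; apply: contra => /eqP f0.
    by rewrite /= f0 dimv0.
  pose z V : (M V * N V)%type :=
    (pmap M (0 : 'Hom(zero_vect k, V)) x, pmap N (0 : 'Hom(zero_vect k, V)) y).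
  exists (fun V => <[z V]>%VS); split.
    move=> V W f u /vlineP[c ->] /=; rewrite !linearZ /= -!comp_lfunE -!pmapM comp_lfun0r.
    by apply/vlineP; exists c.
  have id0 : (0 : 'End(zero_vect k)) = \1%VF.
    by apply/lfunP => u; apply/dim0_eq/zero_vect_dim.
  exists (zero_vect k), x, y; rewrite /z id0 !pmap1 !id_lfunE; split; first exact: memv_line.
  apply/vlineP => -[c [ex /esym/eqP]]; rewrite scaler_eq0 (negbTE y0) orbF => /eqP c0.
  by move: x0; rewrite ex c0 scale0r eqxx.
have topM : top_weight r.+1 M by apply: top_weightP.
have topN : top_weight r.+1 N by apply: top_weightP => s c rs; rewrite -e rmax.
have dpos : (0 < d)%N.
  by rewrite lt0n; apply: contraNneq ha => d0; rewrite hd // d0.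
(* The weight [r.+1] is positive, so the degree bound drops and the induction applies to the top
   weight parts. *)
have [||||R [Rs [V [x [y [xy x0]]]]]] :=
    IH (d - r.+1)%N _ (A_polyfunctor r.+1 M) (A_polyfunctor r.+1 N).
- by rewrite ltn_subrL dpos.
- by move=> c dc; apply: (hd (r.+1 :: c)); rewrite /= -leq_subLR.
- by move=> c; apply: (e (r.+1 :: c)).
- by exists b.
exists (generated R); split; first by move=> U W f z; apply: generated_stab.
exists (V * k^o)%type, (win M r.+1 V x), (win N r.+1 V y); split.
  apply: vspan_mem; exists V, \1%VF, (x, y); split=> //.
  by rewrite !pmap1 !id_lfunE.
apply: contra x0 => /(generated_top topM topN Rs) /=.
by rewrite -!comp_lfunE wpr_win // id_lfunE linear0.
Qed.

End HighestWeight.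

(** * The Grothendieck group *)

Section AbelianGroups.
Variable G : abgroup.
Implicit Types x y z : G.

Lemma gaddK z x y : gadd x z = gadd y z -> x = y.
Proof.
move=> e; rewrite -[x]gadd0 -[y]gadd0 -(gaddN z) -!gaddA (gaddC z x) (gaddC z y).
by rewrite e.
Qed.

Lemma gaddACA x y z t : gadd (gadd x y) (gadd z t) = gadd (gadd x z) (gadd y t).
Proof. by rewrite -!gaddA; congr gadd; rewrite !gaddA (gaddC y). Qed.

Lemma gadd_rot x y z : gadd x (gadd y z) = gadd z (gadd y x).
Proof. by rewrite gaddC -gaddA [RHS]gaddC -gaddA (gaddC z). Qed.

(** The bookkeeping at the end of [cls_eq_of_chi]: x and y are the classes of the two images of R, z
    and z' those of the cokernels, t and t' those of the kernels. *)
Lemma gadd_exchange x y z z' t t' : gadd z t = gadd z' t' ->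
  gadd (gadd x z) (gadd t y) = gadd (gadd y z') (gadd t' x).
Proof. by move=> e; rewrite -!gaddA (gaddA z) e (gaddA z' t' x); apply: gadd_rot. Qed.

Lemma gadd_self x : gadd x x = x -> x = gzero.
Proof. by move=> e; apply: (@gaddK x); rewrite e gadd0. Qed.

End AbelianGroups.

Section GrothendieckIso.
Variables (k : fieldType) (k_infinite : infinite_set [set: k]%classic).
Implicit Types (L M N X Y Z : polyfunctor k) (U V W : vectType k) (a b : seq nat).
Local Notation KP := (K0 (polyfunctor_cat k)).
Local Notation chP := (ch k_infinite).

Definition cls M : KP := @K0_ob (polyfunctor_cat k) M.

Lemma cls_pexact X Y Z (i : nattrans X Y) (p : nattrans Y Z) :
  pexact i p -> cls Y = gadd (cls X) (cls Z).
Proof.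
move=> /pexact_short_exact ex; apply: K0_class_eq; apply: K0_trans (K0_ses ex) _.
by apply: K0_add; apply/K0_sym/K0_classK.
Qed.

(** If M = 0 then M -> M -> M is exact, and the class of M is its own double. *)
Lemma cls_zero M : (forall V, \dim {:M V} = 0%N) -> cls M = gzero.
Proof.
move=> M0; apply: gadd_self; symmetry; apply: (@cls_pexact M M M (nt_zero M M) (nt_zero M M)).
split=> [V x y _|V|V y]; first exact: dim0_eq.
  by apply/vspaceP => z; rewrite memvf (dim0_eq z 0 (M0 V)) mem0v.
by rewrite zero_lfunE; split=> // _; exists 0; apply: dim0_eq.
Qed.

Lemma cls_prod M N : cls (prod_pf M N) = gadd (cls M) (cls N).
Proof. exact: cls_pexact (biproduct_pexact (prod_biproduct M N)). Qed.

Lemma chi_prod a M N : chi a (prod_pf M N) = (chi a M + chi a N)%N.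
Proof. exact: (chi_pexact k_infinite a (biproduct_pexact (prod_biproduct M N))). Qed.

Section Image.
Variables (M N : polyfunctor k) (t : nattrans M N).

Definition im_pf := sub_pf (@img_stab k M N t).

Definition im_map V : 'Hom(M V, subvs_of (limg (t V))) :=
  linfun (fun x => vsproj (limg (t V)) (t V x)).

Lemma im_mapE V x : vsval (im_map V x) = t V x.
Proof.
rewrite linfunE => [|c u v]; last by rewrite !linearP.
by rewrite vsprojK // memv_img ?memvf.
Qed.

Lemma im_mapP V W (f : 'Hom(V, W)) :
  (im_map W \o pmap M f = pmap im_pf f \o im_map V)%VF.
Proof.
apply/lfunP => x; apply: subvs_inj.
rewrite comp_lfunE im_mapE -comp_lfunE ncompP comp_lfunE.
rewrite [in RHS]comp_lfunE [RHS](sub_pf_mapE (@img_stab k M N t)).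
by rewrite im_mapE.
Qed.

Definition im_nt : nattrans M im_pf := @NatTrans k M im_pf im_map im_mapP.

Lemma ker_im_pexact : pexact (sub_pf_inc (@ker_stab k M N t)) im_nt.
Proof.
have [iI _ _] := sub_quot_pexact (@ker_stab k M N t).
split=> // [V|V x].
  apply/vspaceP => q; rewrite memvf; apply/memv_imgP.
  have /memv_imgP[x _ e] := subvsP q; exists x; rewrite ?memvf //.
  by apply: subvs_inj; rewrite im_mapE.
split=> [/(congr1 (@vsval _ _ _)) e|[u <-]].
  have xk : x \in lker (t V) by rewrite memv_ker -im_mapE e.
  by exists (vsproj (lker (t V)) x); rewrite sub_pf_incE vsprojK.
apply: subvs_inj; rewrite im_mapE sub_pf_incE; apply/eqP.
by rewrite -memv_ker subvsP.
Qed.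

Lemma im_coker_pexact :
  pexact (sub_pf_inc (@img_stab k M N t)) (quot_pf_pi (@img_stab k M N t)).
Proof. exact: sub_quot_pexact. Qed.

End Image.

Lemma chi_coker a M N (t : nattrans M N) : pinj t ->
  chi a N = (chi a M + chi a (coker_pf t))%N.
Proof. by move/inj_pexact; apply: chi_pexact. Qed.

Section Measure.
Variable d : nat.

(** Up to order and zeros, sequences of length d and sum at most d exhaust the exponents of degree
    at most d. The sum is finite, additive on exact sequences, and positive on a functor of degree
    at most d with nonzero character. *)
Definition mult_sum M := (\sum_(m : 'X_{1..d < d.+1}) chi (multinom_val m) M)%N.

Lemma mult_sum_gt0 M : (forall a, (d < sumn a)%N -> chi a M = 0%N) ->
  (exists a, chi a M != 0%N) -> (0 < mult_sum M)%N.
Proof.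
move=> hd [a ha]; rewrite lt0n; apply: contra ha; rewrite sum_nat_eq0 => /forallP h.
suff : chP M = 0 by move=> /(congr1 (cf^~ a)) /eqP; rewrite cf_ch cf0.
apply: (@low_degree_eq0 d); last first.
  by move=> b; rewrite cf_ch leqNgt; apply: contra => /hd ->.
apply/mpolyP => -[u]; rewrite -cf_tuple cf_ch mcoeff0.
have [ud|du] := ltnP (mdeg (Multinom u)) d.+1.
  by have := h (BMultinom ud) => /= /eqP ->.
by rewrite hd // -mdeg_tuple.
Qed.

End Measure.

(** With t and u the projections of R to M and N, replace M by coker t ⊕ ker u and N by coker u ⊕
    ker t. Both classes change by the same amount, [R] - [im t] - [im u], and the characters remain
    equal. *)
Lemma cls_eq_of_chi d n M N : (forall a, (d < sumn a)%N -> chi a M = 0%N) ->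
  (forall a, chi a M = chi a N) -> (mult_sum d M < n)%N -> cls M = cls N.
Proof.
elim: n M N => // n IH M N hd e; rewrite ltnS => leM.
have [nz|/forallNP z] := pselect (exists a, chi a M != 0%N); last first.
  have M0 a : chi a M = 0%N by apply/eqP/negPn/negP; apply: z.
  rewrite !cls_zero // => V; apply: (chi_vanish k_infinite) => a //.
  by rewrite -e.
have [R [Rs [V0 [x [y [xy x0]]]]]] := common_subquotient k_infinite e nz.
have Rs' V W (f : 'Hom(V, W)) z : z \in R V -> pmap (prod_pf M N) f z \in R W.
  by move=> zR; rewrite /= prod_mapE; apply: Rs.
pose RF := @sub_pf k (prod_pf M N) R Rs'.
pose inc := @sub_pf_inc k (prod_pf M N) R Rs'.
pose t : nattrans RF M := nt_comp (prod_fst M N) inc.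
pose u : nattrans RF N := nt_comp (prod_snd M N) inc.
have tE V (w : RF V) : t V w = (vsval (w : subvs_of (R V))).1.
  by rewrite comp_lfunE sub_pf_incE fstE.
have uE V (w : RF V) : u V w = (vsval (w : subvs_of (R V))).2.
  by rewrite comp_lfunE sub_pf_incE sndE.
pose M' := prod_pf (coker_pf t) (ker_pf u).
pose N' := prod_pf (coker_pf u) (ker_pf t).
have chiM a : chi a M = (chi a (im_pf t) + chi a (coker_pf t))%N.
  exact: (chi_pexact k_infinite a (im_coker_pexact t)).
have chiN a : chi a N = (chi a (im_pf u) + chi a (coker_pf u))%N.
  exact: (chi_pexact k_infinite a (im_coker_pexact u)).
have chiR1 a : chi a RF = (chi a (ker_pf t) + chi a (im_pf t))%N.
  exact: (chi_pexact k_infinite a (ker_im_pexact t)).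
have chiR2 a : chi a RF = (chi a (ker_pf u) + chi a (im_pf u))%N.
  exact: (chi_pexact k_infinite a (ker_im_pexact u)).
(* As in Goursat's lemma: ker u consists of the pairs (x, 0) in R, so t is injective on it. The
   cokernel Q of v is the common subquotient; a pair (x, y) in R with (x, 0) not in R gives a
   nonzero element of it. *)
pose v : nattrans (ker_pf u) (im_pf t) := nt_comp (im_nt t) (sub_pf_inc (@ker_stab k _ _ u)).
have vE V w : vsval (v V w : subvs_of (limg (t V))) = t V (vsval (w : subvs_of (lker (u V)))).
  by rewrite comp_lfunE im_mapE sub_pf_incE.
have vI : pinj v.
  move=> V w w' /(congr1 (@vsval _ _ _)); rewrite !vE !tE => e1.
  have e2 (w'' : subvs_of (lker (u V))) : (vsval (vsval w'' : subvs_of (R V))).2 = 0.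
    by rewrite -uE; apply/eqP; rewrite -memv_ker subvsP.
  apply/subvs_inj/subvs_inj; rewrite [LHS]surjective_pairing [RHS]surjective_pairing.
  by rewrite e1 !e2.
pose Q := coker_pf v.
have chiv a : chi a (im_pf t) = (chi a (ker_pf u) + chi a Q)%N by apply: chi_coker.
have hdQ a : (d < sumn a)%N -> chi a Q = 0%N.
  by move=> /hd; rewrite chiM chiv; lia.
have Qnz : exists a, chi a Q != 0%N.
  pose z : RF V0 := vsproj (R V0) (x, y).
  apply: (@nonzero_dim _ k_infinite Q V0 (vquot_pi (limg (v V0)) (im_map t V0 z))).
  rewrite vquot_pi_eq0; apply: contra x0 => /memv_imgP[w _ /(congr1 (@vsval _ _ _))].
  rewrite im_mapE vE !tE vsprojK //= => ex.
  have wR := subvsP (vsval (w : subvs_of (lker (u V0))) : subvs_of (R V0)).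
  have w2 : (vsval (vsval (w : subvs_of (lker (u V0))) : subvs_of (R V0))).2 = 0.
    by rewrite -uE; apply/eqP; rewrite -memv_ker subvsP.
  by rewrite ex -w2 -surjective_pairing.
have chiM' a : chi a M = (chi a M' + chi a Q)%N.
  by rewrite chiM chiv chi_prod; lia.
have : cls M' = cls N'.
  apply: IH.
  - by move=> a /hd; rewrite chiM'; lia.
  - move=> a; rewrite !chi_prod; have := e a; have := chiR2 a.
    by rewrite chiR1 chiM chiN; lia.
  have eM : mult_sum d M = (mult_sum d M' + mult_sum d Q)%N.
    by rewrite -big_split; apply: eq_bigr => m _; apply: chiM'.
  by have := mult_sum_gt0 hdQ Qnz; lia.
rewrite !cls_prod => eMN.
have cM := cls_pexact (im_coker_pexact t); have cN := cls_pexact (im_coker_pexact u).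
have cR1 := cls_pexact (ker_im_pexact t); have cR2 := cls_pexact (ker_im_pexact u).
(* After adding [R] to both sides, each cokernel is completed by an image to M or N, and each kernel
   to R. *)
apply: (@gaddK _ (cls RF)).
have := gadd_exchange (cls (im_pf t)) (cls (im_pf u)) eMN.
rewrite -(cM : _ = gadd _ (cls (coker_pf t))) -(cN : _ = gadd _ (cls (coker_pf u))).
by rewrite -(cR2 : _ = gadd (cls (ker_pf u)) _) -(cR1 : _ = gadd (cls (ker_pf t)) _).
Qed.

(** * The isomorphism of K_0 with B_Z *)

Fixpoint gterm_ch (s : gterm (polyfunctor_cat k)) : BZ :=
  match s with
  | GVar M => chP M
  | GZero => 0
  | GOpp s => - gterm_ch s
  | GAdd s t => gterm_ch s + gterm_ch t
  end.

Lemma gterm_ch_eq s t : K0_eq s t -> gterm_ch s = gterm_ch t.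
Proof.
elim=> {s t} //=.
- by move=> s t u _ -> _ ->.
- by move=> s s' _ ->.
- by move=> s s' t t' _ -> _ ->.
- by move=> s t u; rewrite addrA.
- by move=> s t; rewrite addrC.
- by move=> s; rewrite add0r.
- by move=> s; rewrite addNr.
by move=> X Y Z i p /short_exact_pexact; apply: ch_pexact.
Qed.

Definition K0_ch (x : KP) : BZ := gterm_ch (K0_repr x).

Lemma K0_ch_class s : K0_ch (K0_class s) = gterm_ch s.
Proof. exact/gterm_ch_eq/K0_classK. Qed.

Lemma K0_ch_cls M : K0_ch (cls M) = chP M.
Proof. exact: K0_ch_class. Qed.

Lemma K0_chD (x y : KP) : K0_ch (gadd x y) = K0_ch x + K0_ch y.
Proof. exact: K0_ch_class. Qed.

(** This reduces injectivity on K_0 to a comparison of two functors: signed sums collapse because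
    direct sums realize addition. *)
Lemma K0_difference (x : KP) : exists M N, gadd x (cls N) = cls M.
Proof.
have addE (s t : gterm (polyfunctor_cat k)) :
    K0_class (GAdd s t) = gadd (K0_class s : KP) (K0_class t).
  by apply: K0_class_eq; apply: K0_add; apply/K0_sym/K0_classK.
have oppE (t : gterm (polyfunctor_cat k)) : K0_class (GOpp t) = gopp (K0_class t : KP).
  by apply: K0_class_eq; apply/K0_opp/K0_sym/K0_classK.
have z0 : cls (const_pf (zero_vect k)) = gzero.
  by apply: cls_zero => V; apply: zero_vect_dim.
rewrite -[x]K0_reprK; elim: (K0_repr x) => [M||s [M [N e]]|s [M [N e]] t [M' [N' e']]].
- by exists M, (const_pf (zero_vect k)); rewrite z0 gaddC gadd0.
- by exists (const_pf (zero_vect k)), (const_pf (zero_vect k)); rewrite z0; apply: gadd0.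
- exists N, M; rewrite oppE -e gaddA gaddN; exact: gadd0.
exists (prod_pf M M'), (prod_pf N N').
by rewrite !cls_prod addE gaddACA e e'.
Qed.

Lemma cls_eq M N : chP M = chP N -> cls M = cls N.
Proof.
move=> e; have [d hd] := chi_bounded k_infinite M.
apply: (@cls_eq_of_chi d (mult_sum d M).+1) => // [a da|a]; first by apply: hd; apply: ltnW.
by have /(congr1 (cf^~ a)) := e; rewrite !cf_ch => -[].
Qed.

Lemma K0_ch_inj : injective K0_ch.
Proof.
move=> x y e; have [M [N eM]] := K0_difference x; have [M' [N' eM']] := K0_difference y.
have : cls (prod_pf M N') = cls (prod_pf M' N).
  apply: cls_eq; rewrite -!K0_ch_cls !cls_prod !K0_chD -eM -eM' !K0_chD e.
  by rewrite addrAC.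
rewrite !cls_prod -eM -eM' -!gaddA (gaddC (cls N')) => h.
exact: gaddK h.
Qed.

Fixpoint gterm_map (F : polyfunctor k -> polyfunctor k) (s : gterm (polyfunctor_cat k)) :
    gterm (polyfunctor_cat k) :=
  match s with
  | GVar M => GVar (F M : polyfunctor_cat k)
  | GZero => GZero _
  | GOpp s => GOpp (gterm_map F s)
  | GAdd s t => GAdd (gterm_map F s) (gterm_map F t)
  end.

(** Surjectivity only asks for some preimage, so multiplication by e_r is lifted to terms. *)
Lemma gterm_ch_map_B r s : gterm_ch (gterm_map (B_polyfunctor r) s) = e_ r * gterm_ch s.
Proof.
elim: s => /= [M||s ->|s -> t ->]; first exact: ch_B.
- by rewrite mulr0.
- by rewrite mulrN.
by rewrite mulrDr.
Qed.

(** The property of f to be generated is that the image of [K0_ch] is stable under multiplication by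
    f, which is closed under products; for e_r it is [ch_B]. Apply it to 1, the character of the
    constant functor k. *)
Lemma K0_ch_surj f : exists x, K0_ch x = f.
Proof.
suff /(_ (cls (const_pf (k^o : vectType k))))[x e] : forall x, exists y, K0_ch y = f * K0_ch x.
  by exists x; rewrite e K0_ch_cls ch_const mulr1.
move: f; apply: e_generate.
- by move=> x; exists x; rewrite mul1r.
- move=> f g hf hg x; have [y ey] := hf x; have [z ez] := hg x.
  exists (gadd y (gopp z)); rewrite K0_chD ey mulrBl; congr (_ + _).
  apply: (addrI (K0_ch z)); rewrite -K0_chD gaddC gaddN -ez subrr.
  exact: K0_ch_class.
- by move=> f g hf hg x; have [y ey] := hg x; have [z ez] := hf y; exists z; rewrite ez ey mulrA.
move=> r x; exists (K0_class (gterm_map (B_polyfunctor r) (K0_repr x))).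
by rewrite K0_ch_class gterm_ch_map_B.
Qed.

Definition K0_ch_inv f : KP := projT1 (cid (K0_ch_surj f)).

Lemma K0_ch_invK : cancel K0_ch_inv K0_ch.
Proof. by move=> f; rewrite /K0_ch_inv; case: cid. Qed.

Lemma K0_chK : cancel K0_ch K0_ch_inv.
Proof. by move=> x; apply: K0_ch_inj; rewrite K0_ch_invK. Qed.

(** Transport of structure along the bijection [K0_ch]: the module axioms are inherited, and [ch_A]
    and [ch_B] identify the generators with the operators induced by the functors. *)
Definition K0_act (a : HZ) (x : KP) : KP := K0_ch_inv (fock a (K0_ch x)).

Lemma K0_actDr (a : HZ) (x y : KP) : K0_act a (gadd x y) = gadd (K0_act a x) (K0_act a y).
Proof. by apply: K0_ch_inj; rewrite K0_chD !K0_ch_invK K0_chD; apply: (ractDr fock). Qed.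

Lemma K0_actDl (a b : HZ) (x : KP) : K0_act (a + b) x = gadd (K0_act a x) (K0_act b x).
Proof. by apply: K0_ch_inj; rewrite K0_chD !K0_ch_invK; apply: (ractDl fock). Qed.

Lemma K0_actM (a b : HZ) (x : KP) : K0_act (a * b) x = K0_act a (K0_act b x).
Proof. by apply: K0_ch_inj; rewrite !K0_ch_invK; apply: (ractM fock). Qed.

Lemma K0_act1 (x : KP) : K0_act 1 x = x.
Proof. by apply: K0_ch_inj; rewrite K0_ch_invK; apply: (ract1 fock). Qed.

Definition K0_representation : representation HZ KP :=
  Representation K0_actDr K0_actDl K0_actM K0_act1.

Lemma fock_categorification :
  weak_HZ_categorification (@functorA k) (@functorB k) fock.
Proof.
split.
- exact: polyfunctor_abelian.
- exact: relation_AB.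
- exact: relation_AB0.
- exact: relation_AA.
- exact: relation_BB.
exists K0_representation; split=> [n M|n M|].
- apply: K0_ch_inj; rewrite [LHS]K0_ch_invK [X in fock _ X]K0_ch_cls fock_h.
  by rewrite [RHS]K0_ch_cls [RHS]ch_A.
- apply: K0_ch_inj; rewrite [LHS]K0_ch_invK [X in fock _ X]K0_ch_cls fock_e.
  by rewrite [RHS]K0_ch_cls [RHS]ch_B.
exists K0_ch; split; first by exists K0_ch_inv; [apply: K0_chK|apply: K0_ch_invK].
  exact: K0_chD.
by move=> a x; rewrite [LHS]K0_ch_invK.
Qed.

End GrothendieckIso.

Unset Implicit Arguments.

Theorem theorem7p9 (k : fieldType) (k_infinite : infinite_set [set: k]%classic) :
  exists Fock : representation HZ (zmod_abgroup BZ),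
    is_Fock Fock /\
    weak_HZ_categorification (@functorA k) (@functorB k) Fock.
Proof.
by exists fock; split; [apply: is_Fock_fock|apply: fock_categorification].
Qed.
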